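(* There exist $\Theta>0$ and $M<\infty$ such that for every positive even integer $n$, every integer $k$ with $\frac13n\le k\le\frac23n$, and every probable value $s$ of $S_n$, writing $W_1:=S_k[n,0]$, $W_2:=S_{4k}[4n,0]$ and $W:=S_k[n,s]-\frac{sk}{n}$, there are couplings (1) of $W_1$ with $W_2$ such that $\mathbf{E}\left[e^{\theta|2W_1-W_2|}\right]\le\frac32$ for all $\theta\le\Theta$, and (2) of $W_1$ with $W$ such that $\mathbf{E}\left[e^{\theta|W_1-W|}\right]\le e^{1+M\theta^2\frac{s^2}{n}}$ for all $\theta\le\Theta$.
   Context: $S_n=X_1+\ldots+X_n$ where $X_1,X_2,\ldots$ are i.i.d. with $X_i=\pm1$ with probability $1/2$ each. An integer $s$ is a probable value of $S_n$ if $\mathbf{P}\{S_n=s\}>0$, equivalently $|s|\le n$ and $n-s$ is even. For $0\le k\le n$ and a probable value $s$ of $S_n$, $S_k[n,s]$ denotes a random variable whose distribution is the conditional distribution of $S_k$ given $S_n=s$ (equivalently, the sum of the first $k$ coupons drawn uniformly without replacement from a box of $n$ coupons, of which $(n+s)/2$ are labeled $+1$ and $(n-s)/2$ are labeled $-1$). A coupling of random variables $X,Y$ satisfying certain statements means a probability space carrying random variables with the same marginal distributions as $X$ and $Y$ respectively and satisfying the stated mutual relationships. *)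

(* Defs.v *)
From HB Require Import structures.
From mathcomp Require Import all_boot all_order all_algebra.
From mathcomp Require Import all_classical all_reals all_analysis.

Set Implicit Arguments.
Unset Strict Implicit.
Unset Printing Implicit Defensive.

Import Order.TTheory GRing.Theory Num.Theory.
Import numFieldNormedType.Exports.

Local Open Scope classical_set_scope.
Local Open Scope ring_scope.
Local Open Scope ereal_scope.

Section Walk.
Context (d : measure_display) (T : measurableType d) (R : realType).
Variables (P : probability T R) (X : nat -> {RV P >-> R}).

(* Mutual independence: the product rule over every finite subfamily. *)
Definition independent_RVs : Prop :=
  forall (J : seq nat) (A : nat -> set R),
    uniq J -> (forall i, measurable (A i)) ->
    P (\bigcap_(i in [set` J]) X i @^-1` A i) =
    \prod_(i <- J) P (X i @^-1` A i).

Definition iid_fair_signs : Prop :=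
  independent_RVs /\
  forall i, P (X i @^-1` [set 1%R]) = (2^-1)%:E /\
            P (X i @^-1` [set (-1)%R]) = (2^-1)%:E.

(* The steps are indexed from 0, so the first n of them are X 0, ..., X n.-1. *)
Definition walk (n : nat) (w : T) : R := (\sum_(i < n) X i w)%R.

Definition probable (n : nat) (s : int) : Prop :=
  0 < P [set w | walk n w = s%:~R%R].

(* The conditional distribution of S_k given S_n = s; only meaningful when s is
   a probable value of S_n, as x / 0 is a junk value. *)
Definition bridge_law (k n : nat) (s : int) (A : set R) : \bar R :=
  P (walk k @^-1` A `&` [set w | walk n w = s%:~R%R]) /
  P [set w | walk n w = s%:~R%R].

End Walk.

(* The distribution of Z - c when Z has distribution mu. *)
Definition shifted_law (R : realType) (mu : set R -> \bar R) (c : R) :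
  set R -> \bar R := fun A => mu ((fun x => x - c)%R @^-1` A).

Definition is_coupling (d : measure_display) (T : measurableType d)
    (R : realType) (Q : probability T R) (U V : {RV Q >-> R})
    (mu nu : set R -> \bar R) : Prop :=
  forall A : set R, measurable A ->
    distribution Q U A = mu A /\ distribution Q V A = nu A.

(* Main.v *)
(* The conditional law of S_k given S_n = s is hypergeometric; two such laws are
   coupled monotonically, through their quantiles.

   If the ratio of the two weight functions, after a shift by b, is monotone on
   a window, then the distribution functions are ordered up to that shift and
   up to the masses outside the window.  Ratios of consecutive hypergeometric
   weights are explicit rational functions, so an admissible b is found by
   algebra alone, with no normalising constant and no local limit theorem.
   Drawing the coupons one at a time bounds the moment generating function, so
   the masses outside the window are exponentially small, and a second shift
   by b absorbs them because the weights vary slowly.  Letting the window grow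
   with the distance x of the quantile from the mean bounds the displacement by
   C (1 + x^2/n) between the scales n and 4n, and by
   C (1 + |s|/sqrt n + |s| |x|/n + x^2/n) between s and 0; both have the
   required exponential moments.  When |s| is of order n, the bound
   |W_1 - W| <= |W_1| + |W| is enough. *)

Require Import Defs.
From HB Require Import structures.
From mathcomp Require Import all_boot all_order all_algebra.
From mathcomp Require Import all_classical all_reals all_analysis.
From mathcomp Require Import measurable_realfun.
From mathcomp Require Import ring lra zify.

Set Implicit Arguments.
Unset Strict Implicit.
Unset Printing Implicit Defensive.

Import Order.TTheory GRing.Theory Num.Theory.
Import numFieldNormedType.Exports.

Local Open Scope ring_scope.

(** * Hypergeometric weights and their exponential moments *)

(** The window radius Y is under two opposite demands. The first shift must beat error terms that
    grow with Y ([drift]), while the mass outside, about e^{-cY^2/n}, must be beaten by the mass of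
    b consecutive points. Two radii settle this: within Z = 2Y/K of the centre, slow variation
    bounds the weights below by about e^{-c'Z^2/n}, which exceeds the tails beyond Y once K is
    large. With sg = |s|/n, the base radius is n^{5/8}, capped at sqrt(n)/sg; there the shift is O(1
    + |s|/sqrt n). Farther out Y is a multiple of x. The two scales live on different lattices: 2W_1
    moves in steps of 4, W_2 in steps of 2. Neighbouring atoms of W_2 are therefore merged in pairs,
    and the square of a ratio at scale 4n is compared with one ratio at scale n. Only upper bounds
    on the quantile map are proved directly; exchanging the labels +1 and -1 yields the lower ones.
    A moment that is merely bounded at a fixed rate is brought close to 1 at small rates by
    convexity, which fixes Theta. *)

(* [hypw k m N a / 'C(k + m, N)] is the probability that the first [k] of
   [k + m] coupons, [N] of them labelled +1, contain exactly [a] labels +1. *)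
Definition hypw (k m N a : nat) : nat :=
  if (a <= N)%N then ('C(k, a) * 'C(m, N - a))%N else 0%N.

Definition hyp (R : realType) (k m N a : nat) : R :=
  (hypw k m N a)%:R / ('C(k + m, N))%:R.

Lemma hypw_eq0 k m N a : (k < a)%N -> hypw k m N a = 0%N.
Proof. by move=> ka; rewrite /hypw; case: ifP => // _; rewrite bin_small. Qed.

Lemma hypwSS k m N a :
  hypw k.+1 m N.+1 a.+1 = (hypw k m N.+1 a.+1 + hypw k m N a)%N.
Proof.
rewrite /hypw ltnS; case: ifP => // _; rewrite binS mulnDl subSS.
by [].
Qed.

Lemma hypw0 k m N : hypw k m N 0 = 'C(m, N).
Proof. by rewrite /hypw bin0 mul1n subn0. Qed.

Section Hypergeometric.
Variable R : realType.
Implicit Types (k m N a : nat) (t u x y : R).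

(** Condition on one drawn coupon: Pascal's rule splits the weight according to its label, and a
    label +1 contributes the factor [t]. *)
Lemma sum_hypw_S k m N t :
  \sum_(a < k.+2) (hypw k.+1 m N.+1 a)%:R * t ^+ a =
  \sum_(a < k.+1) (hypw k m N.+1 a)%:R * t ^+ a +
  t * \sum_(a < k.+1) (hypw k m N a)%:R * t ^+ a.
Proof.
rewrite big_ord_recl /=.
under eq_bigr => i _ do rewrite /bump /= add1n hypwSS natrD mulrDl.
rewrite big_split /= addrA; congr (_ + _); last first.
  by rewrite mulr_sumr; apply: eq_bigr => i _; rewrite exprS mulrCA.
rewrite !hypw0 [in RHS]big_ord_recl /= hypw0; congr (_ + _).
rewrite big_ord_recr /= hypw_eq0 // mul0r addr0.
by apply: eq_bigr => i _; rewrite /bump /= add1n.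
Qed.

Lemma sum_hypw_0 k m t : \sum_(a < k.+1) (hypw k m 0 a)%:R * t ^+ a = 1.
Proof.
rewrite big_ord_recl /= hypw0 bin0 mul1r big1 ?addr0 // => i _.
by rewrite /hypw /= mul0r.
Qed.

(** From e^{-u} >= 1 - u, since (1 + u + 2u^2)(1 - u) = 1 + u^2(1 - 2u) >= 1. *)
Lemma expR_le_quad u : `|u| <= 1 / 2 -> expR u <= 1 + u + 2 * u ^+ 2.
Proof.
move=> /ler_normlP [u1 u2].
have h := expR_ge1Dx (- u); rewrite expRN in h.
have e0 := expR_gt0 u.
have : expR u * (1 - u) <= 1.
  by rewrite -[leRHS](divff (lt0r_neq0 e0)) ler_pM2l.
move=> h2; rewrite -(ler_pM2r (x := 1 - u)); last lra.
by apply: le_trans h2 _; nra.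
Qed.

(** The linear terms cancel because the variable is centred, and p(1 - p) <= 1/4 leaves at most 1 +
    u^2/2. *)
Lemma two_point_mgf (p : R) u : 0 <= p <= 1 -> `|u| <= 1 / 2 ->
  p * expR (u * (1 - p)) + (1 - p) * expR (- (u * p)) <= expR (u ^+ 2).
Proof.
move=> /andP[p0 p1] hu.
have h1 : `|u * (1 - p)| <= 1 / 2.
  rewrite normrM (ger0_norm (x := 1 - p)); last lra.
  have := normr_ge0 u; nra.
have h2 : `|- (u * p)| <= 1 / 2.
  rewrite normrN normrM (ger0_norm (x := p)) //.
  have := normr_ge0 u; nra.
have {}h1 := expR_le_quad h1; have {}h2 := expR_le_quad h2.
apply: le_trans (expR_ge1Dx _).
apply: (@le_trans _ _ (p * (1 + u * (1 - p) + 2 * (u * (1 - p)) ^+ 2) +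
   (1 - p) * (1 + - (u * p) + 2 * (- (u * p)) ^+ 2))).
  apply: lerD; apply: ler_wpM2l => //; lra.
have -> : p * (1 + u * (1 - p) + 2 * (u * (1 - p)) ^+ 2) +
   (1 - p) * (1 + - (u * p) + 2 * (- (u * p)) ^+ 2) =
   1 + 2 * (p * (1 - p)) * u ^+ 2 by ring.
have q1 : p * (1 - p) <= 1 / 4 by have := sqr_ge0 (p - 1 / 2); rewrite expr2; lra.
have := sqr_ge0 u; nra.
Qed.

(** A Doob martingale: revealing one coupon moves the conditional mean of the count by al(1 - p) or
    -al p, where al = m/(k + m) and p is the proportion of labels +1. Each step costs one factor
    e^{t^2} by [two_point_mgf] at u = t al. *)
Lemma hypw_mgf k m N t : (0 < m)%N -> `|t| <= 1 / 2 ->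
  \sum_(a < k.+1) (hypw k m N a)%:R * expR t ^+ a <=
  ('C(k + m, N))%:R * expR (t * (k%:R * N%:R / (k + m)%:R) + k%:R * t ^+ 2).
Proof.
move=> m0 ht; elim: k N => [|k IH] N.
  by rewrite big_ord1 hypw0 expr0 mulr1 !mul0r mulr0 addr0 expR0 mulr1 add0n.
case: N => [|N].
  rewrite sum_hypw_0 bin0 mul1r mulr0 mul0r mulr0 add0r -expR0 ler_expR.
  by rewrite mulr_ge0 // sqr_ge0.
rewrite sum_hypw_S.
(* With more labels than coupons everything vanishes. The induction passes through such values,
   hence the unnormalised form of the bound. *)
have [nN|Nn] := ltnP (k.+1 + m) N.+1.
  have IH1 := IH N.+1; have IH2 := IH N.
  rewrite !bin_small ?mul0r; try lia.
  rewrite bin_small ?mul0r in IH1; last lia.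
  rewrite bin_small ?mul0r in IH2; last lia.
  have := expR_ge0 t; nra.
set n := (k.+1 + m)%:R : R.
have n0 : 0 < n by rewrite ltr0n.
have n1 : 0 < (k + m)%:R :> R by rewrite ltr0n; lia.
have nE : n = (k + m)%:R + 1 by rewrite /n addSn -natr1.
pose p : R := N.+1%:R / n.
have p0 : 0 <= p by rewrite divr_ge0 // ltW.
have p1 : p <= 1 by rewrite ler_pdivrMr // mul1r ler_nat.
have C1 : ('C(k + m, N))%:R = p * ('C(k.+1 + m, N.+1))%:R :> R.
  have := mul_bin_diag (k.+1 + m) N; rewrite addSn /= => /(congr1 (fun i => i%:R : R)).
  rewrite !natrM /p /n -addSn => h.
  by apply: (mulfI (lt0r_neq0 n0)); rewrite h mulrA mulrCA divff ?mulr1 // lt0r_neq0.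
have C2 : ('C(k + m, N.+1))%:R = (1 - p) * ('C(k.+1 + m, N.+1))%:R :> R.
  by rewrite mulrBl mul1r -C1 addSn binS natrD addrK.
pose al : R := m%:R / (k + m)%:R.
have al0 : 0 <= al by rewrite divr_ge0.
have al1 : al <= 1 by rewrite ler_pdivrMr // mul1r ler_nat leq_addl.
have hu : `|t * al| <= 1 / 2.
  rewrite normrM (ger0_norm al0); have := normr_ge0 t; nra.
have key := two_point_mgf (introT andP (conj p0 p1)) hu.
have IH1 := IH N.+1; have IH2 := IH N; rewrite C1 in IH2; rewrite C2 in IH1.
have et := expR_gt0 t.
apply: (le_trans (lerD IH1 (ler_wpM2l (ltW et) IH2))).
set C := ('C(k.+1 + m, N.+1))%:R : R.
set E := expR (t * (k.+1%:R * N.+1%:R / n) + k%:R * t ^+ 2).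
have E1 : expR (t * (k%:R * N.+1%:R / (k + m)%:R) + k%:R * t ^+ 2) =
   E * expR (- (t * al * p)).
  rewrite /E -expRD; congr expR; rewrite /al /p nE natrD -[k.+1%:R]natr1.
  move: n1 n0; rewrite nE !natrD => n1 n0.
  by field; rewrite !lt0r_neq0.
have E2 : expR t * expR (t * (k%:R * N%:R / (k + m)%:R) + k%:R * t ^+ 2) =
   E * expR (t * al * (1 - p)).
  rewrite /E -!expRD; congr expR; rewrite /al /p nE natrD -[k.+1%:R]natr1 -[N.+1%:R]natr1.
  move: n1 n0; rewrite nE !natrD => n1 n0.
  by field; rewrite !lt0r_neq0.
have -> : (1 - p) * C * expR (t * (k%:R * N.+1%:R / (k + m)%:R) + k%:R * t ^+ 2) +
  expR t * (p * C * expR (t * (k%:R * N%:R / (k + m)%:R) + k%:R * t ^+ 2)) =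
  C * E * (p * expR (t * al * (1 - p)) + (1 - p) * expR (- (t * al * p))).
  rewrite E1 [X in _ + X]mulrCA E2; ring.
have -> : expR (t * (k.+1%:R * N.+1%:R / n) + k.+1%:R * t ^+ 2) = E * expR (t ^+ 2).
  by rewrite /E -expRD -natr1; congr expR; ring.
rewrite mulrA ler_wpM2l //; first by rewrite mulr_ge0 ?expR_ge0.
apply: le_trans key _; rewrite ler_expR exprMn ler_piMr ?sqr_ge0 //.
by rewrite expr_le1.
Qed.

Lemma sum_hypw k m N : \sum_(a < k.+1) (hypw k m N a)%:R = ('C(k + m, N))%:R :> R.
Proof.
have E k' N' : \sum_(a < k'.+1) (hypw k' m N' a)%:R * (1 : R) ^+ a =
    \sum_(a < k'.+1) (hypw k' m N' a)%:R.
  by apply: eq_bigr => a _; rewrite expr1n mulr1.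
elim: k N => [|k IH] N; first by rewrite big_ord1 hypw0 add0n.
case: N => [|N]; first by rewrite -E sum_hypw_0 bin0.
by rewrite -E sum_hypw_S mul1r !E !IH -natrD -binS addSn.
Qed.

Lemma binR_gt0 n N : (N <= n)%N -> 0 < ('C(n, N))%:R :> R.
Proof. by rewrite ltr0n bin_gt0. Qed.

Lemma hyp_ge0 k m N a : 0 <= hyp R k m N a.
Proof. by rewrite divr_ge0. Qed.

Lemma hyp_eq0 k m N a : (k < a)%N -> hyp R k m N a = 0.
Proof. by move=> ka; rewrite /hyp hypw_eq0 // mul0r. Qed.

Lemma sum_hyp k m N : (N <= k + m)%N -> \sum_(a < k.+1) hyp R k m N a = 1.
Proof.
by move=> Nn; rewrite -mulr_suml sum_hypw divff // lt0r_neq0 // binR_gt0.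
Qed.

(** Cross-multiplied and with real subtraction, so that it holds outside the support as well. *)
Lemma hypw_ratio k m N a :
  (hypw k m N a.+1)%:R * ((a%:R + 1) * (m%:R - N%:R + a%:R + 1)) =
  (hypw k m N a)%:R * ((k%:R - a%:R) * (N%:R - a%:R)) :> R.
Proof.
have bin_ratio n i : ('C(n, i.+1))%:R * (i%:R + 1) = ('C(n, i))%:R * (n%:R - i%:R) :> R.
  rewrite natr1 -natrM mulnC mul_bin_left natrM mulrC.
  have [ni|ni] := leqP i n; first by rewrite natrB.
  by rewrite bin_small ?mul0r.
rewrite /hypw; have [aN|Na] := ltnP a N; last first.
  rewrite mul0r; case: ifP => [aN|_]; last by rewrite mul0r.
  have -> : N = a by lia.
  by rewrite subrr !mulr0.
rewrite (ltnW aN) !natrM.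
have e := bin_ratio m (N - a.+1)%N.
have -> : m%:R - N%:R + a%:R + 1 = m%:R - (N - a.+1)%:R :> R.
  by rewrite natrB // -natr1; ring.
have e2 : (N - a.+1)%:R + 1 = N%:R - a%:R :> R.
  by rewrite natrB // -natr1; ring.
rewrite subnSK // e2 in e.
rewrite mulrACA bin_ratio mulrACA mulrACA [RHS]mulrACA -e; ring.
Qed.

Lemma hyp_ratio k m N a :
  hyp R k m N a.+1 * ((a%:R + 1) * (m%:R - N%:R + a%:R + 1)) =
  hyp R k m N a * ((k%:R - a%:R) * (N%:R - a%:R)).
Proof. by rewrite /hyp mulrAC hypw_ratio mulrAC. Qed.

Lemma hyp_gt0 k m N a : (a <= k)%N -> (a <= N)%N -> (N <= m + a)%N ->
  0 < hyp R k m N a.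
Proof.
move=> ak aN Nm; rewrite divr_gt0 // ltr0n ?bin_gt0; last lia.
by rewrite /hypw aN muln_gt0 !bin_gt0 ak; lia.
Qed.

(** Exchanging the labels +1 and -1. This reflection later turns upper bounds on quantiles into
    lower bounds. *)
Lemma hyp_rev k m N a : (N <= k + m)%N -> (a <= k)%N ->
  hyp R k m (k + m - N) (k - a) = hyp R k m N a.
Proof.
move=> Nn ak; rewrite /hyp bin_sub //; congr (_%:R / _).
rewrite /hypw bin_sub //.
have [aN|Na] := leqP a N; last first.
  by case: ifP => // h; rewrite (@bin_small m) ?muln0 //; lia.
have [Nm|mN] := leqP (N - a) m; last first.
  rewrite [in RHS](@bin_small m) // muln0; case: ifP => // h; exfalso; lia.
have -> : (k - a <= k + m - N)%N by lia.
by rewrite -(bin_sub Nm); congr (_ * 'C(_, _))%N; lia.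
Qed.

Definition hyp_mean k m N : R := k%:R * N%:R / (k + m)%:R.

Lemma hyp_mgf k m N t : (0 < m)%N -> (N <= k + m)%N -> `|t| <= 1 / 2 ->
  \sum_(a < k.+1) hyp R k m N a * expR (t * (a%:R - hyp_mean k m N)) <=
  expR ((k + m)%:R * t ^+ 2).
Proof.
move=> m0 Nn ht; have C0 := binR_gt0 Nn.
have h := hypw_mgf k N m0 ht.
set mu := hyp_mean k m N.
have -> : \sum_(a < k.+1) hyp R k m N a * expR (t * (a%:R - mu)) =
   (\sum_(a < k.+1) (hypw k m N a)%:R * expR t ^+ a) / ('C(k + m, N))%:R * expR (- (t * mu)).
  rewrite !mulr_suml; apply: eq_bigr => a _.
  rewrite /hyp mulrBr expRD expRM_natr; ring.
rewrite -ler_pdivlMr ?expR_gt0 // ler_pdivrMr //.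
apply: (le_trans h); rewrite mulrC ler_wpM2r ?(ltW C0) //.
rewrite -expRN opprK -expRD ler_expR [leRHS]addrC lerD2l //.
by rewrite ler_wpM2r ?sqr_ge0 // ler_nat leq_addr.
Qed.

Lemma hyp_absmgf k m N t : (0 < m)%N -> (N <= k + m)%N -> 0 <= t -> t <= 1 / 2 ->
  \sum_(a < k.+1) hyp R k m N a * expR (t * `|a%:R - hyp_mean k m N|) <=
  2 * expR ((k + m)%:R * t ^+ 2).
Proof.
move=> m0 Nn t0 ht.
have h1 := @hyp_mgf k m N t m0 Nn; have h2 := @hyp_mgf k m N (- t) m0 Nn.
rewrite normrN sqrrN ger0_norm // in h1 h2.
have -> : 2 * expR ((k + m)%:R * t ^+ 2) =
  expR ((k + m)%:R * t ^+ 2) + expR ((k + m)%:R * t ^+ 2) by ring.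
apply: le_trans (lerD (h1 ht) (h2 ht)).
rewrite -big_split /=; apply: ler_sum => a _.
rewrite -mulrDr; apply: ler_wpM2l; first exact: hyp_ge0.
have [x0|x0] := leP 0 (a%:R - hyp_mean k m N).
  by rewrite ger0_norm // lerDl expR_ge0.
by rewrite ltr0_norm // mulrN mulNr lerDr expR_ge0.
Qed.

(** Chernoff bound at t = Y/(2(k + m)), the minimiser of (k + m)t^2 - tY; the upper bound on Y keeps
    t <= 1/2. *)
Lemma hyp_tail k m N Y : (0 < m)%N -> (N <= k + m)%N -> 0 <= Y <= (k + m)%:R ->
  \sum_(a < k.+1 | Y <= `|a%:R - hyp_mean k m N|) hyp R k m N a <=
  2 * expR (- (Y ^+ 2 / (4 * (k + m)%:R))).
Proof.
move=> m0 Nn /andP[Y0 Yn].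
have n0 : 0 < (k + m)%:R :> R by rewrite ltr0n; lia.
pose t : R := Y / (2 * (k + m)%:R).
have t0 : 0 <= t by rewrite divr_ge0 // mulr_ge0 // ltW.
have t1 : t <= 1 / 2.
  by rewrite /t ler_pdivrMr ?mulr_gt0 //; lra.
have h := hyp_absmgf m0 Nn t0 t1.
have -> : - (Y ^+ 2 / (4 * (k + m)%:R)) = (k + m)%:R * t ^+ 2 - t * Y.
  by rewrite /t; move: ((k + m)%:R) (lt0r_neq0 n0) => n nz; field.
rewrite expRD mulrA expRN ler_pdivlMr ?expR_gt0 //.
apply: le_trans h; rewrite big_mkcond /= mulr_suml; apply: ler_sum => a _.
case: ifP => hY; last by rewrite mul0r mulr_ge0 ?hyp_ge0 ?expR_ge0.
by rewrite ler_wpM2l ?hyp_ge0 // ler_expR ler_wpM2l.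
Qed.

Lemma expR_layer (J : nat) (c q : R) : 0 <= c -> 0 <= q -> q <= J%:R ->
  expR (c * q) <= \sum_(j < J.+1) (j%:R <= q)%R%:R * expR (c * (j%:R + 1)).
Proof.
move=> c0 q0; elim: J => [|J IH] qJ.
  rewrite big_ord1 /= q0 mul1r ler_expR ler_wpM2l //.
  by move: qJ; rewrite !mulr0n; lra.
rewrite big_ord_recr /=; have [qJ1|qJ1] := leP q J%:R.
  by apply: (le_trans (IH qJ1)); rewrite lerDl mulr_ge0 ?expR_ge0.
rewrite big_ord_recr /= (ltW qJ1) mul1r -addrA addrCA.
apply: (@le_trans _ _ (expR (c * (J%:R + 1)))).
  by rewrite ler_expR ler_wpM2l // natr1.
rewrite lerDl addr_ge0 // ?sumr_ge0 // => [i _|]; by rewrite mulr_ge0 ?expR_ge0.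
Qed.

Lemma geometric_sum_le (J : nat) (z : R) : 0 <= z < 1 ->
  \sum_(j < J) z ^+ j <= (1 - z)^-1.
Proof.
move=> /andP[z0 z1]; have z2 : 0 < 1 - z by rewrite subr_gt0.
rewrite -(ler_pM2r z2) mulVf ?lt0r_neq0 // mulr_suml.
have -> : \sum_(j < J) z ^+ j * (1 - z) = 1 - z ^+ J.
  elim: J => [|J IH]; first by rewrite big_ord0 expr0 subrr.
  by rewrite big_ord_recr /= IH exprS; ring.
by rewrite gerBl exprn_ge0.
Qed.

(* Layer cake over the integer part of x^2/n. *)
Lemma hyp_sqmgf : exists B : R, forall k m N, (0 < m)%N -> (N <= k + m)%N ->
  \sum_(a < k.+1) hyp R k m N a *
    expR (64^-1 * ((a%:R - hyp_mean k m N) ^+ 2 / (k + m)%:R)) <= B.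
Proof.
(* The tail at level j decays like e^{-j/4} and the layer grows like e^{j/64}; since 1/4 - 1/64 >
   1/8, a geometric series of ratio e^{-1/8} dominates. *)
pose z : R := expR (- (8^-1)).
exists (2 * expR (64^-1) * (1 - z)^-1) => k m N m0 Nn.
have n0 : 0 < (k + m)%:R :> R by rewrite ltr0n; lia.
set mu := hyp_mean k m N.
have mu0 : 0 <= mu by rewrite divr_ge0 ?mulr_ge0 // ltW.
have muk : mu <= (k + m)%:R.
  by rewrite ler_pdivrMr // -!natrM ler_nat leq_mul // leq_addr.
apply: (@le_trans _ _ (\sum_(a < k.+1) \sum_(j < (k + m).+1)
   hyp R k m N a * ((j%:R <= (a%:R - mu) ^+ 2 / (k + m)%:R)%R%:R * expR (64^-1 * (j%:R + 1))))).
  apply: ler_sum => a _; rewrite -mulr_sumr ler_wpM2l ?hyp_ge0 //.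
  apply: expR_layer => //; first by rewrite divr_ge0 ?sqr_ge0 // ltW.
  rewrite ler_pdivrMr // -expr2 -real_normK ?num_real // lerXn2r ?nnegrE ?(ltW n0) //.
  rewrite ler_norml; have ak : a%:R <= (k + m)%:R :> R by rewrite ler_nat; have := ltn_ord a; lia.
  have := ler0n R a; lra.
rewrite exchange_big /=.
apply: (@le_trans _ _ (\sum_(j < (k + m).+1) 2 * expR (64^-1) * z ^+ j)); last first.
  rewrite -mulr_sumr ler_wpM2l ?mulr_ge0 ?expR_ge0 // geometric_sum_le //.
  by rewrite expR_ge0 expR_lt1 oppr_lt0 invr_gt0 ltr0n.
apply: ler_sum => j _.
have jn : j%:R <= (k + m)%:R :> R by rewrite ler_nat -ltnS.
have j0 := ler0n R j.
(* The level x^2/n >= j is |x| >= sqrt(jn), which is at most n because only the layers j <= n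
   occur. *)
pose Y : R := Num.sqrt (j%:R * (k + m)%:R).
have Y2 : Y ^+ 2 = j%:R * (k + m)%:R by rewrite sqr_sqrtr // mulr_ge0.
have Yr : 0 <= Y <= (k + m)%:R.
  rewrite sqrtr_ge0 /= -(@ler_pXn2r _ 2) ?nnegrE ?sqrtr_ge0 //.
  by rewrite Y2 expr2 ler_wpM2r.
have := hyp_tail m0 Nn Yr; rewrite Y2 big_mkcond /= => h.
apply: (@le_trans _ _ ((2 * expR (- (j%:R * (k + m)%:R / (4 * (k + m)%:R)))) * expR (64^-1 * (j%:R + 1)))).
  apply: le_trans (ler_wpM2r (expR_ge0 _) h); rewrite mulr_suml; apply: ler_sum => a _.
  rewrite mulrA ler_wpM2r ?expR_ge0 //.
  have -> : (Y <= `|a%:R - mu|) = (j%:R <= (a%:R - mu) ^+ 2 / (k + m)%:R).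
    rewrite ler_pdivlMr // -Y2 -[in RHS](real_normK (num_real (a%:R - mu))).
    by rewrite ler_pXn2r ?nnegrE ?sqrtr_ge0.
  by case: ifP; rewrite ?mulr1 ?mulr0.
have E (p q : R) : 2 * expR p * expR q = 2 * expR (p + q) by rewrite expRD mulrA.
rewrite /z -expRM_natl !E ler_wpM2l // ler_expR.
have -> : j%:R * (k + m)%:R / (4 * (k + m)%:R) = j%:R / 4 :> R.
  by move: ((k + m)%:R) (lt0r_neq0 n0) => n nz; field.
lra.
Qed.

End Hypergeometric.

(** * Monotone likelihood ratios on a window *)

Section Transfer.
Variable R : realType.
Implicit Types (f g h : nat -> R) (i j l M w : nat).

Lemma lr_pairs w f h : (forall t, (t < w)%N -> 0 < f t) -> (forall t, 0 <= h t) ->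
  (forall t, (t.+1 < w)%N -> h t.+1 * f t <= h t * f t.+1) ->
  forall i j, (i <= j)%N -> (j < w)%N -> h j * f i <= h i * f j.
Proof.
move=> f0 h0 lr i; elim=> [|j IH] ij jw.
  by have -> : i = 0%N by lia.
have [->//|ij'] := eqVneq i j.+1.
have {}IH := IH ltac:(lia) ltac:(lia).
have fj := f0 j ltac:(lia); have fj1 := f0 j.+1 jw.
have fi := f0 i ltac:(lia).
have p1 := ler_wpM2l (ltW fi) (lr j jw); have p2 := ler_wpM2l (ltW fj1) IH.
by rewrite -(ler_pM2r fj); lra.
Qed.

(** A decreasing ratio h/f gives stochastic order: for t < x <= y, [lr_pairs] compares the products
    h(y)f(t) and h(t)f(y), and these are summed. Cross-multiplying avoids normalising the masses of
    the window. *)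
Lemma lr_cdf w f h : (forall t, (t < w)%N -> 0 < f t) -> (forall t, 0 <= h t) ->
  (forall t, (t.+1 < w)%N -> h t.+1 * f t <= h t * f t.+1) ->
  forall x, (x <= w)%N ->
  (\sum_(t < x) f t) * (\sum_(t < w) h t) <= (\sum_(t < x) h t) * (\sum_(t < w) f t).
Proof.
move=> f0 h0 lr x xw.
have P := lr_pairs f0 h0 lr.
have H y : (x <= y)%N -> (y <= w)%N ->
  (\sum_(t < x) f t) * (\sum_(t < y) h t) <= (\sum_(t < x) h t) * (\sum_(t < y) f t).
  elim: y => [|y IH] xy yw.
    have -> : x = 0%N by lia.
    by rewrite !big_ord0 !mulr0.
  have [xE|xy'] := eqVneq x y.+1; first by rewrite -xE mulrC.
  rewrite !big_ord_recr /= !mulrDr lerD ?IH //; try lia.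
  rewrite !mulr_suml; apply: ler_sum => t _; rewrite mulrC; apply: P => //.
  have := ltn_ord t; lia.
by apply: H.
Qed.

Definition law M f :=
  [/\ forall i, 0 <= f i, forall i, (M <= i)%N -> f i = 0 & \sum_(i < M) f i = 1].

Lemma law_cover M f (P : pred nat) l w : law M f ->
  (forall i, ~~ P i -> (l <= i < l + w)%N) ->
  1 <= \sum_(i < M | P i) f i + \sum_(t < w) f (l + t)%N.
Proof.
move=> [f0 fM <-] hP; rewrite (bigID (fun i : 'I_M => P i)) /= lerD2l.
have -> : \sum_(t < w) f (l + t)%N = \sum_(l <= i < l + w) f i.
  rewrite -[X in \sum_(X <= _ < _) _]add0n big_addn addKn big_mkord.
  by apply: eq_bigr => i _; rewrite addnC.
rewrite -(big_mkord (fun i => ~~ P i) f).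
rewrite (big_nat_widen _ _ (maxn M (l + w))) ?leq_maxl //.
rewrite [leRHS](big_nat_widenl _ 0) // [leRHS](big_nat_widen _ _ (maxn M (l + w))) ?leq_maxr //.
rewrite [leLHS]big_mkcond [leRHS]big_mkcond /=; apply: ler_sum => i _.
case: ifP => [/andP[Pi _]|_]; last by case: ifP.
by have /andP[-> ->] := hP _ Pi.
Qed.

Lemma law_sum_le1 M f x : law M f -> \sum_(i < x) f i <= 1.
Proof.
move=> [f0 fM <-]; rewrite -!(big_mkord xpredT f).
rewrite (big_nat_widen _ _ (maxn M x)) ?leq_maxr //.
rewrite [leRHS](big_nat_widen _ _ (maxn M x)) ?leq_maxl //.
rewrite [leLHS]big_mkcond [leRHS]big_mkcond /=; apply: ler_sum => i _.
case: ifP => _; last by case: ifP.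
by case: ifP => // /negbT; rewrite -leqNgt => /fM ->.
Qed.

Lemma law_window_le1 M f l w : law M f -> \sum_(t < w) f (l + t)%N <= 1.
Proof.
move=> lf; apply: le_trans (law_sum_le1 (l + w) lf).
have [f0 _ _] := lf; rewrite big_split_ord /= lerDr.
by apply: sumr_ge0.
Qed.

(** Inside the window [lr_cdf] applies. The mass of f below the window costs at most [ef]; replacing
    the window mass of g by 1 costs at most [eg]. *)
Lemma lr_window_cdf Mf Mg f g l l' w i ef eg : law Mf f -> law Mg g ->
  (l <= i < l + w)%N ->
  (forall t, (t < w)%N -> 0 < f (l + t)%N) ->
  (forall t, (t.+1 < w)%N ->
     g (l' + t.+1)%N * f (l + t)%N <= g (l' + t)%N * f (l + t.+1)%N) ->
  1 - \sum_(t < w) f (l + t)%N <= ef -> 1 - \sum_(t < w) g (l' + t)%N <= eg ->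
  \sum_(z < i.+1) f z <= \sum_(z < l' + (i - l).+1) g z + ef + eg.
Proof.
move=> lf lg /andP[li iw] fp lr hf hg.
have [f0 _ _] := lf; have [g0 _ _] := lg.
set x := (i - l).+1; have xw : (x <= w)%N by lia.
have := @lr_cdf w (fun t => f (l + t)%N) (fun t => g (l' + t)%N) fp (fun t => g0 _) lr x xw.
have -> : i.+1 = (l + x)%N by lia.
rewrite !big_split_ord /=.
have h1 := law_sum_le1 (l + w) lf; rewrite big_split_ord /= in h1.
have h2 := law_window_le1 l x lf.
have h3 := law_window_le1 l w lf.
have h5 : 0 <= \sum_(z < l') g z by apply: sumr_ge0.
have h6 : 0 <= \sum_(t < x) g (l' + t)%N by apply: sumr_ge0.
have h7 : 0 <= \sum_(t < x) f (l + t)%N by apply: sumr_ge0.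
have h8 := law_window_le1 l' w lg.
set a := \sum_(t < x) f _ in h2 h7 *; set b := \sum_(t < x) g _ in h6 *.
set Hw := \sum_(t < w) g _ in hg h8 *; set Fw := \sum_(t < w) f _ in hf h1 h3 *.
move=> hlr; have p1 : b * Fw <= b by rewrite ler_piMr.
have p2 : a * (1 - Hw) <= 1 - Hw by rewrite ler_piMl // subr_ge0.
lra.
Qed.

Lemma nat_above (x : R) : 0 <= x -> exists l : nat, x < l%:R <= x + 1.
Proof.
move=> x0; exists (Num.truncn x).+1.
by have /andP[h1 h2] := truncn_itv x0; rewrite h2 -natr1 lerD2r.
Qed.

(** Two shifts: one by about b makes the likelihood ratio monotone, another by about b collects mass
    at least b gam >= 2e to repay both tails. Rounding included, the total is at most 2b + 3 <=
    5b. *)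
Lemma window_transfer Mf Mg f g (cf cg Y b e Z gam : R) i : law Mf f -> law Mg g ->
  (forall z, `|z%:R - cf| <= Y -> 0 < f z) ->
  (forall z j, `|z%:R - cf| <= Y -> b <= (j%:R - cg) - (z%:R - cf) <= b + 1 ->
     g j.+1 * f z <= g j * f z.+1) ->
  1 <= b -> 10 * b <= Y -> Y <= cf -> Y <= cg ->
  \sum_(z < Mf | Y <= `|z%:R - cf|) f z <= e ->
  \sum_(z < Mg | Y / 2 <= `|z%:R - cg|) g z <= e ->
  (forall j, `|j%:R - cg| <= Z -> gam <= g j) ->
  `|i%:R - cf| + 5 * b <= Z -> `|i%:R - cf| < Y -> 0 <= gam -> 2 * e <= b * gam ->
  exists j, \sum_(z < i.+1) f z <= \sum_(z < j) g z /\
    j%:R - cg <= (i%:R - cf) + 5 * b.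
Proof.
move=> lf lg fp lr b1 bY Ycf Ycg tf tg gm xZ xY gam0 he.
have [l /andP[l1 l2]] : exists l : nat, cf - Y < l%:R <= cf - Y + 1 by apply: nat_above; lra.
have [q /andP[q1 q2]] : exists q : nat, cf + Y < q%:R <= cf + Y + 1 by apply: nat_above; lra.
have lq : (l <= q)%N by rewrite -(ler_nat R); lra.
have [w lwq] : exists w, (l + w = q)%N by exists (q - l)%N; rewrite subnKC.
have [l' /andP[l'1 l'2]] : exists l' : nat,
  l%:R + cg - cf + b < l'%:R <= l%:R + cg - cf + b + 1 by apply: nat_above; lra.
have in_window z : (l <= z < q)%N -> `|z%:R - cf| <= Y.
  move=> /andP[]; rewrite -(ler_nat R) -(ler_nat R) -natr1 => lz zq.
  rewrite ler_norml; lra.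
have /ltr_normlP[x1 x2] := xY.
have li : (l <= i < l + w)%N.
  rewrite lwq -[X in X && _]ltnS -!(ltr_nat R) -natr1; apply/andP; split; lra.
have key : \sum_(z < i.+1) f z <= \sum_(z < l' + (i - l).+1) g z + e + e.
  apply: (lr_window_cdf lf lg li).
  - move=> t tw; apply: fp; apply: in_window; rewrite leq_addr -lwq ltn_add2l //.
  - move=> t tw; rewrite !addnS; apply: lr.
      by apply: in_window; rewrite leq_addr -lwq ltn_add2l // ltnW.
    rewrite !natrD; lra.
  - rewrite lerBlDr; apply: (le_trans (law_cover (P := fun z => Y <= `|z%:R - cf|) (l := l) (w := w) lf _)); last by rewrite lerD2r.
    move=> z; rewrite -ltNge => /ltr_normlP[z1 z2]; rewrite lwq.
    by rewrite -[X in X && _]ltnS -!(ltr_nat R) -natr1; apply/andP; split; lra.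
  (* The shift moves the left end of the window of g towards its centre by at most b + 2 <= Y/2, so
     the tail is taken at Y/2 instead of Y. *)
  - rewrite lerBlDr; apply: (le_trans (law_cover (P := fun z => Y / 2 <= `|z%:R - cg|) (l := l') (w := w) lg _)); last by rewrite lerD2r.
    have wE : w%:R = q%:R - l%:R :> R by rewrite -lwq natrD addrC addKr.
    move=> z; rewrite -ltNge => /ltr_normlP[z1 z2].
    by rewrite -[X in X && _]ltnS -!(ltr_nat R) -natr1 natrD wE; apply/andP; split; lra.
set j0 := (l' + (i - l).+1)%N in key.
have /andP[j01 j02] : (i%:R - cf) + b + 1 <= j0%:R - cg <= (i%:R - cf) + b + 2.
  have : (i - l)%:R = i%:R - l%:R :> R by rewrite natrB //; case/andP: li.
  rewrite /j0 natrD -natr1 => ->; lra.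
(* The second shift: the next [be] points of g all lie within Z of its centre, so each carries at
   least [gam]. *)
have [be /andP[be1 be2]] : exists be : nat, b < be%:R <= b + 1 by apply: nat_above; lra.
exists (j0 + be)%N; split; last by rewrite natrD; lra.
have : be%:R * gam <= \sum_(t < be) g (j0 + t)%N.
  rewrite mulr_natl -[X in gam *+ X]card_ord -sumr_const; apply: ler_sum => t _.
  apply: gm; have tb : t%:R <= b :> R.
    have : t.+1%:R <= be%:R :> R by rewrite ler_nat.
    by rewrite -natr1; lra.
  have := ler0n R t; have := ler_norm (i%:R - cf); have := ler_norm (- (i%:R - cf)).
  rewrite normrN natrD ler_norml; lra.
have : b * gam <= be%:R * gam by rewrite ler_wpM2r // ltW.
rewrite big_split_ord /=; lra.
Qed.

Lemma ratio_chain g (cg Z E : R) : 1 <= E -> (forall j, 0 <= g j) ->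
  (forall j, `|j%:R - cg| <= Z -> g j.+1 <= E * g j /\ g j <= E * g j.+1) ->
  forall d j, `|j%:R - cg| <= Z -> `|(j + d)%:R - cg| <= Z ->
  g (j + d)%N <= E ^+ d * g j /\ g j <= E ^+ d * g (j + d)%N.
Proof.
move=> E1 g0 hr; elim=> [|d IH] j hj hjd; first by rewrite addn0 expr0 !mul1r.
have hd : `|(j + d)%:R - cg| <= Z.
  move: hj hjd; rewrite addnS -natr1 !natrD !ler_norml; have := ler0n R d; lra.
have [h1 h2] := IH j hj hd; have [h3 h4] := hr _ hd.
have E0 : 0 <= E by lra.
rewrite addnS exprS; split.
  by apply: (le_trans h3); rewrite -mulrA ler_wpM2l.
by apply: (le_trans h2); rewrite -mulrA mulrCA ler_wpM2l // exprn_ge0.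
Qed.

(** Pigeonhole: at least half of the mass sits on at most 4Z points, and moving between two of them
    takes at most 2Z steps, each changing the weight by a factor at most e^{CZ/n}. *)
Lemma law_lower_bound Mg g (cg Z n C : R) : law Mg g -> 1 <= n -> 0 <= C ->
  1 <= Z -> Z <= cg ->
  (forall j, `|j%:R - cg| <= Z ->
     g j.+1 <= expR (C * Z / n) * g j /\ g j <= expR (C * Z / n) * g j.+1) ->
  \sum_(z < Mg | Z <= `|z%:R - cg|) g z <= 1 / 2 ->
  forall j, `|j%:R - cg| <= Z ->
  expR (- (2 * C * Z ^+ 2 / n)) / (8 * Z) <= g j.
Proof.
move=> lg n1 C0 Z1 Zc hr ht j hj.
have [g0 _ _] := lg.
have s0 : 0 <= C * Z / n by rewrite divr_ge0 ?mulr_ge0 //; lra.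
have E1 : 1 <= expR (C * Z / n) by rewrite -expR0 ler_expR.
have chain := ratio_chain E1 g0 hr.
pose A := expR (2 * C * Z ^+ 2 / n).
have power_le d : d%:R <= 2 * Z -> expR (C * Z / n) ^+ d <= A.
  move=> hd; rewrite -expRM_natl ler_expR.
  have -> : 2 * C * Z ^+ 2 / n = 2 * Z * (C * Z / n) by rewrite expr2; ring.
  by rewrite ler_wpM2r.
have close z : `|z%:R - cg| <= Z -> g z <= A * g j.
  move=> hz; have [zj|jz] := leqP z j.
    have := chain (j - z)%N z hz; rewrite subnKC // => /(_ hj)[_ h].
    apply: (le_trans h); rewrite ler_wpM2r // power_le // natrB //.
    by move: hj hz; rewrite !ler_norml; lra.
  have := chain (z - j)%N j hj; rewrite subnKC 1?ltnW // => /(_ hz)[h _].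
  apply: (le_trans h); rewrite ler_wpM2r // power_le // natrB 1?ltnW //.
  by move: hj hz; rewrite !ler_norml; lra.
have [l /andP[l1 l2]] : exists l : nat, cg - Z < l%:R <= cg - Z + 1 by apply: nat_above; lra.
have [q /andP[q1 q2]] : exists q : nat, cg + Z < q%:R <= cg + Z + 1 by apply: nat_above; lra.
have lq : (l <= q)%N by rewrite -(ler_nat R); lra.
have cov : 1 / 2 <= \sum_(z < Mg | ~~ (Z <= `|z%:R - cg|)) g z.
  have [_ _] := lg; rewrite (bigID (fun z : 'I_Mg => Z <= `|z%:R - cg|)) /=; lra.
have up : \sum_(z < Mg | ~~ (Z <= `|z%:R - cg|)) g z <= (q - l)%:R * (A * g j).
  apply: (@le_trans _ _ (\sum_(z < Mg | (l <= z < q)%N) A * g j)).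
    rewrite [leLHS]big_mkcond [leRHS]big_mkcond /=; apply: ler_sum => z _.
    case: ifP => hz; last by case: ifP => // _; rewrite mulr_ge0 ?expR_ge0.
    have hz' : `|z%:R - cg| < Z by rewrite ltNge.
    have -> : (l <= z < q)%N.
      have /ltr_normlP[z1 z2] := hz'.
      rewrite -[X in X && _]ltnS -!(ltr_nat R) -natr1.
      by apply/andP; split; lra.
    by apply: close; exact: ltW.
  rewrite -(big_mkord (fun z => (l <= z < q)%N) (fun _ => A * g j)).
  apply: (@le_trans _ _ (\sum_(l <= z < q) A * g j)).
    rewrite (big_nat_widen _ _ (maxn Mg q)) ?leq_maxl //.
    rewrite [leRHS](big_nat_widenl _ 0) // [leRHS](big_nat_widen _ _ (maxn Mg q)) ?leq_maxr //.
    rewrite [leLHS]big_mkcond [leRHS]big_mkcond /=; apply: ler_sum => z _.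
    case: ifP => [/andP[/andP[-> ->] _] //|_]; case: ifP => // _.
    by rewrite mulr_ge0 ?expR_ge0.
  by rewrite sumr_const_nat mulr_natl.
have hq : (q - l)%:R <= 4 * Z by rewrite natrB //; lra.
have gj := g0 j.
have A0 : 0 < A by exact: expR_gt0.
rewrite expRN -/A ler_pdivrMr ?mulr_gt0 //; last lra.
rewrite -(ler_pM2l A0) divff ?lt0r_neq0 //.
have : (q - l)%:R * (A * g j) <= 4 * Z * (A * g j) by rewrite ler_wpM2r // mulr_ge0 // ltW.
lra.
Qed.

End Transfer.

(** * Choice of the window and of the shift *)

Section Bulk.
Variable R : realType.
Implicit Types (n r u sg x Y b t : R).

(* Up to a constant, n times the difference of the logarithmic slopes of the two
   laws on a window of half-width Y. *)
Definition drift n sg Y : R :=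
  1 + sg * Num.sqrt n + sg ^+ 2 * Y + sg * Y ^+ 2 / n + Y ^+ 3 / n ^+ 2.

(** The cubic term of the series of e^{t^2/128} already has order t^6. *)
Lemma expR_dominates_pow5 : exists T0 : R, 100 <= T0 /\ forall t, T0 <= t ->
  192 * t ^+ 5 * expR (- (t ^+ 2 / 128)) <= 1.
Proof.
exists (100 + 192 * 6 * 128 ^+ 3); split; first by rewrite lerDl !mulr_ge0 ?exprn_ge0 ?ler0n.
move=> t ht; have t1 : 0 <= t by apply: le_trans ht; rewrite addr_ge0 ?mulr_ge0 ?exprn_ge0 ?ler0n.
pose v := t ^+ 2 / 128; have v0 : 0 <= v by rewrite /v divr_ge0 ?sqr_ge0.
have := expR_ge1Dxn 2 v0; rewrite expRN -/v => hv.
rewrite ler_pdivrMr ?expR_gt0 // mul1r; apply: le_trans hv.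
have -> : 3`!%:R = 6 :> R by [].
have -> : v ^+ 3 / 6 = t * t ^+ 5 / (128 ^+ 3 * 6).
  by rewrite /v; field.
have h5 : 0 <= t ^+ 5 by rewrite exprn_ge0.
have := ler_wpM2r h5 ht => h.
have : 192 * t ^+ 5 <= t * t ^+ 5 / (128 ^+ 3 * 6).
  by rewrite ler_pdivlMr //; apply: le_trans h; lra.
lra.
Qed.

(** With n = u^8, Y0 is the smaller of n^{5/8} and sqrt(n)/sg. For b = 1 the last clause, which pays
    for the tails, asks for Y >= n^{5/8}; this exponent is below 2/3, so Y^3/n^2 stays bounded. The
    cap keeps sg^2 Y below sg sqrt(n), and b >= sg sqrt(n) then compensates for the smaller
    radius. *)
Lemma bulk_radius u sg t0 : 1 <= t0 -> t0 <= u -> 0 <= sg -> sg * t0 <= 1 ->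
  exists Y0 : R, [/\ t0 * u ^+ 4 <= Y0, Y0 <= u ^+ 5,
    drift (u ^+ 8) sg Y0 <= 2 + 3 * (sg * u ^+ 4) &
    forall Y b, Y0 <= Y -> 1 <= b -> sg * u ^+ 4 <= b -> u ^+ 20 <= b * Y ^+ 4].
Proof.
move=> t1 tu s0 st.
have u1 : 1 <= u by lra.
have u0 : 0 < u by lra.
have r0 : 0 < u ^+ 4 by rewrite exprn_gt0.
have sq : Num.sqrt (u ^+ 8) = u ^+ 4.
  by rewrite -[8%N]/(4 * 2)%N exprM sqrtr_sqr ger0_norm // ltW.
have bound Y0 : 0 <= Y0 -> Y0 <= u ^+ 5 -> sg * Y0 <= u ^+ 4 ->
    drift (u ^+ 8) sg Y0 <= 2 + 3 * (sg * u ^+ 4).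
  move=> Y00 Yu sY; rewrite /drift sq.
  have e1 : sg ^+ 2 * Y0 <= sg * u ^+ 4 by rewrite expr2 -mulrA ler_wpM2l.
  have e2 : sg * Y0 ^+ 2 / u ^+ 8 <= sg * u ^+ 4.
    rewrite ler_pdivrMr ?exprn_gt0 // -mulrA ler_wpM2l // -exprD.
    apply: (@le_trans _ _ ((u ^+ 5) ^+ 2)); first by rewrite lerXn2r // nnegrE ?exprn_ge0 // ltW.
    by rewrite -exprM ler_weXn2l.
  have e3 : Y0 ^+ 3 / (u ^+ 8) ^+ 2 <= 1.
    rewrite ler_pdivrMr ?exprn_gt0 // mul1r -exprM.
    apply: (@le_trans _ _ ((u ^+ 5) ^+ 3)); first by rewrite lerXn2r // nnegrE ?exprn_ge0 // ltW.
    by rewrite -exprM ler_weXn2l.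
  lra.
have [su|su] := leP (sg * u) 1.
  exists (u ^+ 5); split.
  - by rewrite [in leRHS]exprS ler_wpM2r // ltW.
  - by [].
  - apply: bound => //; first by rewrite exprn_ge0 // ltW.
    by rewrite [u ^+ 5]exprS mulrA ler_piMl // ltW.
  - move=> Y b hY b1 _; apply: (@le_trans _ _ ((u ^+ 5) ^+ 4)); first by rewrite -exprM.
    have Yp : (u ^+ 5) ^+ 4 <= Y ^+ 4.
      have u50 : 0 <= u ^+ 5 by rewrite exprn_ge0 // ltW.
      by rewrite lerXn2r // nnegrE //; apply: le_trans hY.
    apply: (le_trans Yp); rewrite ler_peMl //.
    by apply: le_trans Yp; rewrite exprn_ge0 // exprn_ge0 // ltW.
have sp : 0 < sg by rewrite lt_neqAle s0 andbT; apply: contraTneq su => <-; rewrite mul0r -leNgt.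
have sY : sg * (u ^+ 4 / sg) = u ^+ 4 by rewrite mulrCA divff ?mulr1 // lt0r_neq0.
have s1 : sg <= 1 by apply: le_trans st; rewrite ler_peMr.
have up : u ^+ 4 / sg <= u ^+ 5.
  by rewrite ler_pdivrMr // [u ^+ 5]exprSr -mulrA [u * _]mulrC ler_peMr ?(ltW r0) ?(ltW su).
exists (u ^+ 4 / sg); split.
- by rewrite ler_pdivlMr // mulrAC mulrC [t0 * sg]mulrC ler_piMr // ltW.
- by [].
- apply: bound; last by rewrite sY.
    by rewrite divr_ge0 // ltW.
  by [].
- move=> Y b hY b1 hb; have Y0 : 0 <= Y by apply: le_trans hY; rewrite divr_ge0 // ltW.
  have h1 : u ^+ 4 <= sg * Y by rewrite -sY ler_wpM2l.
  have h2 : (u ^+ 4) ^+ 4 <= (sg * Y) ^+ 4 by rewrite lerXn2r // nnegrE ?mulr_ge0 // ltW.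
  apply: (@le_trans _ _ (sg * u ^+ 4 * Y ^+ 4)); last by rewrite ler_wpM2r // exprn_ge0.
  have -> : u ^+ 20 = (u ^+ 4) ^+ 4 * u ^+ 4 by rewrite -exprM -exprD.
  rewrite [leRHS]mulrAC ler_wpM2r ?(ltW r0) //; apply: (le_trans h2).
  by rewrite exprMn ler_wpM2r ?exprn_ge0 // [leRHS](_ : sg = sg ^+ 1) // ler_wiXn2l.
Qed.

(** On a window proportional to the distance x of the quantile, the drift is the displacement aimed
    at: sg <= 1 and x <= n reduce every term to sg x or x^2/n. *)
Lemma drift_far n sg K x : 1 <= n -> 0 <= sg <= 1 -> 1 <= K -> 0 <= x <= n ->
  drift n sg (K * x) <= 2 * K ^+ 3 * (1 + sg * Num.sqrt n + sg * x + x ^+ 2 / n).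
Proof.
move=> n1 /andP[s0 s1] K1 /andP[x0 xn].
have n0 : 0 < n by lra.
have K0 : 0 <= K by lra.
have K3 : 1 <= K ^+ 3 by rewrite exprn_ege1.
have KK3 : K <= K ^+ 3 by rewrite -[leLHS]expr1 ler_weXn2l.
have KK2 : K ^+ 2 <= K ^+ 3 by rewrite ler_weXn2l.
have q0 : 0 <= x ^+ 2 / n by rewrite divr_ge0 ?sqr_ge0 // ltW.
have sq0 : 0 <= sg * Num.sqrt n by rewrite mulr_ge0 // sqrtr_ge0.
have sx0 : 0 <= sg * x by rewrite mulr_ge0.
have e1 : sg ^+ 2 * (K * x) <= K ^+ 3 * (sg * x).
  have -> : sg ^+ 2 * (K * x) = sg * (K * (sg * x)) by rewrite expr2; ring.
  apply: (@le_trans _ _ (K * (sg * x))); first by rewrite ler_piMl // mulr_ge0.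
  by rewrite ler_wpM2r.
have e2 : sg * (K * x) ^+ 2 / n <= K ^+ 3 * (x ^+ 2 / n).
  have -> : sg * (K * x) ^+ 2 / n = sg * (K ^+ 2 * (x ^+ 2 / n)) by rewrite exprMn; ring.
  apply: (@le_trans _ _ (K ^+ 2 * (x ^+ 2 / n))); first by rewrite ler_piMl // mulr_ge0 // exprn_ge0.
  by rewrite ler_wpM2r.
have e3 : (K * x) ^+ 3 / n ^+ 2 <= K ^+ 3 * (x ^+ 2 / n).
  have -> : (K * x) ^+ 3 / n ^+ 2 = K ^+ 3 * (x ^+ 2 / n) * (x / n) by field; lra.
  have xn1 : x / n <= 1 by rewrite ler_pdivrMr // mul1r.
  by rewrite ler_piMr // mulr_ge0 //; lra.
have e4 : 1 + sg * Num.sqrt n <= K ^+ 3 * (1 + sg * Num.sqrt n) by rewrite ler_peMl //; lra.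
have p0 : 0 <= K ^+ 3 * (sg * x) by rewrite mulr_ge0 //; lra.
have p1 : 0 <= K ^+ 3 * (1 + sg * Num.sqrt n) by rewrite mulr_ge0 //; lra.
rewrite /drift; lra.
Qed.

End Bulk.

(** * Comparison of two laws from tails, slow variation and drift *)

Section Comparison.
Variable R : realType.
Implicit Types (n sg c C Y Z : R) (f g : nat -> R) (M i j z : nat).

(** The constant 16, weaker than the 4 of [hyp_tail], leaves room for the law at scale 4n measured
    in units of two counts. *)
Definition tail_bound n c M f := forall Y, 0 <= Y <= n ->
  \sum_(i < M | Y <= `|i%:R - c|) f i <= 2 * expR (- (Y ^+ 2 / (16 * n))).

Definition slowly_varying C n c g := forall Z j, 1 <= Z <= n / 20 -> `|j%:R - c| <= Z ->
  g j.+1 <= expR (C * Z / n) * g j /\ g j <= expR (C * Z / n) * g j.+1.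

(** A shift of at least C times the drift makes the ratio g/f nonincreasing on the window. The upper
    bound on the shift keeps j within 2Y of its centre. *)
Definition drift_dominated C n sg cf cg f g := forall Y z j, 0 <= Y <= n / 20 ->
  `|z%:R - cf| <= Y -> C * drift n sg Y <= (j%:R - cg) - (z%:R - cf) <= Y ->
  g j.+1 * f z <= g j * f z.+1.

(** The shift is a small fraction of the window: Y >= t0 sqrt(n) controls 1 + sg sqrt(n), sg <= 1/t0
    controls the remaining terms in sg, and Y <= n/(10A) controls Y^3/n^2. *)
Lemma drift_small A t0 n r sg Y : 40 <= A -> 100 * A <= t0 -> Num.sqrt n = r ->
  1 <= r -> 0 < n -> 0 <= sg -> sg * t0 <= 1 -> t0 * r <= Y -> 10 * A * Y <= n ->
  5 * A * drift n sg Y <= Y.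
Proof.
move=> A1 tA sq r1 n0 s0 st tY Yn.
have t01 : 1 <= t0 by lra.
have t00 : 0 <= t0 by lra.
have Y0 : 0 < Y by apply: lt_le_trans tY; rewrite mulr_gt0; lra.
have s1 : sg <= 1 by apply: le_trans st; rewrite ler_peMr.
have yn0 : 0 <= Y / n by rewrite divr_ge0 // ltW.
have yA : 10 * A * (Y / n) <= 1 by rewrite mulrA ler_pdivrMr // mul1r.
have y1 : 10 * (Y / n) <= 1 by apply: le_trans yA; rewrite ler_wpM2r //; lra.
have d1 : t0 * (1 + sg * r) <= 2 * Y.
  have p : sg * r <= r by rewrite ler_piMl //; lra.
  apply: (@le_trans _ _ (t0 * (2 * r))); last by rewrite mulrCA; lra.
  by rewrite ler_wpM2l //; lra.
have sY0 : 0 <= sg * Y by rewrite mulr_ge0 // ltW.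
have sY : t0 * (sg * Y) <= Y by rewrite mulrA [t0 * _]mulrC ler_piMl // ltW.
have d2 : t0 * (sg ^+ 2 * Y + sg * Y ^+ 2 / n) <= 2 * Y.
  have -> : t0 * (sg ^+ 2 * Y + sg * Y ^+ 2 / n) = (sg + Y / n) * (t0 * (sg * Y)).
    by rewrite !expr2; move: (lt0r_neq0 n0) => nz; field.
  apply: (@le_trans _ _ (2 * (t0 * (sg * Y)))); last by rewrite ler_wpM2l.
  by rewrite ler_wpM2r ?mulr_ge0 //; lra.
have d3 : 100 * A * (Y ^+ 3 / n ^+ 2) <= Y.
  have -> : 100 * A * (Y ^+ 3 / n ^+ 2) = Y * ((10 * A * (Y / n)) * (10 * (Y / n))).
    by move: (lt0r_neq0 n0) => nz; field.
  have a0 : 0 <= 10 * A * (Y / n) by rewrite mulr_ge0 //; lra.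
  have c0 : 0 <= 10 * (Y / n) by lra.
  by rewrite ler_piMr ?(ltW Y0) //; apply: mulr_ile1.
have p1 : 0 <= sg * r by rewrite mulr_ge0 //; lra.
have p2 : 0 <= sg ^+ 2 * Y by rewrite mulr_ge0 ?sqr_ge0 // ltW.
have p3 : 0 <= sg * Y ^+ 2 / n by rewrite mulr_ge0 ?invr_ge0 ?mulr_ge0 ?sqr_ge0 // ltW.
rewrite /drift sq.
set D1 := 1 + sg * r in d1 *; set D2 := sg ^+ 2 * Y + sg * Y ^+ 2 / n in d2.
have -> : D1 + sg ^+ 2 * Y + sg * Y ^+ 2 / n = D1 + D2 by rewrite /D2 addrA.
have D0 : 0 <= D1 + D2 by rewrite /D1 /D2; lra.
have d4 : 100 * A * (D1 + D2) <= t0 * (D1 + D2) by rewrite ler_wpM2r.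
lra.
Qed.

Lemma drift_ge n sg Y : 0 < n -> 0 <= sg -> 0 <= Y ->
  1 + sg * Num.sqrt n <= drift n sg Y.
Proof.
move=> n0 s0 Y0; rewrite /drift.
have p2 : 0 <= sg ^+ 2 * Y by rewrite mulr_ge0 ?sqr_ge0.
have p3 : 0 <= sg * Y ^+ 2 / n by rewrite mulr_ge0 ?invr_ge0 ?mulr_ge0 ?sqr_ge0 // ltW.
have p4 : 0 <= Y ^+ 3 / n ^+ 2 by rewrite divr_ge0 ?exprn_ge0 // ltW.
lra.
Qed.

(* The exponentially small masses outside the window are absorbed by the mass
   that the lower bound guarantees on b consecutive points. *)
Lemma tail_absorbed C1 K T0 r Y Z b : 1 <= C1 -> 40 * C1 <= K ->
  (forall t, T0 <= t -> 192 * t ^+ 5 * expR (- (t ^+ 2 / 128)) <= 1) ->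
  0 < r -> 0 < Y -> T0 * r <= Y -> Z = 2 * (Y / K) -> 0 <= b -> r ^+ 5 <= b * Y ^+ 4 ->
  2 * (2 * expR (- ((Y / r) ^+ 2 / 64))) <=
    b * (expR (- (2 * C1 * Z ^+ 2 / (r * r))) / (8 * Z)).
Proof.
move=> C11 hK dom5 r0 Y0 TY ZE b0 bY.
have K0 : 0 < K by lra.
have YK0 : 0 < Y / K by rewrite divr_gt0.
have YKY : Y / K <= Y / 40 by rewrite ler_wpM2l ?(ltW Y0) // lef_pV2 ?posrE //; lra.
pose t := Y / r; rewrite -/t.
have h : 192 * t ^+ 5 * expR (- (t ^+ 2 / 128)) <= 1 by apply: dom5; rewrite ler_pdivlMr.
rewrite [leRHS]mulrA ler_pdivlMr; last lra.
have h1 : expR (- (t ^+ 2 / 128)) <= expR (- (2 * C1 * Z ^+ 2 / (r * r))).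
  rewrite ler_expR lerN2.
  have -> : 2 * C1 * Z ^+ 2 / (r * r) = (8 * C1 / K ^+ 2) * t ^+ 2.
    rewrite ZE /t; move: (lt0r_neq0 r0) (lt0r_neq0 K0) => rz Kz; field.
    by rewrite rz.
  rewrite [leRHS]mulrC ler_wpM2r ?sqr_ge0 // ler_pdivrMr ?exprn_gt0 //.
  have : K * 40 <= K * K by rewrite ler_wpM2l //; lra.
  rewrite expr2; lra.
have h2 : 192 * Y * expR (- (t ^+ 2 / 128)) <= b.
  have Y4 : 0 < Y ^+ 4 by rewrite exprn_gt0.
  rewrite -(ler_pM2r Y4); apply: le_trans bY.
  have -> : 192 * Y * expR (- (t ^+ 2 / 128)) * Y ^+ 4 =
      r ^+ 5 * (192 * t ^+ 5 * expR (- (t ^+ 2 / 128))).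
    move: (expR _) => E; rewrite /t; move: (lt0r_neq0 r0) => rz; field.
    by rewrite rz.
  by rewrite ler_piMr // exprn_ge0 // ltW.
(* One half of the exponent pays for the exponential in the lower bound on the weights ([h1]), the
   other for the polynomial factor ([h2]). *)
have h3 : expR (- (t ^+ 2 / 64)) = expR (- (t ^+ 2 / 128)) * expR (- (t ^+ 2 / 128)).
  by rewrite -expRD; congr expR; field.
rewrite h3; have ex0 := expR_gt0 (- (t ^+ 2 / 128)).
move: (expR (- (t ^+ 2 / 128))) h1 h2 ex0 => ex h1 h2 ex0 {h h3}.
have h4 : b * ex <= b * expR (- (2 * C1 * Z ^+ 2 / (r * r))) by rewrite ler_wpM2l.
apply: le_trans h4.
have h6 : 192 * Y * ex * ex <= b * ex by rewrite ler_wpM2r // ltW.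
have h7 : 8 * Z * (ex * ex) <= 2 * Y * (ex * ex).
  by rewrite ler_wpM2r ?mulr_ge0 ?(ltW ex0) //; lra.
have h8 : 0 <= Y * (ex * ex) by rewrite !mulr_ge0 // ltW.
lra.
Qed.

(** [window_transfer] with b equal to C2 times the drift, for any admissible radius Y that is at
    least K times the distance of the quantile. *)
Lemma bulk_transfer C1 C2 K T0 t0 n r sg Mf Mg f g cf cg Y i :
  1 <= C1 -> 1 <= C2 -> 40 * C1 <= K -> 100 <= T0 ->
  (forall t, T0 <= t -> 192 * t ^+ 5 * expR (- (t ^+ 2 / 128)) <= 1) ->
  T0 * C2 * K <= t0 ->
  n = r * r -> 1 <= r -> 0 <= sg -> sg * t0 <= 1 ->
  law Mf f -> law Mg g -> n / 20 <= cf -> n / 20 <= cg ->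
  (forall z, `|z%:R - cf| <= n / 20 -> 0 < f z) ->
  tail_bound n cf Mf f -> tail_bound n cg Mg g -> slowly_varying C1 n cg g ->
  drift_dominated C2 n sg cf cg f g ->
  t0 * r <= Y -> 10 * C2 * K * Y <= n ->
  r ^+ 5 <= C2 * drift n sg Y * Y ^+ 4 -> K * `|i%:R - cf| <= Y ->
  exists j, \sum_(z < i.+1) f z <= \sum_(z < j) g z /\
    j%:R - cg <= (i%:R - cf) + 5 * (C2 * drift n sg Y).
Proof.
move=> C11 C21 hK T01 dom5 ht nE r1 s0 st lf lg ncf ncg fp tf tg sv dd tY Yn bY xY.
have n1 : 1 <= n by rewrite nE mulr_ege1.
have n0 : 0 < n by lra.
have K1 : 40 <= K by lra.
have CK1 : K <= C2 * K by rewrite ler_peMl //; clear - K1 C21; lra.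
have t0T : T0 * (C2 * K) <= t0 by rewrite mulrA.
have t0K : 100 * (C2 * K) <= t0 by apply: le_trans t0T; rewrite ler_wpM2r //; clear - K1 CK1 T01; lra.
have t01 : 1 <= t0 by clear - t0K CK1 K1; lra.
have Yt : t0 <= Y by apply: le_trans tY; rewrite ler_peMr //; clear - t01 r1; lra.
have Y0 : 0 < Y by clear - Yt t01; lra.
have s1 : sg <= 1 by apply: le_trans st; rewrite ler_peMr.
have r0 : 0 < r by clear - r1; lra.
have sq : Num.sqrt n = r by rewrite nE -expr2 sqrtr_sqr ger0_norm // ltW.
have [b bE] : exists b, b = C2 * drift n sg Y by exists (C2 * drift n sg Y).
rewrite -bE; rewrite -bE in bY.
have CK0 : 0 < C2 * K by clear - CK1 K1; lra.
have Yn' : 10 * (C2 * K) * Y <= n by rewrite mulrA.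
have bd : 5 * (C2 * K) * drift n sg Y <= Y.
  by apply: (drift_small (t0 := t0) _ _ sq) => //; clear - CK1 K1; lra.
have Yn20 : Y <= n / 20.
  have : 40 * Y <= C2 * K * Y by rewrite ler_wpM2r; clear - Y0 CK1 K1; lra.
  lra.
have bK : 5 * K * b <= Y by rewrite bE; clear - bd; lra.
have D1 : 1 <= drift n sg Y.
  apply: le_trans (drift_ge n0 s0 (ltW Y0)); rewrite sq lerDl mulr_ge0 //; clear - r0; lra.
have b1 : 1 <= b by rewrite bE; apply: (le_trans D1); rewrite ler_peMl //; clear - C21 D1; lra.
have Kb : 200 * b <= Y.
  by apply: le_trans bK; rewrite ler_wpM2r //; clear - b1 K1; lra.
have K0 : 0 < K by clear - K1; lra.
have T0r : T0 * r <= Y.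
  apply: le_trans tY; rewrite ler_wpM2r ?(ltW r0) //; apply: le_trans t0T.
  by rewrite ler_peMr //; clear - T01 CK1 K1; lra.
have tK : 4 * K <= t0 by clear - t0K CK1 K1; lra.
clear ht t0T t0K CK1 CK0 Yn Yn' bd D1 sq st s1 Yt t01.
(* One Y/K covers the distance of the quantile from the centre, the other the 5b points that may
   follow it. *)
have [Z ZE] : exists Z, Z = 2 * (Y / K) by exists (2 * (Y / K)).
have YK5 : 5 * b <= Y / K by rewrite ler_pdivlMr //; clear - bK; lra.
have xK : `|i%:R - cf| <= Y / K by rewrite ler_pdivlMr // mulrC.
have YKY : Y / K <= Y / 40 by rewrite ler_wpM2l ?(ltW Y0) // lef_pV2 ?posrE //; clear - K0 K1; lra.
have Z1 : 1 <= Z by rewrite ZE; clear - YK5 b1; lra.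
have [t tE] : exists t, t = Y / r by exists (Y / r).
have tt : t0 <= t by rewrite tE ler_pdivlMr.
have t2 : Y ^+ 2 / n = t ^+ 2 by rewrite tE nE; field; rewrite gt_eqF.
have [e eE] : exists e, e = 2 * expR (- (t ^+ 2 / 64)) by exists (2 * expR (- (t ^+ 2 / 64))).
have tfe : \sum_(z < Mf | Y <= `|z%:R - cf|) f z <= e.
  apply: (le_trans (tf Y _)); first by rewrite (ltW Y0) /=; clear - Yn20 Y0 n0; lra.
  rewrite eE ler_wpM2l // ler_expR -t2.
  have -> : Y ^+ 2 / (16 * n) = (Y ^+ 2 / n) / 16 by field; clear - n0; lra.
  have : 0 <= Y ^+ 2 / n by rewrite divr_ge0 ?sqr_ge0 // ltW.
  clear - n0; lra.
have tge : \sum_(z < Mg | Y / 2 <= `|z%:R - cg|) g z <= e.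
  apply: (le_trans (tg (Y / 2) _)); first by apply/andP; split; clear - Y0 Yn20 n0; lra.
  rewrite eE ler_wpM2l // ler_expR -t2.
  have -> : (Y / 2) ^+ 2 / (16 * n) = (Y ^+ 2 / n) / 64 by field; clear - n0; lra.
  clear - n0; lra.
have Z20 : 1 <= Z <= n / 20 by rewrite Z1 /= ZE; clear - YKY Yn20 Y0; lra.
have Zcg : Z <= cg by clear - Z20 ncg; lra.
have tK1 : 4 <= t / K by rewrite ler_pdivlMr //; apply: le_trans tt.
have tZ : \sum_(z < Mg | Z <= `|z%:R - cg|) g z <= 1 / 2.
  apply: (le_trans (tg Z _)); first by apply/andP; split; clear - Z20 n0 Z1; lra.
  have -> : Z ^+ 2 / (16 * n) = (t / K) ^+ 2 / 4.
    rewrite ZE tE nE; field; rewrite !gt_eqF //; clear - K0 r0 n0; lra.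
  have v3 : 3 <= (t / K) ^+ 2 / 4.
    have := lerXn2r 2 _ _ tK1; rewrite !nnegrE => /(_ _ _); clear - tK1; lra.
  have ev := expR_ge1Dx ((t / K) ^+ 2 / 4).
  rewrite expRN; set E := expR _ in ev *.
  have E0 : 0 < E by clear - ev v3; lra.
  rewrite ler_pdivrMr //; clear - ev v3 E0; lra.
have lower := law_lower_bound lg n1 (le_trans ler01 C11) Z1 Zcg (fun j => sv Z j Z20) tZ.
have [gam gE] : exists gam, gam = expR (- (2 * C1 * Z ^+ 2 / n)) / (8 * Z).
  by exists (expR (- (2 * C1 * Z ^+ 2 / n)) / (8 * Z)).
rewrite -gE in lower.
have gam0 : 0 <= gam by rewrite gE divr_ge0 ?expR_ge0 //; clear - Z1; lra.
have eg : 2 * e <= b * gam.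
  rewrite eE gE nE tE; apply: (tail_absorbed (K := K) (T0 := T0)) => //.
  - by apply: le_trans b1.
clear T0r tK tK1 tZ xY bY bK r1 hK.
apply: (window_transfer lf lg _ _ b1 _ _ _ tfe tge lower _ _ gam0 eg);
  try (clear - Kb b1 Yn20 ncf ncg xK YK5 ZE YKY Y0; lra).
- by move=> z hz; apply: fp; apply: le_trans hz _.
- move=> z j hz /andP[j1 j2]; apply: (dd Y) => //; first by rewrite (ltW Y0).
  by rewrite -bE j1 /=; clear - j2 Kb b1; lra.
Qed.

Lemma monotone_transfer C1 C2 : 1 <= C1 -> 1 <= C2 ->
  exists e1 C : R, [/\ 0 < e1, 0 < C & forall n sg Mf Mg f g cf cg,
    1 <= n -> 0 <= sg <= e1 -> law Mf f -> law Mg g ->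
    n / 20 <= cf -> n / 20 <= cg -> Mg%:R <= cg + 2 * n ->
    (forall z, `|z%:R - cf| <= n / 20 -> 0 < f z) ->
    tail_bound n cf Mf f -> tail_bound n cg Mg g -> slowly_varying C1 n cg g ->
    drift_dominated C2 n sg cf cg f g ->
    forall i, `|i%:R - cf| <= n ->
    exists j, \sum_(z < i.+1) f z <= \sum_(z < j) g z /\
      j%:R - cg <= (i%:R - cf) + C * (1 + sg * Num.sqrt n + sg * `|i%:R - cf| +
        (i%:R - cf) ^+ 2 / n)].
Proof.
move=> C11 C21; have [T0 [T01 dom5]] := expR_dominates_pow5 R; have [K KE] : exists K : R, 40 * C1 = K by exists (40 * C1).
have K1 : 40 <= K by lra.
have CK1 : K <= C2 * K by rewrite ler_peMl //; lra.
have [t0 t0E'] : exists t0 : R, T0 * C2 * K = t0 by exists (T0 * C2 * K).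
have t0E : 100 * (C2 * K) <= t0 by rewrite -t0E' -mulrA ler_wpM2r //; lra.
have t01 : 1 <= t0 by lra.
(* One summand per case: the bulk, bounded n, and quantiles at distance of order n. *)
have [C CE] : exists C : R, C = 25 * C2 * K ^+ 3 + 3 * t0 ^+ 8 + 300 * (C2 * K * K) ^+ 2.
  by exists (25 * C2 * K ^+ 3 + 3 * t0 ^+ 8 + 300 * (C2 * K * K) ^+ 2).
have K3 : 1 <= K ^+ 3 by rewrite exprn_ege1 //; lra.
have CK3 : 1 <= C2 * K ^+ 3 by rewrite mulr_ege1.
have t80 : 0 <= t0 ^+ 8 by rewrite exprn_ge0 //; lra.
have q0 : 0 <= (C2 * K * K) ^+ 2 by exact: sqr_ge0.
have C0 : 0 < C by rewrite CE; lra.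
have C25 : 25 * (C2 * K ^+ 3) <= C by rewrite CE; lra.
have C8 : 3 * t0 ^+ 8 <= C by rewrite CE; lra.
have C300 : 300 * (C2 * K * K) ^+ 2 <= C by rewrite CE; lra.
clear CE.
exists t0^-1, C; split=> //; first by rewrite invr_gt0; lra.
move=> n sg Mf Mg f g cf cg n1 /andP[s0 s1] lf lg ncf ncg Mgn fp tf tg sv dd i xn.
have n0 : 0 < n by lra.
have [x xE] : exists x, `|i%:R - cf| = x by exists `|i%:R - cf|.
have x0 : 0 <= x by rewrite -xE.
rewrite xE in xn *.
have x2 : (i%:R - cf) ^+ 2 = x ^+ 2 by rewrite -xE real_normK ?num_real.
have [r rD] : exists r, Num.sqrt n = r by exists (Num.sqrt n).
rewrite x2 rD; have r0 : 0 <= r by rewrite -rD sqrtr_ge0.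
have sr0 : 0 <= sg * r by rewrite mulr_ge0.
have sx0 : 0 <= sg * x by rewrite mulr_ge0.
have xn0 : 0 <= x ^+ 2 / n by rewrite divr_ge0 ?sqr_ge0 // ltW.
(* [j = Mg] always works and overshoots by at most 3n, which is affordable for n <= t0^8 and for x
   of order n. *)
have fallback : 3 * n <= C * (1 + sg * r + sg * x + x ^+ 2 / n) ->
  exists j, \sum_(z < i.+1) f z <= \sum_(z < j) g z /\
    j%:R - cg <= (i%:R - cf) + C * (1 + sg * r + sg * x + x ^+ 2 / n).
  move=> hC; exists Mg; split.
    by have [_ _ ->] := lg; exact: law_sum_le1 lf.
  have := ler_norm (- (i%:R - cf)); rewrite normrN xE; clear - xn Mgn hC; lra.
have [u [u0 nE]] : exists u : R, 0 <= u /\ n = u ^+ 8.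
  exists (Num.sqrt (Num.sqrt r)); split; first exact: sqrtr_ge0.
  rewrite -[8%N]/(2 * (2 * 2))%N exprM sqr_sqrtr ?sqrtr_ge0 // exprM.
  by rewrite sqr_sqrtr // -rD sqr_sqrtr // ltW.
have [ut|tu] := ltP u t0.
  apply: fallback.
  have h : n <= t0 ^+ 8 by rewrite nE lerXn2r // ?nnegrE //; lra.
  apply: (@le_trans _ _ C); first by clear - C8 h; lra.
  by rewrite ler_peMr //; clear - sr0 sx0 xn0 C0; lra.
have [xb|xs] := ltP n (10 * C2 * K * (K * x)).
  apply: fallback.
  apply: (@le_trans _ _ (C * (x ^+ 2 / n))); last by rewrite ler_wpM2l //; clear - sr0 sx0 xn0 C0; lra.
  apply: (@le_trans _ _ (300 * (C2 * K * K) ^+ 2 * (x ^+ 2 / n))); last first.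
    by rewrite ler_wpM2r.
  have -> : 300 * (C2 * K * K) ^+ 2 * (x ^+ 2 / n) = 3 * ((10 * C2 * K * (K * x)) ^+ 2 / n).
    by field; clear - n0; lra.
  rewrite ler_wpM2l // ler_pdivlMr // -expr2 lerXn2r ?nnegrE ?ltW //.
  by clear - xb n0; lra.
have u1 : 1 <= u by clear - tu t01; lra.
have rE : r = u ^+ 4.
  by rewrite -rD nE -[8%N]/(4 * 2)%N exprM sqrtr_sqr ger0_norm // exprn_ge0.
have st : sg * t0 <= 1 by rewrite -ler_pdivlMr ?mul1r //; clear - t01 s1; lra.
have s11 : sg <= 1 by apply: le_trans st; rewrite ler_peMr.
have [Y0 [tY Yu dY hY]] := bulk_radius t01 tu s0 st.
rewrite -nE -rE in dY.
(* The window grows with the quantile; its drift is at most the sum of the drifts at the two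
   radii. *)
have [Y YE] : exists Y, Num.max Y0 (K * x) = Y by exists (Num.max Y0 (K * x)).
have YY0 : Y0 <= Y by rewrite -YE le_max lexx.
have YKx : K * x <= Y by rewrite -YE le_max lexx orbT.
have Y00 : 0 <= Y0 by apply: le_trans tY; rewrite mulr_ge0 ?exprn_ge0 //; clear - t01 u0; lra.
have Kx0 : 0 <= K * x by rewrite mulr_ge0 //; clear - K1 x0; lra.
have dK : drift n sg (K * x) <= 2 * K ^+ 3 * (1 + sg * r + sg * x + x ^+ 2 / n).
  by rewrite -rD; apply: drift_far => //; rewrite ?s0 ?x0 //; clear - s11 xn K1 n1; lra.
have dpos Y' : 0 <= Y' -> 1 + sg * r <= drift n sg Y' by rewrite -rD; exact: drift_ge.
have dmax : drift n sg Y <= drift n sg Y0 + drift n sg (K * x).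
  have := dpos _ Y00; have := dpos _ Kx0; rewrite -YE maxEle; case: ifP => _; clear - sr0; lra.
have Yn : 10 * C2 * K * Y <= n.
  rewrite -YE maxEle; case: ifP => _ //.
  apply: (@le_trans _ _ (10 * C2 * K * u ^+ 5)); first by rewrite ler_wpM2l // !mulr_ge0 //; clear - C21 K1; lra.
  rewrite nE -[8%N]/(3 + 5)%N exprD ler_wpM2r ?exprn_ge0 //.
  have u3 : u <= u ^+ 3 by rewrite -[leLHS]expr1 ler_weXn2l.
  by rewrite -mulrA; clear - u3 tu t0E CK1 K1; lra.
have dY1 := dpos Y (le_trans Y00 YY0).
have CdY : drift n sg Y <= C2 * drift n sg Y by rewrite ler_peMl //; clear - C21 dY1 sr0; lra.
have bY : r ^+ 5 <= C2 * drift n sg Y * Y ^+ 4.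
  by rewrite rE -exprM; apply: hY => //; rewrite -?rE; clear - CdY dY1 sr0; lra.
have tYY : t0 * r <= Y by rewrite rE; apply: le_trans YY0.
have nr : n = r * r by rewrite nE rE -exprD.
have r1 : 1 <= r by rewrite rE exprn_ege1.
have KK : 40 * C1 <= K by rewrite KE.
have tT : T0 * C2 * K <= t0 by rewrite t0E'.
rewrite -xE in YKx.
have [j [j1 j2]] := bulk_transfer C11 C21 KK T01 dom5 tT nr r1 s0 st lf lg ncf ncg fp tf tg sv dd tYY Yn bY YKx.
exists j; split => //; apply: (le_trans j2); rewrite lerD2l.
have [D DE] : exists D, 1 + sg * r + sg * x + x ^+ 2 / n = D by eexists.
rewrite DE in dK *; have D1 : 1 + sg * r <= D by clear - DE sx0 xn0; lra.
clear hY bY fallback tYY Yu.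
have d1 : drift n sg Y <= (3 + 2 * K ^+ 3) * D by clear - dmax dY dK D1 sr0; lra.
have KD : D <= K ^+ 3 * D by rewrite ler_peMl //; clear - K3 D1 sr0; lra.
have d2 : drift n sg Y <= 5 * (K ^+ 3 * D) by clear - d1 KD; lra.
have d3 : C2 * drift n sg Y <= C2 * (5 * (K ^+ 3 * D)) by rewrite ler_wpM2l //; clear - C21; lra.
have d4 : 25 * (C2 * K ^+ 3) * D <= C * D by rewrite ler_wpM2r //; clear - D1 sr0; lra.
clear - d3 d4; lra.
Qed.

End Comparison.

(** * Ratios of consecutive hypergeometric weights *)

Section RatioAlgebra.
Variable R : realFieldType.
Implicit Types (k m n s x y b Y Z : R).

(** X and X' are centred at the midpoints of the steps. Relative to n(k + 1)(m + 1), the main term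
    is 2(y - x); the errors have orders s^2 Y, |s|Y^2/n and 1, which is where these terms of [drift]
    come from. *)
Lemma ratio_gap k m s x y :
  let n := k + m in
  let X := 2 * x + 1 in let X' := 2 * y + 1 in
  let i := x + k / 2 in let j := y + k * (1 + s) / 2 in
  let N0 := n / 2 in let N := n * (1 + s) / 2 in
  8 * ((k - i) * (N0 - i) * ((j + 1) * (m - N + j + 1)) -
       (k - j) * (N - j) * ((i + 1) * (m - N0 + i + 1))) =
  (n + 2) * (2 * (y - x) * ((k + 1) * (m + 1) - X * X') + s ^+ 2 * (k * m) * X
             + s * (m - k) * (X * X'))
  - s * (m - k) * ((k + 1) * (m + 1) + X ^+ 2).
Proof. by move=> n X X' i j N0 N; rewrite /N /N0 /i /j /X /X' /n; field. Qed.

Lemma ler_norm_opp (z t : R) : `|z| <= t -> - t <= z /\ z <= t.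
Proof. by rewrite ler_norml => /andP. Qed.

(** As 2XX' <= B, the main term is at least B(y - x). In units of B the errors cost at most 3 sg^2
    Y, 23 sg Y^2/n and 1, all covered by the constant 30. *)
Lemma ratio_gap_ge0 k m s sg x y Y :
  k + m <= 3 * k -> k + m <= 3 * m -> 0 < k -> 0 < m ->
  `|s| <= sg -> sg <= 1 -> `|x| <= Y -> Y <= (k + m) / 20 -> y - x <= Y ->
  30 * (1 + sg ^+ 2 * Y + sg * Y ^+ 2 / (k + m)) <= y - x ->
  forall X X', X = 2 * x + 1 -> X' = 2 * y + 1 ->
  0 <= (k + m + 2) * (2 * (y - x) * ((k + 1) * (m + 1) - X * X') + s ^+ 2 * (k * m) * X
             + s * (m - k) * (X * X'))
  - s * (m - k) * ((k + 1) * (m + 1) + X ^+ 2).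
Proof.
move=> hk hm k0 m0 hs s1 hx Yn dY dC X X' XE X'E.
have [n nE] : exists n, k + m = n by exists (k + m).
rewrite nE in hk hm Yn dC *.
have n0 : 0 < n by lra.
have sg0 : 0 <= sg by apply: le_trans hs.
have Y0 : 0 <= Y by apply: le_trans hx.
have q1 : 0 <= sg ^+ 2 * Y by rewrite mulr_ge0 ?sqr_ge0.
have q2 : 0 <= sg * Y ^+ 2 / n by rewrite !mulr_ge0 ?sqr_ge0 ?invr_ge0 // ltW.
have [d dE] : exists d, y - x = d by exists (y - x).
rewrite dE in dY dC *.
have d30 : 30 <= d by lra.
have [B BE] : exists B, (k + 1) * (m + 1) = B by exists ((k + 1) * (m + 1)).
rewrite BE.
have kn : 0 <= (3 * k - n) * (3 * m - n) by rewrite mulr_ge0 // subr_ge0.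
have km : 2 * n ^+ 2 <= 9 * (k * m).
  have n2 : n * n = n * k + n * m by rewrite -mulrDr nE.
  by rewrite expr2; lra.
have kmB : k * m <= B by rewrite -BE; lra.
have km0 : 0 <= k * m by rewrite mulr_ge0 // ltW.
have B0 : 0 < B by rewrite -BE mulr_gt0 //; lra.
have [x1 x2] := ler_norm_opp hx.
have X3 : `|X| <= 3 * Y by rewrite ler_norml XE; apply/andP; split; lra.
have X5 : `|X'| <= 5 * Y by rewrite ler_norml X'E; apply/andP; split; lra.
have XX : `|X * X'| <= 15 * Y ^+ 2.
  rewrite normrM; apply: (le_trans (ler_pM _ _ X3 X5)) => //.
  by rewrite expr2; lra.
have Y2 : 400 * Y ^+ 2 <= n ^+ 2.
  have : (20 * Y) ^+ 2 <= n ^+ 2 by rewrite lerXn2r // ?nnegrE; clear - Y0 Yn n0; lra.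
  by rewrite exprMn; lra.
have X2 : X ^+ 2 <= 9 * Y ^+ 2.
  rewrite -real_normK ?num_real //; have -> : 9 * Y ^+ 2 = (3 * Y) ^+ 2 by ring.
  by rewrite lerXn2r // ?nnegrE; clear - Y0; lra.
have mk : `|m - k| <= n / 3 by rewrite ler_norml; apply/andP; split; clear - hk hm nE; lra.
have [t tE] : exists t, s * (m - k) = t by exists (s * (m - k)).
have ht : `|t| <= sg * (n / 3) by rewrite -tE normrM ler_pM.
rewrite tE.
have E1 : B * d <= 2 * d * (B - X * X').
  have [_ u2] := ler_norm_opp XX.
  have : 0 <= d * (B - 2 * (X * X')) by rewrite mulr_ge0 //; lra.
  clear - d30; lra.
have s2 : s ^+ 2 <= sg ^+ 2 by rewrite -real_normK ?num_real // lerXn2r // nnegrE.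
have E2 : - (B * (3 * (sg ^+ 2 * Y))) <= s ^+ 2 * (k * m) * X.
  have : `|s ^+ 2 * (k * m) * X| <= sg ^+ 2 * B * (3 * Y).
    rewrite normrM ler_pM // normrM ler_pM //.
      by rewrite ger0_norm // sqr_ge0.
    by rewrite ger0_norm.
  by move=> /ler_norm_opp[]; clear - B0; lra.
have E3 : - (B * (23 * (sg * Y ^+ 2 / n))) <= t * (X * X').
  have : `|t * (X * X')| <= sg * (n / 3) * (15 * Y ^+ 2) by rewrite normrM ler_pM.
  move=> /ler_norm_opp[h _]; apply: le_trans h; rewrite lerN2.
  have -> : sg * (n / 3) * (15 * Y ^+ 2) = (sg * Y ^+ 2 / n) * (5 * n ^+ 2).
    by move: (lt0r_neq0 n0) => nz; field.
  have : 0 <= (sg * Y ^+ 2 / n) * (23 * B - 5 * n ^+ 2) by rewrite mulr_ge0 //; lra.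
  clear - B0; lra.
have E4 : t * (B + X ^+ 2) <= (n + 2) * B.
  have : `|t * (B + X ^+ 2)| <= (n / 3) * (B + B).
    rewrite normrM ler_pM //.
      by apply: (le_trans ht); rewrite ler_piMl //; clear - s1 n0; lra.
    by rewrite ger0_norm ?addr_ge0 ?sqr_ge0 ?(ltW B0) //; lra.
  move=> /ler_norm_opp[_ h]; apply: (le_trans h).
  have : 0 <= n * B by rewrite mulr_ge0 // ltW.
  clear - n0 B0; lra.
have E5 : 0 <= 2 * d * (B - X * X') + s ^+ 2 * (k * m) * X + t * (X * X') - B.
  have : 0 <= B * (d - 3 * (sg ^+ 2 * Y) - 23 * (sg * Y ^+ 2 / n) - 1).
    by rewrite mulr_ge0 ?(ltW B0) //; clear - dC q1 q2 d30; lra.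
  clear - E1 E2 E3; lra.
have := mulr_ge0 (_ : 0 <= n + 2) E5; clear - E4 n0; lra.
Qed.

(** For s = 0 a ratio of consecutive weights is (P - Q)/(P + Q) with P = B + X^2 and Q = (n + 2)X,
    and likewise at scale 4n. The left side is the leading part 2PQ4 - QP4 of the comparison of a
    squared ratio with a single one; the cubic 12nX^3 against 2B(4n + 2)b is the origin of Y^3/n^2
    in [drift]. *)
Lemma quarter_ratio_gap k m x b :
  let n := k + m in let X := 2 * x + 1 in let X' := 2 * X + b in
  let B := (k + 1) * (m + 1) in let B4 := (4 * k + 1) * (4 * m + 1) in
  2 * (B + X ^+ 2) * ((4 * n + 2) * X') - (n + 2) * X * (B4 + X' ^+ 2) =
  2 * B * (4 * n + 2) * b + X * (12 * n ^+ 2 - 24 * (k * m) + 15 * n + 6) +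
  12 * n * X ^+ 3 + b * X ^+ 2 * (4 * n - 4) - b ^+ 2 * X * (n + 2).
Proof. by move=> n X X' B B4; rewrite /B /B4 /X' /X /n; ring. Qed.

Lemma quarter_gap_ge0 k m x b Y :
  k + m <= 3 * k -> k + m <= 3 * m -> 0 < k -> 0 < m ->
  `|x| <= Y -> 1 <= Y -> Y <= (k + m) / 20 -> b <= 5 * Y ->
  2 * 10 ^+ 3 * (1 + Y ^+ 3 / (k + m) ^+ 2) <= b ->
  forall n X X' P Q P4 Q4, n = k + m -> X = 2 * x + 1 -> X' = 2 * X + b ->
  P = (k + 1) * (m + 1) + X ^+ 2 -> Q = (n + 2) * X ->
  P4 = (4 * k + 1) * (4 * m + 1) + X' ^+ 2 -> Q4 = (4 * n + 2) * X' ->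
  (P4 - Q4) ^+ 2 * (P + Q) <= (P4 + Q4) ^+ 2 * (P - Q).
Proof.
move=> hk hm k0 m0 hx Y1 Yn bY bC n X X' P Q P4 Q4 nE XE X'E PE QE P4E Q4E.
(* This is half the difference of the two sides, expanded. The left side is of lower order; the
   factor 2PQ4 - QP4 is evaluated by [quarter_ratio_gap]. *)
suff h : Q * Q4 ^+ 2 <= P4 * (2 * P * Q4 - Q * P4) by lra.
have -> : 2 * P * Q4 - Q * P4 = 2 * ((k + 1) * (m + 1)) * (4 * n + 2) * b +
    X * (12 * n ^+ 2 - 24 * (k * m) + 15 * n + 6) +
    12 * n * X ^+ 3 + b * X ^+ 2 * (4 * n - 4) - b ^+ 2 * X * (n + 2).
  by rewrite PE Q4E QE P4E X'E XE nE quarter_ratio_gap.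
rewrite -nE in hk hm Yn bC.
have [B BE] : exists B, (k + 1) * (m + 1) = B by exists ((k + 1) * (m + 1)).
rewrite BE; have [A AE] : exists A, k * m = A by exists (k * m).
rewrite AE.
have n0 : 0 < n by lra.
have kn : 0 <= (3 * k - n) * (3 * m - n) by rewrite mulr_ge0 // subr_ge0.
have km1 : 2 * n ^+ 2 <= 9 * A.
  have n2 : n * n = n * k + n * m by rewrite -mulrDr -nE.
  by rewrite -AE expr2; lra.
have km2 : 4 * A <= n ^+ 2.
  have := sqr_ge0 (k - m); rewrite -AE nE !expr2; lra.
have AB : A <= B by rewrite -AE -BE; lra.
have P4A : 16 * A <= P4.
  have := sqr_ge0 X'; rewrite P4E -AE; lra.
have hX : `|X| <= 3 * Y.
  have [x1 x2] := ler_norm_opp hx.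
  by rewrite ler_norml XE; apply/andP; split; lra.
have b0 : 0 <= Y ^+ 3 / n ^+ 2 by rewrite divr_ge0 ?exprn_ge0 //; clear - n0 Y1; lra.
have b1000 : 10 ^+ 3 <= b by lra.
have bY3 : 2 * 10 ^+ 3 * Y ^+ 3 <= b * n ^+ 2.
  have n20 : 0 < n ^+ 2 by rewrite exprn_gt0.
  by rewrite -ler_pdivrMr // -mulrA; lra.
rewrite Q4E QE X'E.
have n400 : 400 <= n by lra.
clear hk hm k0 m0 hx x XE QE Q4E P4E PE X'E P Q Q4 X' kn BE AE bC b0 k m nE.
have X2 : X ^+ 2 <= 9 * Y ^+ 2.
  rewrite -real_normK ?num_real //; have -> : 9 * Y ^+ 2 = (3 * Y) ^+ 2 by ring.
  by rewrite lerXn2r // ?nnegrE; lra.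
have X20 := sqr_ge0 X.
have Y30 : 0 <= Y ^+ 3 by rewrite exprn_ge0 //; lra.
have n3 : n ^+ 3 = n ^+ 2 * n by rewrite exprSr.
have n20 : 0 < n ^+ 2 by rewrite exprn_gt0.
have n30 : 0 < n ^+ 3 by rewrite exprn_gt0.
have bn3 : 2 * 10 ^+ 3 * (n * Y ^+ 3) <= b * n ^+ 3.
  by have := ler_wpM2r (ltW n0) bY3; rewrite n3; lra.
have bn30 : 0 <= b * n ^+ 3 by rewrite mulr_ge0 // ltW //; lra.
have T1 : 16 * (b * n ^+ 3) <= 9 * (2 * B * (4 * n + 2) * b).
  have : 0 <= b * n * (9 * B - 2 * n ^+ 2) by rewrite !mulr_ge0 //; clear - b1000 n0 km1 AB; lra.
  have : 0 <= B * b by rewrite mulr_ge0 //; clear - b1000 AB km1 n20; lra.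
  rewrite n3; clear - n0; lra.
have T2 : - (b * n ^+ 3) <= 50 * (X * (12 * n ^+ 2 - 24 * A + 15 * n + 6)).
  have : `|X * (12 * n ^+ 2 - 24 * A + 15 * n + 6)| <= 3 * Y * (7 * n ^+ 2).
    rewrite normrM ler_pM // ger0_norm; first by have := ler_wpM2r (ltW n0) n400; rewrite expr2; lra.
    lra.
  move=> /ler_norm_opp[h _].
  have : Y * n ^+ 2 <= n / 20 * n ^+ 2 by rewrite ler_wpM2r // ltW.
  have : 10 ^+ 3 * n ^+ 3 <= b * n ^+ 3 by rewrite ler_wpM2r // ltW.
  rewrite n3; lra.
have X3 : `|X ^+ 3| <= 27 * Y ^+ 3.
  rewrite normrX; have -> : 27 * Y ^+ 3 = (3 * Y) ^+ 3 by ring.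
  by rewrite lerXn2r // ?nnegrE; lra.
have T3 : - (162 * (b * n ^+ 3)) <= 10 ^+ 3 * (12 * n * X ^+ 3).
  have [h _] := ler_norm_opp X3.
  have := ler_wpM2l (ltW n0) h; lra.
have T4 : 0 <= b * X ^+ 2 * (4 * n - 4) by apply: mulr_ge0; [apply: mulr_ge0 => // |]; clear - b1000 n400; lra.
have T5 : - (b * n ^+ 3) <= 20 * (- (b ^+ 2 * X * (n + 2))).
  have h1 : `|b * X * (n + 2)| <= n / 4 * (3 * n / 20) * (n + n / 20).
    rewrite !normrM !ler_pM ?mulr_ge0 //.
    - by rewrite ger0_norm; clear - b1000 bY Yn; lra.
    - by apply: (le_trans hX); clear - Yn; lra.
    - by rewrite ger0_norm; clear - n400; lra.
  have [_ h2] := ler_norm_opp h1.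
  have := ler_wpM2l (_ : 0 <= b) h2; rewrite n3 !expr2; lra.
have main : 3 * (b * n ^+ 3) <= 2 * (2 * B * (4 * n + 2) * b + X * (12 * n ^+ 2 - 24 * A + 15 * n + 6) +
    12 * n * X ^+ 3 + b * X ^+ 2 * (4 * n - 4) - b ^+ 2 * X * (n + 2)) by clear - T1 T2 T3 T4 T5 bn30; lra.
have QQ : (n + 2) * X * ((4 * n + 2) * (2 * X + b)) ^+ 2 <= 6 * (10 ^+ 3 * (n ^+ 3 * Y ^+ 3)).
  have h1 : `|2 * X + b| <= 11 * Y.
    by have [x1 x2] := ler_norm_opp hX; rewrite ler_norml; apply/andP; split; clear - x1 x2 bY b1000 Y1; lra.
  have h2 : (2 * X + b) ^+ 2 <= 121 * Y ^+ 2.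
    rewrite -real_normK ?num_real //; have -> : 121 * Y ^+ 2 = (11 * Y) ^+ 2 by ring.
    by rewrite lerXn2r // ?nnegrE; clear - Y1; lra.
  have h3 : (4 * n + 2) ^+ 2 <= 81 / 5 * n ^+ 2.
    have := ler_wpM2r (ltW n0) n400; rewrite !expr2; clear - n400; lra.
  have h4 : `|(n + 2) * X * ((4 * n + 2) * (2 * X + b)) ^+ 2| <=
     (n + n / 200) * (3 * Y) * ((81 / 5 * n ^+ 2) * (121 * Y ^+ 2)).
    rewrite !exprMn normrM ler_pM // normrM ler_pM //; try by rewrite ger0_norm ?sqr_ge0.
    by rewrite ger0_norm; clear - n400; lra.
  have [_ h5] := ler_norm_opp h4; apply: (le_trans h5).
  have : 0 <= n ^+ 3 * Y ^+ 3 by rewrite mulr_ge0 // ltW.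
  rewrite !exprS !expr0; clear - n0; lra.
apply: (le_trans QQ).
have [W WE] : exists W, 2 * B * (4 * n + 2) * b + X * (12 * n ^+ 2 - 24 * A + 15 * n + 6) +
    12 * n * X ^+ 3 + b * X ^+ 2 * (4 * n - 4) - b ^+ 2 * X * (n + 2) = W by eexists.
rewrite WE in main *.
have p40 : 32 * n ^+ 2 <= 9 * P4 by clear - km1 P4A; lra.
clear T1 T2 T3 T4 T5 WE QQ X2 X20 X3 hX bY bY3 Yn km1 km2 AB P4A.
have h1 : 0 <= (9 * P4 - 32 * n ^+ 2) * (b * n ^+ 3) by rewrite mulr_ge0 // subr_ge0.
have h2 : P4 * (3 * (b * n ^+ 3)) <= P4 * (2 * W) by rewrite ler_wpM2l //; lra.
have h3 : n ^+ 2 * (2 * 10 ^+ 3 * (n * Y ^+ 3)) <= n ^+ 2 * (b * n ^+ 3) by rewrite ler_wpM2l // ltW.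
have h4 : n ^+ 2 * (n * Y ^+ 3) = n ^+ 3 * Y ^+ 3 by rewrite n3; ring.
have h5 : 0 <= n ^+ 3 * Y ^+ 3 by rewrite mulr_ge0 // ltW.
have h6 : n ^+ 2 * (2 * 10 ^+ 3 * (n * Y ^+ 3)) = 2 * 10 ^+ 3 * (n ^+ 3 * Y ^+ 3).
  by rewrite -h4; ring.
rewrite h6 in h3.
move: (n ^+ 3 * Y ^+ 3) (b * n ^+ 3) h1 h2 h3 h5 => u v h1 h2 h3 h5; lra.
Qed.

End RatioAlgebra.

(** * Hypergeometric laws, single and paired, satisfy the comparison hypotheses *)

Section HypergeometricComparison.
Variable R : realType.
Implicit Types (k m N a i j : nat).

Lemma hyp_law k m N : (N <= k + m)%N -> law k.+1 (hyp R k m N).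
Proof.
move=> Nn; split; [exact: hyp_ge0 | exact: hyp_eq0 | exact: sum_hyp].
Qed.

Lemma hyp_tail_bound k m N : (0 < m)%N -> (N <= k + m)%N ->
  tail_bound (k + m)%:R (hyp_mean R k m N) k.+1 (hyp R k m N).
Proof.
move=> m0 Nn Y hY; apply: (le_trans (hyp_tail m0 Nn hY)).
have n0 : 0 < (k + m)%:R :> R by rewrite ltr0n; lia.
rewrite ler_wpM2l // ler_expR lerN2 ler_wpM2l ?sqr_ge0 //.
by rewrite lef_pV2 ?posrE ?mulr_gt0 // ler_wpM2r ?(ltW n0) // ler_nat.
Qed.

Lemma ratio_expR (g0 g1 D N c : R) : 0 < D -> 0 < N -> 0 <= g0 -> 0 <= g1 ->
  g1 * D = g0 * N -> `|D - N| <= c * D -> `|D - N| <= c * N ->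
  g1 <= expR c * g0 /\ g0 <= expR c * g1.
Proof.
move=> D0 N0 h0 h1 E cD cN; have ec := expR_ge1Dx c.
have [d1 d2] := ler_norm_opp cD; have [n1 n2] := ler_norm_opp cN.
split.
  apply: (@le_trans _ _ ((1 + c) * g0)); last by rewrite ler_wpM2r.
  rewrite -(ler_pM2r D0) E mulrAC [leLHS]mulrC ler_wpM2r //; lra.
apply: (@le_trans _ _ ((1 + c) * g1)); last by rewrite ler_wpM2r.
rewrite -(ler_pM2r N0) -E mulrAC [leLHS]mulrC ler_wpM2r //; lra.
Qed.

(** Numerator and denominator of the ratio are both at least n^2/100, and they differ by at most
    3Zn; the quotient of these bounds is 300 Z/n. *)
Lemma hyp_slowly_varying k m N :
  (k + m)%:R <= 3 * k%:R :> R -> (k + m)%:R <= 3 * m%:R :> R ->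
  `|2 * N%:R - (k + m)%:R| <= (k + m)%:R / 10 :> R ->
  slowly_varying 300 (k + m)%:R (hyp_mean R k m N) (hyp R k m N).
Proof.
move=> hk hm hN Z j /andP[Z1 Z20] hj.
have E := hyp_ratio R k m N j.
have n0 : 0 < (k + m)%:R :> R by lra.
have [p pE] : exists p : R, p * (k + m)%:R = N%:R.
  by exists (N%:R / (k + m)%:R); rewrite divfK // gt_eqF.
have cE : hyp_mean R k m N = k%:R * p.
  by rewrite /hyp_mean -pE mulrA mulfK // gt_eqF.
have nE : (k + m)%:R = k%:R + m%:R :> R by rewrite natrD.
have /ler_norm_opp[p1 p2] : `|2 * p - 1| <= 1 / 10.
  have e : `|2 * p - 1| * (k + m)%:R = `|2 * N%:R - (k + m)%:R|.
    by rewrite -[X in _ * X](gtr0_norm n0) -normrM mulrBl mul1r -mulrA pE.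
  by rewrite -(ler_pM2r n0) e; lra.
rewrite cE in hj; rewrite nE in pE.
have [y yE] : exists y : R, j%:R = k%:R * p + y by exists (j%:R - k%:R * p); ring.
rewrite yE [X in X - _]addrC addrK in hj.
have [y1 y2] := ler_norm_opp hj.
have [K KE] : exists K : R, k%:R = K by eexists.
have [M ME] : exists M : R, m%:R = M by eexists.
rewrite -pE yE KE ME in E; rewrite nE KE ME in hk hm Z20 *.
have Kp1 : 0 <= (K - (K + M) / 3) * (p - 9 / 20) by rewrite mulr_ge0 //; clear - p1 p2 hk hm; lra.
have Kp2 : 0 <= (K - (K + M) / 3) * (11 / 20 - p) by rewrite mulr_ge0 //; clear - p1 p2 hk hm; lra.
have Mp1 : 0 <= (M - (K + M) / 3) * (p - 9 / 20) by rewrite mulr_ge0 //; clear - p1 p2 hk hm; lra.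
have Mp2 : 0 <= (M - (K + M) / 3) * (11 / 20 - p) by rewrite mulr_ge0 //; clear - p1 p2 hk hm; lra.
have np1 : 0 <= (K + M) * (p - 9 / 20) by rewrite mulr_ge0 //; clear - p1 p2 hk hm; lra.
have np2 : 0 <= (K + M) * (11 / 20 - p) by rewrite mulr_ge0 //; clear - p1 p2 hk hm; lra.
have [n nD] : exists n : R, K + M = n by eexists.
have a1 : n / 10 <= K * p + y + 1 by lra.
have a2 : n / 10 <= M - p * (K + M) + (K * p + y) + 1 by lra.
have a3 : n / 10 <= K - (K * p + y) by lra.
have a4 : n / 10 <= p * (K + M) - (K * p + y) by lra.
have n1 : 0 < n / 10 by lra.
have D1 : n ^+ 2 / 100 <= (K * p + y + 1) * (M - p * (K + M) + (K * p + y) + 1).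
  have -> : n ^+ 2 / 100 = n / 10 * (n / 10) by field.
  by rewrite ler_pM // ltW.
have N1 : n ^+ 2 / 100 <= (K - (K * p + y)) * (p * (K + M) - (K * p + y)).
  have -> : n ^+ 2 / 100 = n / 10 * (n / 10) by field.
  by rewrite ler_pM // ltW.
have n2 : 0 < n ^+ 2 / 100 by rewrite divr_gt0 ?exprn_gt0 //; clear - n1; lra.
have gap : `|(K * p + y + 1) * (M - p * (K + M) + (K * p + y) + 1) -
   (K - (K * p + y)) * (p * (K + M) - (K * p + y))| <= 3 * Z * n.
  have -> : (K * p + y + 1) * (M - p * (K + M) + (K * p + y) + 1) -
   (K - (K * p + y)) * (p * (K + M) - (K * p + y)) =
   y * n + (K * p + M - M * p) + 2 * y + 1 by rewrite -nD; ring.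
  have w1 : `|y * n| <= Z * n by rewrite normrM ler_pM // gtr0_norm //; clear - n1; lra.
  have [v1 v2] := ler_norm_opp w1.
  have Zn : n <= Z * n by rewrite ler_peMl //; clear - Z1 n1; lra.
  by rewrite ler_norml; apply/andP; split; clear - v1 v2 Zn y1 y2 Z1 Z20 np1 np2 Kp1 Kp2 Mp1 Mp2 nD p1 p2 hk hm n1; lra.
have scale (D : R) : n ^+ 2 / 100 <= D -> 3 * Z * n <= 300 * Z / n * D.
  move=> hD; apply: (@le_trans _ _ (300 * Z / n * (n ^+ 2 / 100))).
    have -> : 300 * Z / n * (n ^+ 2 / 100) = 3 * Z * n by field; clear - n1; lra.
    exact: lexx.
  rewrite ler_wpM2l // divr_ge0 ?mulr_ge0 ?ler0n //; clear - Z1 n1; lra.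
rewrite nD; rewrite nD in E D1 N1 gap *.
apply: (ratio_expR _ _ (hyp_ge0 _ _ _ _ _) (hyp_ge0 _ _ _ _ _) E).
- by apply: lt_le_trans D1.
- by apply: lt_le_trans N1.
- by apply: (le_trans gap); apply: scale.
- by apply: (le_trans gap); apply: scale.
Qed.

Lemma cross_le (g0 g1 f0 f1 Dg Ng Df Nf : R) : 0 < Dg -> 0 < Df -> 0 <= g0 -> 0 <= f0 ->
  g1 * Dg = g0 * Ng -> f1 * Df = f0 * Nf -> Ng * Df <= Nf * Dg ->
  g1 * f0 <= g0 * f1.
Proof.
move=> Dg0 Df0 g00 f00 Eg Ef h.
rewrite -(ler_pM2r (mulr_gt0 Dg0 Df0)).
have -> : g1 * f0 * (Dg * Df) = (g1 * Dg) * (f0 * Df) by ring.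
have -> : g0 * f1 * (Dg * Df) = (f1 * Df) * (g0 * Dg) by ring.
rewrite Eg Ef.
have := mulr_ge0 (mulr_ge0 g00 f00) (_ : 0 <= Nf * Dg - Ng * Df).
rewrite subr_ge0 => /(_ h); lra.
Qed.

Lemma hyp_mean_half k m N0 : (0 < k + m)%N -> (k + m = 2 * N0)%N ->
  hyp_mean R k m N0 = k%:R / 2.
Proof.
move=> n0 nE; rewrite /hyp_mean nE natrM; field.
by rewrite pnatr_eq0; lia.
Qed.

(** In the centred coordinates x and y, with s = 2N/n - 1, the cross-multiplied ratio condition is
    [ratio_gap_ge0]. The bounds |s| <= 1/10 and Y <= n/20 keep both denominators positive. *)
Lemma hyp_drift_dominated k m N N0 : (k + m = 2 * N0)%N ->
  (k + m)%:R <= 3 * k%:R :> R -> (k + m)%:R <= 3 * m%:R :> R ->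
  (0 < k)%N -> (0 < m)%N ->
  `|2 * N%:R - (k + m)%:R| <= (k + m)%:R / 10 :> R ->
  drift_dominated (2 * 10 ^+ 3) (k + m)%:R (`|2 * N%:R - (k + m)%:R| / (k + m)%:R)
    (hyp_mean R k m N0) (hyp_mean R k m N) (hyp R k m N0) (hyp R k m N).
Proof.
move=> nN hk hm k0 m0 hN Y i j /andP[Y0 Y20].
rewrite (hyp_mean_half _ nN); last lia.
have n0 : 0 < (k + m)%:R :> R by rewrite ltr0n; lia.
have nE : (k + m)%:R = k%:R + m%:R :> R by rewrite natrD.
have N0E : N0%:R = (k + m)%:R / 2 :> R by rewrite nN natrM; field.
have [s sE] : exists s : R, s * (k + m)%:R = 2 * N%:R - (k + m)%:R.
  by exists ((2 * N%:R - (k + m)%:R) / (k + m)%:R); rewrite divfK // gt_eqF.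
have sgE : `|2 * N%:R - (k + m)%:R| / (k + m)%:R = `|s| :> R.
  by rewrite -sE normrM (gtr0_norm n0) mulfK // gt_eqF.
have NE : N%:R = (k + m)%:R * (1 + s) / 2 :> R by rewrite mulrDr mulr1 [_ * s]mulrC sE; field.
have cE : hyp_mean R k m N = k%:R * (1 + s) / 2.
  by rewrite /hyp_mean NE; move: ((k + m)%:R) (lt0r_neq0 n0) => n nz; field.
have s10 : `|s| <= 1 / 10 by rewrite -sgE ler_pdivrMr //; lra.
rewrite sgE cE.
have [x xE] : exists x : R, i%:R = x + k%:R / 2 by exists (i%:R - k%:R / 2); ring.
have [y yE] : exists y : R, j%:R = y + k%:R * (1 + s) / 2.
  by exists (j%:R - k%:R * (1 + s) / 2); ring.
rewrite xE yE !addrK => hx /andP[d1 d2].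
have Ef := hyp_ratio R k m N0 i; have Eg := hyp_ratio R k m N j.
have K0 : 0 < k%:R :> R by rewrite ltr0n.
have M0 : 0 < m%:R :> R by rewrite ltr0n.
rewrite nE in hk hm Y20 d1 NE N0E.
have gap := ratio_gap k%:R m%:R s x y; rewrite /= -NE -N0E -xE -yE in gap.
move: (k%:R : R) (m%:R : R) K0 M0 hk hm Y20 d1 NE N0E gap xE yE Ef Eg {n0 nE cE sE sgE hN} => K M K0 M0 hk hm Y20 d1 NE N0E gap xE yE Ef Eg.
have n0 : 0 < K + M by lra.
have sr0 : 0 <= `|s| * Num.sqrt (K + M) by rewrite mulr_ge0 ?sqrtr_ge0.
have p2 : 0 <= `|s| ^+ 2 * Y by rewrite mulr_ge0 ?sqr_ge0.
have p3 : 0 <= `|s| * Y ^+ 2 / (K + M) by rewrite !mulr_ge0 ?sqr_ge0 ?invr_ge0 // ltW.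
have p4 : 0 <= Y ^+ 3 / (K + M) ^+ 2 by rewrite divr_ge0 ?exprn_ge0 // ltW.
have dC : 30 * (1 + `|s| ^+ 2 * Y + `|s| * Y ^+ 2 / (K + M)) <= y - x.
  by apply: le_trans d1; rewrite /drift; lra.
have s1 : `|s| <= 1 by lra.
have [x1 x2] := ler_norm_opp hx.
have [t1 t2] := ler_norm_opp s10.
have Ks1 : 0 <= K * (s + 1 / 10) by rewrite mulr_ge0 //; lra.
have Ms1 : 0 <= M * (1 / 10 - s) by rewrite mulr_ge0 //; lra.
have d3 : 0 <= y - x.
  by apply: le_trans dC; lra.
have G := ratio_gap_ge0 hk hm K0 M0 (lexx _) s1 hx Y20 d2 dC (erefl _) (erefl _).
rewrite -gap pmulr_rge0 // subr_ge0 in G; clear gap.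
apply: (cross_le _ _ (hyp_ge0 _ _ _ _ _) (hyp_ge0 _ _ _ _ _) Eg Ef G).
- by clear G Eg Ef; rewrite yE NE; apply: mulr_gt0; lra.
- by clear G Eg Ef; rewrite xE N0E; apply: mulr_gt0; lra.
Qed.

(** Two neighbouring counts at scale 4n correspond to one count at scale n, because 2W_1 moves in
    steps of 4 and W_2 in steps of 2. *)
Definition pair_hyp k m N j : R := hyp R k m N (2 * j)%N + hyp R k m N (2 * j).+1.

Lemma big_pairs (F : nat -> R) (M : nat) :
  \sum_(i < M) (F (2 * i)%N + F (2 * i).+1) = \sum_(a < 2 * M) F a.
Proof.
elim: M => [|M IH]; first by rewrite muln0 !big_ord0.
by rewrite big_ord_recr /= IH mulnS !add2n !big_ord_recr /= addrA.
Qed.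

Lemma pair_law k m N : (N <= 4 * k + 4 * m)%N ->
  law (2 * k).+1 (pair_hyp (4 * k) (4 * m) N).
Proof.
move=> Nn; split.
- by move=> j; rewrite addr_ge0 ?hyp_ge0.
- by move=> j hj; rewrite /pair_hyp !hyp_eq0 ?addr0 //; lia.
- rewrite /pair_hyp (big_pairs (hyp R (4 * k) (4 * m) N)).
  have -> : (2 * (2 * k).+1 = (4 * k).+2)%N by lia.
  by rewrite big_ord_recr /= hyp_eq0 // addr0 sum_hyp.
Qed.

Lemma pair_tail_bound k m N0 : (0 < m)%N -> (k + m = 2 * N0)%N ->
  tail_bound (k + m)%:R k%:R (2 * k).+1 (pair_hyp (4 * k) (4 * m) (4 * N0)).
Proof.
move=> m0 nN Y /andP[Y0 Yn].
have n0 : 0 < (k + m)%:R :> R by rewrite ltr0n; lia.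
have mu : hyp_mean R (4 * k) (4 * m) (4 * N0) = 2 * k%:R.
  by rewrite hyp_mean_half ?natrM; [field | lia | lia].
have n4 : (4 * k + 4 * m)%:R = 4 * (k + m)%:R :> R by rewrite -natrM; congr (_%:R); lia.
(* Below 2 the right side is at least 2(1 - 1/4) > 1. From 2 on, both members of an outlying pair
   are at distance at least 2Y - 1 >= Y. *)
have [Y1|Y1] := ltP Y 2.
  have lf := @pair_law k m (4 * N0) ltac:(lia).
  have [f0 _ s1] := lf.
  apply: (@le_trans _ _ 1).
    rewrite -[leRHS]s1 [leRHS](bigID (fun i : 'I_(2 * k).+1 => Y <= `|i%:R - k%:R|)) /= lerDl.
    by apply: sumr_ge0.
  have v : - (Y ^+ 2 / (16 * (k + m)%:R)) >= - (1 / 4).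
    rewrite lerN2 ler_pdivrMr ?mulr_gt0 //.
    have : 1 <= (k + m)%:R :> R by rewrite ler1n; lia.
    have : Y ^+ 2 <= 2 ^+ 2 by rewrite lerXn2r // ?nnegrE ?ltW.
    rewrite expr2; lra.
  have := expR_ge1Dx (- (Y ^+ 2 / (16 * (k + m)%:R))); lra.
have h := @hyp_tail R (4 * k) (4 * m) (4 * N0) (2 * Y - 1) ltac:(lia) ltac:(lia).
rewrite mu n4 in h.
apply: le_trans (_ : 2 * expR (- ((2 * Y - 1) ^+ 2 / (4 * (4 * (k + m)%:R)))) <= _); last first.
  rewrite ler_wpM2l // ler_expR lerN2.
  have -> : 4 * (4 * (k + m)%:R) = 16 * (k + m)%:R :> R by ring.
  rewrite ler_wpM2r ?invr_ge0 ?mulr_ge0 ?(ltW n0) //.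
  rewrite lerXn2r ?nnegrE //; lra.
apply: le_trans (h _); last by apply/andP; split; lra.
have -> : \sum_(a < (4 * k).+1 | 2 * Y - 1 <= `|a%:R - 2 * k%:R|) hyp R (4 * k) (4 * m) (4 * N0) a =
  \sum_(a < (4 * k).+2 | 2 * Y - 1 <= `|a%:R - 2 * k%:R|) hyp R (4 * k) (4 * m) (4 * N0) a.
  rewrite big_mkcond [RHS]big_mkcond [RHS]big_ord_recr /= (hyp_eq0 _ _ _ (ltnSn (4 * k))).
  by rewrite if_same addr0.
have -> : ((4 * k).+2 = 2 * (2 * k).+1)%N by lia.
rewrite [leLHS]big_mkcond [leRHS]big_mkcond /=.
rewrite -(big_pairs (fun a => if 2 * Y - 1 <= `|a%:R - 2 * k%:R| then hyp R (4 * k) (4 * m) (4 * N0) a else 0)).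
apply: ler_sum => j _; case: ifP => hj; last first.
  by apply: addr_ge0; case: ifP => // _; exact: hyp_ge0.
have -> : 2 * Y - 1 <= `|(2 * j)%:R - 2 * k%:R|.
  rewrite natrM -mulrBr normrM ger0_norm //; lra.
have -> : 2 * Y - 1 <= `|(2 * j).+1%:R - 2 * k%:R|; last by [].
rewrite -[(2 * j).+1%:R]natr1 natrM.
have -> : 2 * j%:R + 1 - 2 * k%:R = 1 + 2 * (j%:R - k%:R) :> R by ring.
have := lerB_normD 1 (2 * (j%:R - k%:R) : R); have := lerB_normD (2 * (j%:R - k%:R) : R) 1.
by rewrite normrM normr1 ger0_norm // [_ + 1]addrC; lra.
Qed.

(** One step of the pair index is two steps of the count. Within 4Z of the centre at scale 4n each
    costs 300(4Z)/(4n) = 300 Z/n, whence 600. *)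
Lemma pair_slowly_varying k m N0 : (k + m = 2 * N0)%N -> (0 < m)%N ->
  (k + m)%:R <= 3 * k%:R :> R -> (k + m)%:R <= 3 * m%:R :> R ->
  slowly_varying 600 (k + m)%:R k%:R (pair_hyp (4 * k) (4 * m) (4 * N0)).
Proof.
move=> nN m0 hk hm Z j /andP[Z1 Z20] hj.
have n0 : 0 < (k + m)%:R :> R by rewrite ltr0n; lia.
have mu : hyp_mean R (4 * k) (4 * m) (4 * N0) = 2 * k%:R.
  by rewrite hyp_mean_half ?natrM; [field | lia | lia].
have n4 : (4 * k + 4 * m)%:R = 4 * (k + m)%:R :> R by rewrite -natrM; congr (_%:R); lia.
have sv : slowly_varying 300 (4 * (k + m)%:R) (2 * k%:R) (hyp R (4 * k) (4 * m) (4 * N0)).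
  rewrite -mu -n4; apply: hyp_slowly_varying; rewrite n4 ?natrM; try lra.
  have -> : 2 * (4 * N0%:R) - 4 * (k + m)%:R = 0 :> R by rewrite nN natrM; ring.
  by rewrite normr0; lra.
have step a : (2 * j <= a)%N -> (a <= (2 * j).+2)%N ->
  hyp R (4 * k) (4 * m) (4 * N0) a.+1 <= expR (300 * Z / (k + m)%:R) * hyp R (4 * k) (4 * m) (4 * N0) a /\
  hyp R (4 * k) (4 * m) (4 * N0) a <= expR (300 * Z / (k + m)%:R) * hyp R (4 * k) (4 * m) (4 * N0) a.+1.
  move=> a1 a2; have := sv (4 * Z) a.
  have -> : 300 * (4 * Z) / (4 * (k + m)%:R) = 300 * Z / (k + m)%:R.
    by move: ((k + m)%:R) (lt0r_neq0 n0) => n nz; field.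
  apply; first by apply/andP; split; lra.
  have [j1 j2] := ler_norm_opp hj.
  move: a1 a2; rewrite -!(ler_nat R) -natr1 -natr1 natrM => a1 a2.
  by rewrite ler_norml; apply/andP; split; lra.
have [u1 v1] := step (2 * j)%N (leqnn _) (leqW (leqnSn _)).
have [u2 v2] := step (2 * j).+1 (leqnSn _) (leqnSn _).
have [u3 v3] := step (2 * j).+2 (leqW (leqnSn _)) (leqnn _).
have -> : 600 * Z / (k + m)%:R = 300 * Z / (k + m)%:R + 300 * Z / (k + m)%:R by ring.
rewrite expRD /pair_hyp mulnS add2n; move: (expR _) (expR_ge0 (300 * Z / (k + m)%:R)) u1 u2 u3 v1 v2 v3 => E E0 u1 u2 u3 v1 v2 v3.
have := ler_wpM2l E0 u1; have := ler_wpM2l E0 u2.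
have := ler_wpM2l E0 v2; have := ler_wpM2l E0 v3.
move=> *; split; lra.
Qed.

(** Advancing a pair multiplies its members by r1 r2 and r2 r3, where the r's are consecutive ratios
    at scale 4n. Each square r^2 is at most the ratio [rf] at scale n by [quarter_gap_ge0], so both
    products are too, by the inequality of means. *)
Lemma pair_drift_dominated k m N0 : (k + m = 2 * N0)%N ->
  (k + m)%:R <= 3 * k%:R :> R -> (k + m)%:R <= 3 * m%:R :> R ->
  (0 < k)%N -> (0 < m)%N ->
  drift_dominated (2 * 10 ^+ 3) (k + m)%:R 0
    (hyp_mean R k m N0) k%:R (hyp R k m N0) (pair_hyp (4 * k) (4 * m) (4 * N0)).
Proof.
move=> nN hk hm k0 m0 Y i j /andP[Y0 Y20].
rewrite (hyp_mean_half _ nN); last lia.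
have n0 : 0 < (k + m)%:R :> R by rewrite ltr0n; lia.
have nE : (k + m)%:R = k%:R + m%:R :> R by rewrite natrD.
have N0E : N0%:R = (k + m)%:R / 2 :> R by rewrite nN natrM; field.
have K0 : 0 < k%:R :> R by rewrite ltr0n.
have M0 : 0 < m%:R :> R by rewrite ltr0n.
rewrite /drift expr0n /= !mul0r !addr0 => hx /andP[d1 d2].
have p4 : 0 <= Y ^+ 3 / (k + m)%:R ^+ 2 by rewrite divr_ge0 ?exprn_ge0 // ltW.
have Y2000 : 2 * 10 ^+ 3 <= Y by lra.
have [x1 x2] := ler_norm_opp hx.
rewrite nE in hk hm Y20 d1 N0E p4.
have Ef := hyp_ratio R k m N0 i.
pose g := hyp R (4 * k) (4 * m) (4 * N0).
pose Nf : R := (k%:R - i%:R) * (N0%:R - i%:R).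
pose Df : R := (i%:R + 1) * (m%:R - N0%:R + i%:R + 1).
have Df0 : 0 < Df by rewrite /Df N0E; apply: mulr_gt0; lra.
pose rf := Nf / Df.
have key a : (2 * j <= a)%N -> (a <= (2 * j).+2)%N -> exists2 r, g a.+1 = r * g a & 0 <= r /\ r ^+ 2 <= rf.
  rewrite -!(ler_nat R) -natr1 -natr1 natrM => a1 a2.
  have Eg := hyp_ratio R (4 * k) (4 * m) (4 * N0) a.
  pose D4 : R := (a%:R + 1) * ((4 * m)%:R - (4 * N0)%:R + a%:R + 1).
  pose N4 : R := ((4 * k)%:R - a%:R) * ((4 * N0)%:R - a%:R).
  have D40 : 0 < D4 by rewrite /D4 !natrM N0E; apply: mulr_gt0; lra.
  have N40 : 0 < N4 by rewrite /N4 !natrM N0E; apply: mulr_gt0; lra.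
  exists (N4 / D4).
    by rewrite mulrAC [N4 * _]mulrC /g -Eg mulfK // gt_eqF.
  split; first by rewrite divr_ge0 // ltW.
  rewrite /rf exprMn exprVn ler_pdivrMr ?exprn_gt0 // mulrAC ler_pdivlMr //.
  have b1 : 2 * (a%:R - 2 * k%:R) + 1 - 2 * (2 * (i%:R - k%:R / 2) + 1) <= 5 * Y by lra.
  have b2 : 2 * 10 ^+ 3 * (1 + Y ^+ 3 / (k%:R + m%:R) ^+ 2) <=
     2 * (a%:R - 2 * k%:R) + 1 - 2 * (2 * (i%:R - k%:R / 2) + 1) by lra.
  have Y1 : 1 <= Y by lra.
  have := quarter_gap_ge0 hk hm K0 M0 hx Y1 Y20 b1 b2
    (erefl _) (erefl _) (erefl _) (erefl _) (erefl _) (erefl _) (erefl _).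
  set L := (X in X <= _ -> _); set U := (X in _ <= X -> _) => LU.
  have LE : L = 64 * (N4 ^+ 2 * Df).
    by rewrite /L /N4 /Df !natrM N0E; field.
  have UE : U = 64 * (Nf * D4 ^+ 2).
    by rewrite /U /Nf /D4 !natrM N0E; field.
  rewrite LE UE in LU; clear - LU; lra.
have [r1 e1 [r10 h1]] := key (2 * j)%N (leqnn _) (leqW (leqnSn _)).
have [r2 e2 [r20 h2]] := key (2 * j).+1 (leqnSn _) (leqnSn _).
have [r3 e3 [r30 h3]] := key (2 * j).+2 (leqW (leqnSn _)) (leqnn _).
have fE : hyp R k m N0 i.+1 = rf * hyp R k m N0 i.
  by rewrite /rf mulrAC [Nf * _]mulrC /Nf -Ef mulfK // gt_eqF.
have q1 : r1 * r2 <= rf by have := sqr_ge0 (r1 - r2); rewrite sqrrB; lra.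
have q2 : r2 * r3 <= rf by have := sqr_ge0 (r2 - r3); rewrite sqrrB; lra.
have g1 : 0 <= g (2 * j)%N by exact: hyp_ge0.
have g2 : 0 <= g (2 * j).+1 by exact: hyp_ge0.
have t1 : r2 * g (2 * j).+1 <= rf * g (2 * j)%N.
  by rewrite e1 mulrA [r2 * _]mulrC ler_wpM2r.
have t2 : r3 * (r2 * g (2 * j).+1) <= rf * g (2 * j).+1.
  by rewrite mulrA [r3 * _]mulrC ler_wpM2r.
rewrite fE [leRHS]mulrA ler_wpM2r ?hyp_ge0 // /pair_hyp mulnS add2n -/g e3 e2.
by rewrite [leRHS]mulrC mulrDr; apply: lerD.
Qed.

End HypergeometricComparison.

(** * The monotone coupling *)

Section DiscreteProbability.
Variables (R : realType) (n : nat) (w : nat -> R).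
Hypotheses (w_ge0 : forall t, 0 <= w t) (sum_w : \sum_(t < n) w t = 1).
Local Open Scope ereal_scope.

Definition discrete_measure : set nat -> \bar R :=
  msum (fun t => mscale (NngNum (w_ge0 t)) (\d_ t)) n.

HB.instance Definition _ := Measure.on discrete_measure.

Lemma discrete_measureE (A : set nat) :
  discrete_measure A = (\sum_(t < n) w t * \1_A (t : nat))%R%:E.
Proof.
rewrite /discrete_measure /msum -sumEFin; apply: eq_bigr => t _.
by rewrite /mscale /= EFinM.
Qed.

Lemma discrete_measure_setT : discrete_measure setT = 1.
Proof.
rewrite discrete_measureE -[1]/(1%R%:E) -sum_w; congr EFin.
by apply: eq_bigr => t _; rewrite indicT mulr1.
Qed.

HB.instance Definition _ :=
  Measure_isProbability.Build _ _ _ discrete_measure discrete_measure_setT.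

Definition discrete_probability : probability nat R := discrete_measure.

(** An alias to carry the structure of a measurable function: every subset of [nat] is
    measurable. *)
Definition nat_fun (X : nat -> R) : nat -> R := X.

Lemma measurable_nat_fun (X : nat -> R) : measurable_fun setT (nat_fun X).
Proof. by move=> _ A _. Qed.

HB.instance Definition _ (X : nat -> R) :=
  isMeasurableFun.Build _ _ _ _ (nat_fun X) (@measurable_nat_fun X).

Lemma discrete_expectation (X : nat -> R) : (forall t, 0 <= X t)%R ->
  'E_discrete_probability[X] = (\sum_(t < n) w t * X t)%R%:E.
Proof.
move=> X0; rewrite unlock.
rewrite ge0_integral_measure_sum //; last by move=> x _; rewrite lee_fin.
rewrite -sumEFin; apply: eq_bigr => t _.
rewrite ge0_integral_mscale //; last by move=> x _; rewrite lee_fin.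
by rewrite integral_dirac //= diracT mul1e.
Qed.

End DiscreteProbability.

Lemma big_divmod (R : realType) (M M' : nat) (F : nat -> nat -> R) : (0 < M')%N ->
  \sum_(t < M * M') F (t %/ M')%N (t %% M')%N = \sum_(i < M) \sum_(j < M') F i j.
Proof.
move=> M'0; elim: M => [|M IH]; first by rewrite !big_ord0.
rewrite big_ord_recr /= -IH mulSnr big_split_ord /=; congr (_ + _).
apply: eq_bigr => j _.
by rewrite divnMDl // divn_small // addn0 modnMDl modn_small.
Qed.

(** The pair (i, j) is coded as iM' + j, so that one discrete probability on [nat] carries both
    variables. *)
Lemma finite_coupling (R : realType) (M M' : nat) (p : nat -> nat -> R) (u v : nat -> R) :
  (forall i j, 0 <= p i j) -> \sum_(i < M) \sum_(j < M') p i j = 1 ->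
  exists (Q : probability nat R) (U V : {RV Q >-> R}),
  [/\ forall A, distribution Q U A = (\sum_(i < M) (\sum_(j < M') p i j) * \1_A (u i))%:E,
      forall A, distribution Q V A = (\sum_(j < M') (\sum_(i < M) p i j) * \1_A (v j))%:E &
      forall psi : R -> R -> R, (forall x y, 0 <= psi x y) ->
        ('E_Q[fun t => psi (U t) (V t)])%E =
        (\sum_(i < M) \sum_(j < M') p i j * psi (u i) (v j))%:E].
Proof.
move=> p0 p1.
have M'0 : (0 < M')%N.
  case: M' p1 => // p1; exfalso; move: p1.
  rewrite big1 => [/eqP|i _]; last by rewrite big_ord0.
  by rewrite eq_sym oner_eq0.
pose w t := p (t %/ M')%N (t %% M')%N.
have w0 t : 0 <= w t by exact: p0.
have w1 : \sum_(t < M * M') w t = 1 by rewrite (big_divmod M p M'0).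
exists (discrete_probability w0 w1).
exists (nat_fun (fun t => u (t %/ M')%N)), (nat_fun (fun t => v (t %% M')%N)).
split.
- move=> A; rewrite /distribution /pushforward /= [LHS]discrete_measureE; congr EFin.
  rewrite (big_divmod M (fun i j => p i j * \1_A (u i)) M'0).
  by apply: eq_bigr => i _; rewrite mulr_suml.
- move=> A; rewrite /distribution /pushforward /= [LHS]discrete_measureE; congr EFin.
  rewrite (big_divmod M (fun i j => p i j * \1_A (v j)) M'0) exchange_big /=.
  by apply: eq_bigr => i _; rewrite mulr_suml.
- move=> psi psi0; rewrite discrete_expectation //.
  by rewrite -(big_divmod M (fun i j => p i j * psi (u i) (v j)) M'0).
Qed.

(** * Quantile coupling of two laws on the integers *)

Section MonotoneCoupling.
Variable R : realType.
Implicit Types (f g : nat -> R) (M i j : nat).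

Definition cumul f i : R := \sum_(z < i) f z.

(* The length of the intersection of the i-th cell of f with the j-th cell of g,
   both laws being laid out as consecutive intervals of [0, 1]. *)
Definition overlap f g i j : R :=
  Num.min (cumul f i.+1) (cumul g j.+1) - Num.min (cumul f i) (cumul g j.+1)
  - Num.min (cumul f i.+1) (cumul g j) + Num.min (cumul f i) (cumul g j).

Lemma cumulS f i : cumul f i.+1 = cumul f i + f i.
Proof. by rewrite /cumul big_ord_recr. Qed.

Lemma overlapC f g i j : overlap f g i j = overlap g f j i.
Proof.
rewrite /overlap ![Num.min (cumul f _) _]minC; ring.
Qed.

Lemma overlap_ge0 f g i j : (forall z, 0 <= f z) -> (forall z, 0 <= g z) ->
  0 <= overlap f g i j.
Proof.
move=> f0 g0; rewrite /overlap !cumulS; have := f0 i; have := g0 j.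
move: (cumul f i) (cumul g j) (f i) (g j) => a b p q q0 p0.
rewrite !minEle; do ![case: ifPn; rewrite -?ltNge => ?]; lra.
Qed.

Lemma overlap_support f g i j : (forall z, 0 <= f z) -> (forall z, 0 <= g z) ->
  overlap f g i j != 0 -> cumul g j < cumul f i.+1 /\ cumul f i < cumul g j.+1.
Proof.
move=> f0 g0; rewrite /overlap !cumulS; have := f0 i; have := g0 j.
move: (cumul f i) (cumul g j) (f i) (g j) => a b p q q0 p0.
rewrite !minEle => h; split; rewrite ltNge; apply: contra h => h; apply/eqP; do ![case: ifPn; rewrite -?ltNge => ?]; lra.
Qed.

(** The sum over j telescopes, and the total masses 1 remove the minima. *)
Lemma sum_overlap f g M M' i : law M f -> law M' g ->
  \sum_(j < M') overlap f g i j = f i.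
Proof.
move=> lf lg; have [f0 _ _] := lf; have [_ _ g1] := lg.
have T M0 : \sum_(j < M0) overlap f g i j =
    Num.min (cumul f i.+1) (cumul g M0) - Num.min (cumul f i) (cumul g M0).
  elim: M0 => [|M0 IH].
    have c0 z : 0 <= cumul f z by apply: sumr_ge0.
    by rewrite big_ord0 {2 4}/cumul !big_ord0 !min_r ?subrr.
  by rewrite big_ord_recr /= IH /overlap; ring.
rewrite T {2 4}/cumul g1 !min_l; try exact: law_sum_le1 lf.
by rewrite cumulS addrC addKr.
Qed.

(** Only intersecting cells carry mass, so a bound depending on i need only be checked there (third
    clause). The fourth clause, for bounds that split between i and j, uses nothing but the
    marginals. *)
Lemma monotone_coupling M M' f g (u v : nat -> R) : law M f -> law M' g ->
  exists (Q : probability nat R) (U V : {RV Q >-> R}),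
  [/\ forall A, distribution Q U A = (\sum_(i < M) f i * \1_A (u i))%:E,
      forall A, distribution Q V A = (\sum_(j < M') g j * \1_A (v j))%:E,
      (forall (psi : R -> R -> R) (D : nat -> R), (forall x y, 0 <= psi x y) ->
        (forall i j, (i < M)%N -> (j < M')%N -> cumul g j < cumul f i.+1 ->
           cumul f i < cumul g j.+1 -> psi (u i) (v j) <= D i) ->
        ('E_Q[fun t => psi (U t) (V t)] <= (\sum_(i < M) f i * D i)%:E)%E) &
      (forall (psi : R -> R -> R) (D D' : nat -> R), (forall x y, 0 <= psi x y) ->
        (forall i j, psi (u i) (v j) <= D i + D' j) ->
        ('E_Q[fun t => psi (U t) (V t)] <=
          (\sum_(i < M) f i * D i + \sum_(j < M') g j * D' j)%:E)%E)].
Proof.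
move=> lf lg; have [f0 _ f1] := lf; have [g0 _ g1] := lg.
have row i : \sum_(j < M') overlap f g i j = f i by exact: sum_overlap lf lg.
have col j : \sum_(i < M) overlap f g i j = g j.
  by under eq_bigr do rewrite overlapC; exact: sum_overlap lg lf.
have p0 i j : 0 <= overlap f g i j by exact: overlap_ge0.
have p1 : \sum_(i < M) \sum_(j < M') overlap f g i j = 1.
  by rewrite -[RHS]f1; apply: eq_bigr => i _; exact: row.
have [Q [U [V [hU hV hE]]]] := finite_coupling u v p0 p1.
exists Q, U, V; split.
- by move=> A; rewrite hU; congr EFin; apply: eq_bigr => i _; rewrite row.
- by move=> A; rewrite hV; congr EFin; apply: eq_bigr => i _; rewrite col.
- move=> psi D psi0 hD; rewrite hE // lee_fin; apply: ler_sum => i _.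
  rewrite -row mulr_suml; apply: ler_sum => j _.
  have [->|nz] := eqVneq (overlap f g i j) 0; first by rewrite !mul0r.
  have [h1 h2] := overlap_support f0 g0 nz.
  by rewrite ler_wpM2l // hD.
- move=> psi D D' psi0 hD; rewrite hE // lee_fin.
  apply: (@le_trans _ _ (\sum_(i < M) \sum_(j < M') overlap f g i j * (D i + D' j))).
    by apply: ler_sum => i _; apply: ler_sum => j _; rewrite ler_wpM2l.
  under eq_bigr => i _ do [under eq_bigr => j _ do rewrite mulrDr; rewrite big_split /= -mulr_suml row].
  rewrite big_split /= lerD2l exchange_big /=; apply: ler_sum => j _.
  by rewrite -mulr_suml col.
Qed.

End MonotoneCoupling.

(** * The law of the bridge *)

Fixpoint words (n : nat) : seq (seq bool) :=
  if n is n'.+1 then map (cons true) (words n') ++ map (cons false) (words n')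
  else [:: [::]].

Lemma size_words n w : w \in words n -> size w = n.
Proof.
elim: n w => [|n IH] w /=; first by rewrite inE => /eqP ->.
by rewrite mem_cat => /orP[] /mapP[v /IH <- ->].
Qed.

Section Words.
Variable R : realType.

Lemma big_words_split k m (F : seq bool -> seq bool -> R) :
  \sum_(w <- words (k + m)) F (take k w) (drop k w) =
  \sum_(u <- words k) \sum_(v <- words m) F u v.
Proof.
elim: k F => [|k IH] F.
  by rewrite big_seq1 add0n; apply: eq_bigr => w _; rewrite take0 drop0.
rewrite addSn /= !big_cat !big_map /=.
by rewrite (IH (fun u v => F (true :: u) v)) (IH (fun u v => F (false :: u) v)).
Qed.

Lemma big_words_count n (F : nat -> R) :
  \sum_(w <- words n) F (count id w) = \sum_(a < n.+1) F a *+ 'C(n, a).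
Proof.
elim: n F => [|n IH] F.
  by rewrite big_seq1 big_ord1 bin0 mulr1n.
rewrite /= big_cat !big_map /= (IH F).
under eq_bigr do rewrite add1n; rewrite (IH (fun a => F a.+1)).
rewrite [RHS]big_ord_recl /= bin0.
under [X in _ = _ + X]eq_bigr => i _ do rewrite /bump /= add1n binS mulrnDr.
rewrite big_split /= addrA addrC; congr (_ + _).
rewrite big_ord_recl /= bin0; congr (_ + _).
rewrite [RHS]big_ord_recr /= bin_small // mulr0n addr0.
by apply: eq_bigr => i _; rewrite /bump /= add1n.
Qed.

End Words.

Section BridgeLaw.
Context (d : measure_display) (T : measurableType d) (R : realType).
Variables (P : probability T R) (X : nat -> {RV P >-> R}).
Hypothesis iid : iid_fair_signs X.
Local Open Scope classical_set_scope.

Definition sgnb (b : bool) : R := if b then 1 else -1.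

Definition cylinder (j : nat) (w : seq bool) : set T :=
  [set x | forall i, (i < size w)%N -> X (j + i)%N x = sgnb (nth false w i)].

Lemma measurable_fiber j b : measurable (X j @^-1` [set sgnb b]).
Proof. by apply: measurable_funPTI; exact: measurable_set1. Qed.

Lemma cylinder_cons j b w :
  cylinder j (b :: w) = X j @^-1` [set sgnb b] `&` cylinder j.+1 w.
Proof.
apply/seteqP; split => x /=.
  move=> h; split; first by have := h 0%N isT; rewrite addn0.
  by move=> i iw; have := h i.+1 iw; rewrite addnS.
move=> [h0 h] [|i] iw; first by rewrite addn0.
by rewrite addnS; exact: h.
Qed.

Lemma prob_fiber j b : P (X j @^-1` [set sgnb b]) = (2^-1)%:E.
Proof. by have [_ /(_ j)[h1 h2]] := iid; case: b. Qed.

(** [X j] is a sign only almost surely: the two values carry probability 1/2 each, so the set of all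
    other values is null and can be discarded. *)
Lemma prob_split j B : measurable B ->
  P B = (P (B `&` X j @^-1` [set sgnb true]) + P (B `&` X j @^-1` [set sgnb false]))%E.
Proof.
move=> mB; set E1 := X j @^-1` _; set E2 := X j @^-1` _.
have m1 : measurable E1 by exact: measurable_fiber.
have m2 : measurable E2 by exact: measurable_fiber.
have dis : E1 `&` E2 = set0.
  apply/seteqP; split => // x [/= h1 h2].
  have e : (1 : R) = -1 by rewrite -[LHS]h1 -[RHS]h2.
  have : (0 : R) < 0 by lra.
  by rewrite ltxx.
have mU : measurable (E1 `|` E2) by exact: measurableU.
have PU : P (E1 `|` E2) = 1%E.
  rewrite measureU // [X in (X + _)%E](prob_fiber j true) [X in (_ + X)%E](prob_fiber j false).
  by rewrite -EFinD; congr EFin; lra.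
have PC : P (~` (E1 `|` E2)) = 0%E by rewrite probability_setC // PU subee.
apply: (eq_trans (measureDI P mB mU)).
rewrite [X in (X + _)%E](_ : _ = 0%E); last first.
  apply/eqP; rewrite eq_le measure_ge0 andbT -PC; apply: le_measure.
  - by rewrite inE; exact: measurableD.
  - by rewrite inE; exact: measurableC.
  - by move=> x [].
rewrite add0e setIUr measureU //; [exact: measurableI|exact: measurableI|].
by rewrite setIACA setIid dis setI0.
Qed.

Lemma prob_words n j B : measurable B ->
  P B = (\sum_(w <- words n) P (B `&` cylinder j w))%E.
Proof.
elim: n j B => [|n IH] j B mB.
  rewrite big_seq1; congr (P _); apply/seteqP; split => x //=.
  by case.
rewrite /= big_cat !big_map /= (prob_split j mB).
congr (_ + _)%E; rewrite (IH j.+1); try by apply: measurableI => //; exact: measurable_fiber.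
  by apply: eq_bigr => w _; rewrite cylinder_cons setIA.
by apply: eq_bigr => w _; rewrite cylinder_cons setIA.
Qed.

Lemma prob_cylinder w : P (cylinder 0 w) = (2^-1 ^+ size w)%:E.
Proof.
have [ind _] := iid.
have := ind (iota 0 (size w)) (fun i => [set sgnb (nth false w i)]) (iota_uniq _ _).
move=> /(_ (fun i => @measurable_set1 _ _)) h.
have -> : cylinder 0 w = \bigcap_(i in [set` iota 0 (size w)])
    X i @^-1` [set sgnb (nth false w i)].
  apply/seteqP; split => x /= hx i.
    by rewrite /= mem_iota add0n => iw; exact: hx.
  by move=> iw; apply: hx; rewrite /= mem_iota.
rewrite h (eq_bigr (fun=> (2^-1)%:E)) => [|i _]; last exact: prob_fiber.
by rewrite prodEFin big_const_seq count_predT size_iota iter_mulr mulr1.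
Qed.

Lemma walk_cylinder k w x : cylinder 0 w x -> (k <= size w)%N ->
  walk X k x = 2 * (count id (take k w))%:R - k%:R.
Proof.
move=> hx; elim: k => [|k IH] kw.
  by rewrite /walk big_ord0 take0 mulr0 subrr.
rewrite /walk big_ord_recr /= -/(walk X k x) IH; last exact: ltnW.
rewrite -(add0n k) hx // (take_nth false) // -cats1 count_cat /= addn0 natrD add0n -natr1.
by rewrite /sgnb; case: (nth _ _ _) => /=; ring.
Qed.

Lemma measurable_walk k : measurable_fun setT (walk X k).
Proof.
by apply: measurable_sum => i; exact: measurable_funPT.
Qed.

Lemma prob_walk_words k n (s : int) A : measurable A -> (k <= n)%N ->
  P (walk X k @^-1` A `&` [set x | walk X n x = s%:~R]) =
  (2^-1 ^+ n * \sum_(w <- words n) \1_A (2 * (count id (take k w))%:R - k%:R) *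
     ((2 * (count id w)%:R - n%:R == s%:~R :> R)%:R))%:E.
Proof.
move=> mA kn.
have mB : measurable (walk X k @^-1` A `&` [set x | walk X n x = s%:~R]).
  apply: measurableI.
    by rewrite -[X in measurable X]setTI; exact: measurable_walk.
  rewrite [X in measurable X](_ : _ = walk X n @^-1` [set s%:~R]) //.
  by rewrite -[X in measurable X]setTI; apply: measurable_walk.
rewrite (prob_words n 0 mB) mulr_sumr -sumEFin big_seq [RHS]big_seq.
apply: eq_bigr => w /size_words sw.
rewrite indicE.
have wk x : cylinder 0 w x -> walk X k x = 2 * (count id (take k w))%:R - k%:R.
  by move=> hx; rewrite (walk_cylinder hx) // sw.
have wn x : cylinder 0 w x -> walk X n x = 2 * (count id w)%:R - n%:R.
  by move=> hx; rewrite (walk_cylinder hx) ?sw // -sw take_size.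
have [hA|hA] := boolP (_ \in A); last first.
  rewrite mul0r mulr0; apply: (eq_trans _ (measure0 P)); congr (P _).
  apply/seteqP; split => // x [[/= h _] hx].
  by move/negP: hA; apply; rewrite inE -(wk _ hx).
have [hs|hs] := eqVneq (2 * (count id w)%:R - n%:R) (s%:~R : R); last first.
  rewrite !mulr0; apply: (eq_trans _ (measure0 P)); congr (P _).
  apply/seteqP; split => // x [[/= _ h] hx].
  by move/eqP: hs; apply; rewrite -(wn _ hx).
rewrite !mulr1 -[in RHS]sw -prob_cylinder; congr (P _); apply/seteqP; split => x /=.
  by case.
move=> hx; split => //; split; last by rewrite /= wn.
by rewrite /= wk // -in_setE.
Qed.

(** If no N fits, no sign word ends at s and the sum over words giving the probability is empty of
    positive terms. *)
Lemma probable_parity n (s : int) : probable X n s ->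
  exists2 N : nat, (N <= n)%N & s%:~R = 2 * N%:R - n%:R :> R.
Proof.
rewrite /probable => h; apply: contrapT => hN; move: h.
have -> : [set x | walk X n x = s%:~R] =
    walk X n @^-1` setT `&` [set x | walk X n x = s%:~R] by rewrite preimage_setT setTI.
rewrite prob_walk_words // big_seq big1 ?mulr0 ?ltxx // => w hw.
have [hs|] := eqVneq (2 * (count id w)%:R - n%:R) (s%:~R : R); last by rewrite mulr0.
by exfalso; apply: hN; exists (count id w) => //; rewrite -(size_words hw) count_size.
Qed.

(** Words are cut after k letters and grouped by their numbers of +1 in each part; the end point
    forces N - a of them into the last m letters. *)
Lemma prob_walk k m N (s : int) A : measurable A ->
  s%:~R = 2 * N%:R - (k + m)%:R :> R ->
  P (walk X k @^-1` A `&` [set x | walk X (k + m) x = s%:~R]) =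
  (2^-1 ^+ (k + m) * \sum_(a < k.+1) (hypw k m N a)%:R * \1_A (2 * a%:R - k%:R))%:E.
Proof.
move=> mA sE; rewrite prob_walk_words ?leq_addr //; congr (_ * _)%:E.
pose F (u v : seq bool) : R := \1_A (2 * (count id u)%:R - k%:R) *
   (2 * (count id u + count id v)%N%:R - (k + m)%:R == s%:~R :> R)%:R.
have -> : \sum_(w <- words (k + m)) \1_A (2 * (count id (take k w))%:R - k%:R) *
    (2 * (count id w)%:R - (k + m)%:R == s%:~R :> R)%:R =
    \sum_(w <- words (k + m)) F (take k w) (drop k w).
  by apply: eq_bigr => w _; rewrite /F -count_cat cat_take_drop.
rewrite big_words_split.
pose G (a b : nat) : R := \1_A (2 * a%:R - k%:R) *
   (2 * (a + b)%N%:R - (k + m)%:R == s%:~R :> R)%:R.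
rewrite (eq_bigr (fun u => \sum_(b < m.+1) G (count id u) b *+ 'C(m, b))); last first.
  by move=> u _; rewrite -(big_words_count m (G (count id u))).
rewrite (big_words_count k (fun a => \sum_(b < m.+1) G a b *+ 'C(m, b))).
apply: eq_bigr => a _; rewrite /G sE.
have eqN b : (2 * (a + b)%N%:R - (k + m)%:R == 2 * N%:R - (k + m)%:R :> R) = (a + b == N)%N.
  by rewrite (inj_eq (addIr _)) (inj_eq (mulfI _)) ?pnatr_eq0 // eqr_nat.
under eq_bigr => b _ do rewrite eqN -mulrnAr.
rewrite -mulr_sumr -mulrnAr mulrC; congr (_ * _).
rewrite /hypw; case: ifP => aN; last first.
  rewrite big1 ?mul0rn // => b _; case: eqP => [e|_]; last by rewrite mul0rn.
  by move: aN; rewrite -e leq_addr.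
have [Nm|mN] := leqP (N - a) m.
  rewrite (bigD1 (Ordinal (Nm : (N - a < m.+1)%N))) //= subnKC // eqxx.
  rewrite big1 ?addr0 => [|b /eqP hb]; first by rewrite -mulrnA mulnC.
  case: eqP => [e|_]; last by rewrite mul0rn.
  by exfalso; apply: hb; apply: val_inj => /=; lia.
rewrite (bin_small mN) muln0 big1 ?mul0rn // => b _.
case: eqP => [e|_]; last by rewrite mul0rn.
by exfalso; have := ltn_ord b; lia.
Qed.

Lemma bridge_lawE k m N (s : int) A : measurable A -> (N <= k + m)%N ->
  s%:~R = 2 * N%:R - (k + m)%:R :> R ->
  bridge_law X k (k + m) s A =
  (\sum_(a < k.+1) hyp R k m N a * \1_A (2 * a%:R - k%:R))%:E.
Proof.
move=> mA Nn sE; rewrite /bridge_law (prob_walk mA sE).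
have -> : P [set x | walk X (k + m) x = s%:~R] = (2^-1 ^+ (k + m) * ('C(k + m, N))%:R)%:E.
  have -> : [set x | walk X (k + m) x = s%:~R] =
    walk X k @^-1` setT `&` [set x | walk X (k + m) x = s%:~R] by rewrite preimage_setT setTI.
  rewrite (prob_walk _ sE) // -sum_hypw; congr (_ * _)%:E; apply: eq_bigr => a _.
  by rewrite indicT mulr1.
have C0 := binR_gt0 R Nn.
have q0 : 0 < 2^-1 ^+ (k + m) :> R by rewrite exprn_gt0.
have z0 : 2^-1 ^+ (k + m) * ('C(k + m, N))%:R != 0 :> R by rewrite mulf_neq0 // lt0r_neq0.
rewrite inver (negbTE z0) -EFinM; congr EFin.
rewrite invfM mulrACA divff ?lt0r_neq0 // mul1r mulr_suml.
by apply: eq_bigr => a _; rewrite /hyp mulrAC.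
Qed.

End BridgeLaw.

(** * Displacement and its exponential moments *)

Section Displacement.
Variable R : realType.
Implicit Types (f g : nat -> R) (k m N i j : nat).

Lemma cumul_le g i j : (forall z, 0 <= g z) -> (i <= j)%N -> cumul g i <= cumul g j.
Proof.
move=> g0 ij; rewrite -(subnKC ij) /cumul big_split_ord /= lerDl.
by apply: sumr_ge0.
Qed.

Lemma cumul_rev K g g' j : law K.+1 g -> (forall z, (z <= K)%N -> g' z = g (K - z)%N) ->
  (j <= K.+1)%N -> cumul g' j = 1 - cumul g (K.+1 - j).
Proof.
move=> [_ _ g1] gg; elim: j => [|j IH] jK.
  by rewrite subn0 /cumul big_ord0 g1 subrr.
rewrite cumulS IH ?(ltnW jK) // gg // subSS subSn // cumulS; ring.
Qed.

Lemma law_rev K g g' : law K.+1 g -> (forall z, (z <= K)%N -> g' z = g (K - z)%N) ->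
  (forall z, (K < z)%N -> g' z = 0) -> law K.+1 g'.
Proof.
move=> lg gg g'0; have [g0 _ _] := lg; split=> //.
  by move=> z; have [zK|/g'0 -> //] := leqP z K; rewrite gg.
by rewrite -/(cumul g' K.+1) (cumul_rev lg gg) // subnn /cumul big_ord0 subr0.
Qed.

(* The upper bound for the reversed laws is the lower bound for the laws
   themselves. *)
Lemma two_sided_transfer K K' f g f' g' (c cf cg : R) (D : nat -> R) :
  law K.+1 f -> law K'.+1 g ->
  (forall z, (z <= K)%N -> f' z = f (K - z)%N) ->
  (forall z, (z <= K')%N -> g' z = g (K' - z)%N) ->
  (forall z, (K' < z)%N -> g' z = 0) ->
  (forall i, (i <= K)%N -> exists j, cumul f i.+1 <= cumul g j /\
     j%:R - cg <= c * (i%:R - cf) + D i) ->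
  (forall i, (i <= K)%N -> exists j, cumul f' i.+1 <= cumul g' j /\
     j%:R - (K'%:R - cg) <= c * (i%:R - (K%:R - cf)) + D (K - i)%N) ->
  forall i j, (i <= K)%N -> cumul g j < cumul f i.+1 -> cumul f i < cumul g j.+1 ->
  `|c * (i%:R - cf) - (j%:R - cg)| <= D i.
Proof.
move=> lf lg ff gg g'z up lo i j iK h1 h2.
have [f0 _ _] := lf; have [g0 _ _] := lg.
have lg' := law_rev lg gg g'z.
have [j1 [u1 v1]] := up i iK.
have jj1 : (j < j1)%N.
  rewrite ltnNge; apply/negP => le; have := cumul_le g0 le.
  by move=> h; have := lt_le_trans h1 (le_trans u1 h); rewrite ltxx.
have [j2 [u2 v2]] := lo (K - i)%N (leq_subr _ _).
rewrite subKn // in v2.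
(* Read back from the reversed laws, [u2] says that g has mass at most [cumul f i] below K' + 1 -
   j2. As [cumul g j.+1] is larger, j + 1 lies beyond that point. *)
have jj2 : (K'.+1 <= j + j2)%N.
  rewrite leqNgt; apply/negP => lt.
  have j2K : (j2 <= K'.+1)%N by lia.
  rewrite (cumul_rev lf ff) ?ltnS ?leq_subr // (cumul_rev lg gg) // in u2.
  have e : (K.+1 - (K - i).+1 = i)%N by lia.
  rewrite e in u2.
  have le : (j.+1 <= K'.+1 - j2)%N by lia.
  have := cumul_le g0 le; lra.
have {}jj1 : j%:R + 1 <= j1%:R :> R by rewrite natr1 ler_nat.
have {}jj2 : K'%:R + 1 <= j%:R + j2%:R :> R by rewrite natr1 -natrD ler_nat.
have eK : (K - i)%:R = K%:R - i%:R :> R by rewrite natrB.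
rewrite eK in v2.
rewrite ler_norml; apply/andP; split; lra.
Qed.

Lemma slowly_varying_le (C C' n c : R) g : 0 < n -> C <= C' -> (forall z, 0 <= g z) ->
  slowly_varying C n c g -> slowly_varying C' n c g.
Proof.
move=> n0 CC g0 sv Z j hZ hj; have [h1 h2] := sv Z j hZ hj.
have e : expR (C * Z / n) <= expR (C' * Z / n).
  rewrite ler_expR ler_wpM2r ?invr_ge0 ?(ltW n0) // ler_wpM2r //.
  by case/andP: hZ; lra.
by split; [apply: (le_trans h1) | apply: (le_trans h2)]; rewrite ler_wpM2r.
Qed.

Lemma half_hyp_gt0 k m N0 : (k + m = 2 * N0)%N -> (0 < m)%N ->
  (k + m)%:R <= 3 * k%:R :> R -> (k + m)%:R <= 3 * m%:R :> R ->
  forall z : nat, `|z%:R - k%:R / 2| <= (k + m)%:R / 20 :> R -> 0 < hyp R k m N0 z.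
Proof.
move=> nN m0 hk hm z /ler_norm_opp[z1 z2].
have n0 : 0 < (k + m)%:R :> R by rewrite ltr0n addn_gt0 m0 orbT.
have N0E : N0%:R = (k + m)%:R / 2 :> R by rewrite nN natrM; field.
have nE : (k + m)%:R = k%:R + m%:R :> R by rewrite natrD.
by apply: hyp_gt0; rewrite -(ler_nat R) ?natrD ?N0E; lra.
Qed.

Lemma half_mean_dist k m i : (i <= k)%N -> `|i%:R - k%:R / 2| <= (k + m)%:R :> R.
Proof.
move=> ik; have h1 : i%:R <= k%:R :> R by rewrite ler_nat.
have h2 := ler0n R i; have h3 := ler0n R m.
by rewrite natrD ler_norml; apply/andP; split; lra.
Qed.

Lemma bias_displacement : exists e1 C : R, [/\ 0 < e1, 0 < C &
  forall k m N N0, (k + m = 2 * N0)%N -> (0 < k)%N -> (0 < m)%N -> (N <= k + m)%N ->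
  (k + m)%:R <= 3 * k%:R :> R -> (k + m)%:R <= 3 * m%:R :> R ->
  forall sg : R, sg = `|2 * N%:R - (k + m)%:R| / (k + m)%:R -> sg <= e1 ->
  forall i j, (i <= k)%N ->
  cumul (hyp R k m N) j < cumul (hyp R k m N0) i.+1 ->
  cumul (hyp R k m N0) i < cumul (hyp R k m N) j.+1 ->
  `|(i%:R - k%:R / 2) - (j%:R - hyp_mean R k m N)| <=
  C * (1 + sg * Num.sqrt (k + m)%:R + sg * `|i%:R - k%:R / 2| +
       (i%:R - k%:R / 2) ^+ 2 / (k + m)%:R)].
Proof.
have C11 : 1 <= 600 :> R by rewrite ler1n.
have C21 : 1 <= 2 * 10 ^+ 3 :> R by rewrite mulr_ege1 ?exprn_ege1 ?ler1n.
have [e1 [C [e10 C0 H]]] := monotone_transfer C11 C21.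
(* The bound 1/10 is the range of bias in which slow variation and drift domination were
   established. *)
exists (Num.min e1 (1 / 10)), C; split => //; first by rewrite lt_min e10 /=; lra.
move=> k m N N0 nN k0 m0 Nn hk hm sg sgE; rewrite le_min => /andP[sg1 sg2].
have n0 : 0 < (k + m)%:R :> R by rewrite ltr0n addn_gt0 m0 orbT.
have n1 : 1 <= (k + m)%:R :> R by rewrite ler1n addn_gt0 m0 orbT.
have NN : (N0 <= k + m)%N by rewrite nN mul2n -addnn leq_addr.
have NN2 : (k + m - N0 = N0)%N by rewrite nN mul2n -addnn addnK.
have cf : hyp_mean R k m N0 = k%:R / 2 by apply: hyp_mean_half; rewrite ?addn_gt0 ?k0.
have kn : k%:R <= (k + m)%:R :> R by rewrite ler_nat leq_addr.
have nE : (k + m)%:R = k%:R + m%:R :> R by rewrite natrD.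
pose D i : R := C * (1 + sg * Num.sqrt (k + m)%:R + sg * `|i%:R - k%:R / 2| +
       (i%:R - k%:R / 2) ^+ 2 / (k + m)%:R).
have up N' : (N' <= k + m)%N -> sg = `|2 * N'%:R - (k + m)%:R| / (k + m)%:R ->
  forall i, (i <= k)%N -> exists j, cumul (hyp R k m N0) i.+1 <= cumul (hyp R k m N') j /\
     j%:R - hyp_mean R k m N' <= 1 * (i%:R - k%:R / 2) + D i.
  move=> N'n sgE' i ik.
  have hN : `|2 * N'%:R - (k + m)%:R| <= (k + m)%:R / 10 :> R.
    by move: sg2; rewrite sgE' ler_pdivrMr //; lra.
  have sgr : 0 <= sg <= e1 by rewrite sg1 andbT sgE' divr_ge0 // ltW.
  have dd := hyp_drift_dominated nN hk hm k0 m0 hN.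
  rewrite -sgE' cf in dd.
  have tf := @hyp_tail_bound R k m N0 m0 NN; rewrite cf in tf.
  have c1 : (k + m)%:R / 20 <= k%:R / 2 :> R by lra.
  have c2 : (k + m)%:R / 20 <= hyp_mean R k m N'.
    rewrite /hyp_mean ler_pdivlMr //; have [h1 h2] := ler_norm_opp hN.
    have : 0 <= (3 * k%:R - (k + m)%:R) * N'%:R :> R by rewrite mulr_ge0 // subr_ge0.
    have : 0 <= (k + m)%:R * (2 * N'%:R - (k + m)%:R + (k + m)%:R / 10) :> R.
      by rewrite mulr_ge0 ?(ltW n0) //; lra.
    have : 0 <= (k + m)%:R * (k + m)%:R :> R by rewrite mulr_ge0 // ltW.
    by move: ((k + m)%:R : R) => n; lra.
  have M2 : k.+1%:R <= hyp_mean R k m N' + 2 * (k + m)%:R :> R.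
    have : 0 <= hyp_mean R k m N' by rewrite /hyp_mean divr_ge0 ?mulr_ge0 // ltW.
    by rewrite -natr1; lra.
  have sv := slowly_varying_le n0 (_ : 300 <= 600) (hyp_ge0 R k m N') (hyp_slowly_varying hk hm hN).
  have [|j [h1 h2]] := H _ _ _ _ _ _ _ _ n1 sgr (hyp_law R NN) (hyp_law R N'n) c1 c2 M2
     (half_hyp_gt0 nN m0 hk hm) tf (@hyp_tail_bound R k m N' m0 N'n) (sv _) dd i (half_mean_dist m ik).
    by rewrite ler_nat.
  by exists j; split => //; rewrite mul1r.
move=> i j ik h1 h2; rewrite -[X in `|X - _|]mul1r.
apply: (two_sided_transfer (hyp_law R NN) (hyp_law R Nn) (f' := hyp R k m N0)
  (g' := hyp R k m (k + m - N)) _ _ _ (up N Nn sgE) _ ik h1 h2).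
- move=> z zk; rewrite -(hyp_rev R NN (leq_subr _ _)) subKn //.
  by rewrite NN2.
- by move=> z zk; rewrite -(hyp_rev R Nn (leq_subr _ _)) subKn.
- by move=> z kz; rewrite hyp_eq0.
(* Reflection replaces N by n - N, which leaves [sg] unchanged, so [up] applies to the reflected law
   as well. *)
- move=> i0 i0k.
  have rE : (k + m - N)%:R = (k + m)%:R - N%:R :> R by rewrite natrB.
  have sgE' : sg = `|2 * (k + m - N)%:R - (k + m)%:R| / (k + m)%:R.
    by rewrite sgE rE -normrN; congr (`|_| / _); ring.
  have [j0 [u1 u2]] := up _ (leq_subr _ _) sgE' i0 i0k.
  exists j0; split => //.
  have mE : hyp_mean R k m (k + m - N) = k%:R - hyp_mean R k m N.
    by rewrite /hyp_mean rE; move: ((k + m)%:R) (lt0r_neq0 n0) => n nz; field.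
  have kE : k%:R - k%:R / 2 = k%:R / 2 :> R by lra.
  have dE : (k - i0)%:R - k%:R / 2 = - (i0%:R - k%:R / 2) :> R by rewrite natrB //; lra.
  rewrite -mE kE; apply: (le_trans u2); rewrite lerD2l /D dE normrN sqrrN.
  exact: lexx.
Qed.

Lemma cumul_pairs k m N j : cumul (pair_hyp R k m N) j = cumul (hyp R k m N) (2 * j).
Proof. by rewrite /cumul /pair_hyp (big_pairs (hyp R k m N)). Qed.

Lemma scale_displacement : exists C : R, 0 < C /\
  forall k m N0, (k + m = 2 * N0)%N -> (0 < k)%N -> (0 < m)%N ->
  (k + m)%:R <= 3 * k%:R :> R -> (k + m)%:R <= 3 * m%:R :> R ->
  forall i j, (i <= k)%N ->
  cumul (hyp R (4 * k) (4 * m) (4 * N0)) j < cumul (hyp R k m N0) i.+1 ->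
  cumul (hyp R k m N0) i < cumul (hyp R (4 * k) (4 * m) (4 * N0)) j.+1 ->
  `|2 * (i%:R - k%:R / 2) - (j%:R - 2 * k%:R)| <=
  C * (1 + (i%:R - k%:R / 2) ^+ 2 / (k + m)%:R).
Proof.
have C11 : 1 <= 600 :> R by rewrite ler1n.
have C21 : 1 <= 2 * 10 ^+ 3 :> R by rewrite mulr_ege1 ?exprn_ege1 ?ler1n.
have [e1 [C [e10 C0 H]]] := monotone_transfer C11 C21.
(* The transfer bounds the index of a pair, and the count is twice that index. *)
exists (2 * C); split; first by rewrite mulr_gt0.
move=> k m N0 nN k0 m0 hk hm.
have n0 : 0 < (k + m)%:R :> R by rewrite ltr0n addn_gt0 m0 orbT.
have n1 : 1 <= (k + m)%:R :> R by rewrite ler1n addn_gt0 m0 orbT.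
have NN : (N0 <= k + m)%N by rewrite nN mul2n -addnn leq_addr.
have NN2 : (k + m - N0 = N0)%N by rewrite nN mul2n -addnn addnK.
have N4 : (4 * N0 <= 4 * k + 4 * m)%N by rewrite -mulnDr leq_mul.
have N42 : (4 * k + 4 * m - 4 * N0 = 4 * N0)%N by rewrite -mulnDr -mulnBr NN2.
have cf : hyp_mean R k m N0 = k%:R / 2 by apply: hyp_mean_half; rewrite ?addn_gt0 ?k0.
have nE : (k + m)%:R = k%:R + m%:R :> R by rewrite natrD.
have m00 := ler0n R m.
pose D i : R := 2 * C * (1 + (i%:R - k%:R / 2) ^+ 2 / (k + m)%:R).
have up i : (i <= k)%N -> exists j,
     cumul (hyp R k m N0) i.+1 <= cumul (hyp R (4 * k) (4 * m) (4 * N0)) j /\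
     j%:R - 2 * k%:R <= 2 * (i%:R - k%:R / 2) + D i.
  move=> ik.
  have sgr : 0 <= (0 : R) <= e1 by rewrite lexx ltW.
  have dd := pair_drift_dominated nN hk hm k0 m0; rewrite cf in dd.
  have tf := @hyp_tail_bound R k m N0 m0 NN; rewrite cf in tf.
  have c1 : (k + m)%:R / 20 <= k%:R / 2 :> R by lra.
  have c2 : (k + m)%:R / 20 <= k%:R :> R by lra.
  have M2 : (2 * k).+1%:R <= k%:R + 2 * (k + m)%:R :> R.
    by rewrite -natr1 natrM; lra.
  have [j [h1 h2]] := H _ _ _ _ _ _ _ _ n1 sgr (hyp_law R NN) (pair_law R N4) c1 c2 M2
     (half_hyp_gt0 nN m0 hk hm) tf (@pair_tail_bound R k m N0 m0 nN) (pair_slowly_varying nN m0 hk hm) dd i (half_mean_dist m ik).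
  exists (2 * j)%N; rewrite -cumul_pairs; split=> //.
  by move: h2; rewrite /D !mul0r !addr0 natrM; lra.
apply: (two_sided_transfer (hyp_law R NN) (hyp_law R N4) (f' := hyp R k m N0)
  (g' := hyp R (4 * k) (4 * m) (4 * N0)) (c := 2) (D := D) _ _ _ up _).
- move=> z zk; rewrite -(hyp_rev R NN (leq_subr _ _)) subKn //.
  by rewrite NN2.
- move=> z zk; rewrite -(hyp_rev R N4 (leq_subr _ _)) subKn //.
  by rewrite N42.
- by move=> z kz; rewrite hyp_eq0.
- move=> i0 i0k; have [j0 [u1 u2]] := up i0 i0k.
  exists j0; split => //.
  have kE : k%:R - k%:R / 2 = k%:R / 2 :> R by lra.
  have k4 : (4 * k)%:R - 2 * k%:R = 2 * k%:R :> R by rewrite natrM; ring.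
  have dE : (k - i0)%:R - k%:R / 2 = - (i0%:R - k%:R / 2) :> R by rewrite natrB //; lra.
  by rewrite kE k4; apply: (le_trans u2); rewrite lerD2l /D dE sqrrN.
Qed.

End Displacement.

(** * Exponential moments of the displacement bounds *)

Section ExponentialMoments.
Variable R : realType.
Implicit Types (k m N i j : nat) (C B lam z th x : R).

(** Convexity of the exponential, from its tangent line. It turns a moment bounded at rate 1/64 into
    one near 1 at small rates. *)
Lemma expR_convex lam z : 0 <= lam <= 1 -> expR (lam * z) <= 1 + lam * (expR z - 1).
Proof.
move=> /andP[l0 l1]; have e0 := expR_gt0 (lam * z).
have h1 : expR (lam * z) * (1 + (1 - lam) * z) <= expR z.
  have -> : expR z = expR (lam * z) * expR ((1 - lam) * z) by rewrite -expRD; congr expR; ring.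
  by rewrite ler_wpM2l ?expR_ge1Dx // ltW.
have h2 : expR (lam * z) * (1 - lam * z) <= 1.
  have e : expR (lam * z) * expR (- (lam * z)) = 1 by rewrite -expRD subrr expR0.
  by rewrite -[leRHS]e ler_wpM2l ?expR_ge1Dx // ltW.
have h3 := ler_wpM2l l0 h1.
have l2 : 0 <= 1 - lam by lra.
have h4 := ler_wpM2l l2 h2.
lra.
Qed.

Lemma expR_mean x z : expR (x + z) <= expR (2 * x) / 2 + expR (2 * z) / 2.
Proof.
have := sqr_ge0 (expR x - expR z).
have e (y : R) : expR (2 * y) = expR y * expR y by rewrite -expRD; congr expR; ring.
rewrite expRD !e expr2; lra.
Qed.

(** [expR_convex] with lam = 64 theta C interpolates between 1 and the moment bounded in
    [hyp_sqmgf]; B depends on neither C nor theta. *)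
Lemma hyp_quadratic_moment : exists B : R, 1 <= B /\ forall k m N0,
  (k + m = 2 * N0)%N -> (0 < m)%N -> forall C th, 0 <= th -> 0 <= C -> 64 * (th * C) <= 1 ->
  \sum_(i < k.+1) hyp R k m N0 i *
    expR (th * (C * (1 + (i%:R - k%:R / 2) ^+ 2 / (k + m)%:R))) <= 1 + 64 * (th * C) * B.
Proof.
have [B0 HB] := hyp_sqmgf R.
pose B : R := Num.max 1 (expR (64^-1) * B0).
exists B; split; first by rewrite le_max lexx.
move=> k m N0 nN m0 C th th0 C0 hC.
have NN : (N0 <= k + m)%N by rewrite nN mul2n -addnn leq_addr.
have := HB k m N0 m0 NN; rewrite hyp_mean_half ?addn_gt0 ?m0 ?orbT //.
set lam := 64 * (th * C) in hC * => hB.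
have lam0 : 0 <= lam by rewrite !mulr_ge0.
have step i : hyp R k m N0 i * expR (th * (C * (1 + (i%:R - k%:R / 2) ^+ 2 / (k + m)%:R))) <=
   hyp R k m N0 i * 1 + lam * (expR (64^-1) *
     (hyp R k m N0 i * expR (64^-1 * ((i%:R - k%:R / 2) ^+ 2 / (k + m)%:R)))).
  have -> : th * (C * (1 + (i%:R - k%:R / 2) ^+ 2 / (k + m)%:R)) =
    lam * (64^-1 + 64^-1 * ((i%:R - k%:R / 2) ^+ 2 / (k + m)%:R)).
    by rewrite /lam; move: ((i%:R - k%:R / 2) ^+ 2 / (k + m)%:R) => q; field.
  have l01 : 0 <= lam <= 1 by rewrite lam0.
  have f0 := hyp_ge0 R k m N0 i.
  have := ler_wpM2l f0 (expR_convex (64^-1 + 64^-1 * ((i%:R - k%:R / 2) ^+ 2 / (k + m)%:R)) l01).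
  have := mulr_ge0 f0 lam0; rewrite expRD; lra.
apply: le_trans; first by apply: ler_sum => i _; exact: (step i).
rewrite big_split /= -mulr_suml sum_hyp // mul1r lerD2l -!mulr_sumr ler_wpM2l //.
by apply: (@le_trans _ _ (expR (64^-1) * B0)); [rewrite ler_wpM2l ?expR_ge0 | rewrite le_max lexx orbT].
Qed.

Lemma expR_quarter : expR 4^-1 <= 4 / 3 :> R.
Proof.
have h := expR_ge1Dx (- 4^-1 : R); rewrite expRN in h.
have e0 := expR_gt0 (4^-1 : R).
have : expR 4^-1 * (1 - 4^-1) <= 1 :> R.
  by rewrite -[leRHS](divff (lt0r_neq0 e0)) ler_wpM2l // ltW.
lra.
Qed.

(** Here the 1 in the exponent of the second claim is spent: q <= 1/4 + q^2 leaves at most (11/20 +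
    4/3)e^{2q^2}, and 11/20 + 4/3 < 2 <= e. *)
Lemma expR_absorb (q : R) : (11 / 10) / 2 + (expR q * (2 * expR (q ^+ 2))) / 2 <=
  expR (1 + 2 * q ^+ 2).
Proof.
have e1 := expR_ge1Dx (1 : R).
have e2 : 1 <= expR (2 * q ^+ 2) by rewrite -expR0 ler_expR mulr_ge0 ?sqr_ge0.
have e3 : expR q <= expR (4^-1 + q ^+ 2).
  by rewrite ler_expR; have := sqr_ge0 (q - 2^-1); rewrite sqrrB; lra.
have e4 : expR q * expR (q ^+ 2) <= 4 / 3 * expR (2 * q ^+ 2).
  apply: (@le_trans _ _ (expR (4^-1 + q ^+ 2) * expR (q ^+ 2))).
    by rewrite ler_wpM2r ?expR_ge0.
  have -> : expR (4^-1 + q ^+ 2) * expR (q ^+ 2) = expR 4^-1 * expR (2 * q ^+ 2).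
    by rewrite -!expRD; congr expR; ring.
  by rewrite ler_wpM2r ?expR_ge0 ?expR_quarter.
have e5 : 2 * expR (2 * q ^+ 2) <= expR 1 * expR (2 * q ^+ 2).
  by rewrite ler_wpM2r ?expR_ge0 //; lra.
rewrite expRD; lra.
Qed.

(** [expR_mean] separates the quadratic part of the displacement, whose moment is at most 11/10,
    from the part linear in [sg]. The latter is a moment of |x| at rate t = 2 theta C sg; with q = t
    sqrt(n), [expR_absorb] recombines the two. *)
Lemma hyp_bias_moment C B k m N0 th sg : 0 < C -> 1 <= B ->
  (forall C' th', 0 <= th' -> 0 <= C' -> 64 * (th' * C') <= 1 ->
    \sum_(i < k.+1) hyp R k m N0 i *
    expR (th' * (C' * (1 + (i%:R - k%:R / 2) ^+ 2 / (k + m)%:R))) <= 1 + 64 * (th' * C') * B) ->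
  (k + m = 2 * N0)%N -> (0 < m)%N -> 0 <= sg <= 1 -> 0 <= th ->
  64 * 20 * (th * (C * B)) <= 1 ->
  \sum_(i < k.+1) hyp R k m N0 i *
    expR (th * (C * (1 + sg * Num.sqrt (k + m)%:R + sg * `|i%:R - k%:R / 2| +
       (i%:R - k%:R / 2) ^+ 2 / (k + m)%:R))) <=
  expR (1 + 8 * C ^+ 2 * th ^+ 2 * (sg ^+ 2 * (k + m)%:R)).
Proof.
move=> C0 B1 HB nN m0 /andP[s0 s1] th0 hth.
have NN : (N0 <= k + m)%N by rewrite nN mul2n -addnn leq_addr.
have thC : 0 <= th * C by rewrite mulr_ge0 // ltW.
have thB : th * C <= th * (C * B) by rewrite mulrA ler_peMr.
have n0 : 0 <= (k + m)%:R :> R by exact: ler0n.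
set r := Num.sqrt (k + m)%:R.
have r0 : 0 <= r by exact: sqrtr_ge0.
have r2 : r ^+ 2 = (k + m)%:R by rewrite sqr_sqrtr.
pose t := 2 * (th * C) * sg.
have t0 : 0 <= t by rewrite /t mulr_ge0 // mulr_ge0.
have t1 : t <= 1 / 2.
  apply: (@le_trans _ _ (2 * (th * C))); last lra.
  by rewrite /t ler_piMr // mulr_ge0.
have HA := hyp_absmgf m0 NN t0 t1; rewrite hyp_mean_half ?addn_gt0 ?m0 ?orbT // in HA.
have HQ : 64 * (2 * th * C) <= 1 by lra.
have {}HB := HB C (2 * th) (mulr_ge0 (ler0n _ _) th0) (ltW C0) HQ.
have step i : hyp R k m N0 i * expR (th * (C * (1 + sg * r + sg * `|i%:R - k%:R / 2| +
       (i%:R - k%:R / 2) ^+ 2 / (k + m)%:R))) <=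
    (hyp R k m N0 i * expR (2 * th * (C * (1 + (i%:R - k%:R / 2) ^+ 2 / (k + m)%:R)))) / 2 +
    expR (t * r) * (hyp R k m N0 i * expR (t * `|i%:R - k%:R / 2|)) / 2.
  have -> : expR (t * r) * (hyp R k m N0 i * expR (t * `|i%:R - k%:R / 2|)) / 2 =
     hyp R k m N0 i * (expR (2 * (th * C * sg * (r + `|i%:R - k%:R / 2|))) / 2).
    have -> : 2 * (th * C * sg * (r + `|i%:R - k%:R / 2|)) = t * r + t * `|i%:R - k%:R / 2|.
      by rewrite /t; ring.
    by rewrite expRD; ring.
  have -> x : hyp R k m N0 i * x / 2 = hyp R k m N0 i * (x / 2) by rewrite mulrA.
  rewrite -mulrDr ler_wpM2l ?hyp_ge0 //.
  set q := (_ ^+ 2 / _).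
  have -> : 2 * th * (C * (1 + q)) = 2 * (th * C * (1 + q)) by ring.
  apply: le_trans (expR_mean _ _); rewrite ler_expR; lra.
apply: le_trans; first by apply: ler_sum => i _; exact: (step i).
rewrite big_split /= -!mulr_suml -mulr_sumr.
have q2 : (k + m)%:R * t ^+ 2 = (t * r) ^+ 2 by rewrite -r2; ring.
rewrite q2 in HA.
have -> : 8 * C ^+ 2 * th ^+ 2 * (sg ^+ 2 * (k + m)%:R) = 2 * (t * r) ^+ 2.
  by rewrite -r2 /t; ring.
apply: le_trans (expR_absorb _).
have HB' : 1 + 64 * (2 * th * C) * B <= 11 / 10 by lra.
have HA' := ler_wpM2l (expR_ge0 (t * r)) HA.
apply: lerD; rewrite ler_wpM2r ?invr_ge0 //.
by apply: le_trans HB'.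
Qed.

End ExponentialMoments.

Lemma law_sum_const (R : realType) (M : nat) (f : nat -> R) (c : R) :
  law M f -> \sum_(i < M) f i * c = c.
Proof. by move=> [_ _ f1]; rewrite -mulr_suml f1 mul1r. Qed.

(** * The two couplings of bridges *)

Section Couplings.
Context (d : measure_display) (T : measurableType d) (R : realType).
Variables (P : probability T R) (X : nat -> {RV P >-> R}).
Hypothesis iid : iid_fair_signs X.
Local Open Scope classical_set_scope.

Lemma shifted_bridge_lawE k m N (s : int) (c : R) A : measurable A -> (N <= k + m)%N ->
  s%:~R = 2 * N%:R - (k + m)%:R :> R ->
  shifted_law (bridge_law X k (k + m) s) c A =
  (\sum_(a < k.+1) hyp R k m N a * \1_A (2 * a%:R - k%:R - c))%:E.
Proof.
move=> mA Nn sE; rewrite /shifted_law (bridge_lawE iid _ Nn sE) //.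
have mf : measurable_fun setT (fun x : R => x - c) by exact: measurable_funB.
by rewrite -[X in measurable X]setTI; exact: mf.
Qed.

Lemma scale_coupling (C B Theta : R) k m N0 : (k + m = 2 * N0)%N -> (0 < m)%N ->
  0 <= C -> 0 <= B -> 64 * 20 * (Theta * (C * B)) <= 1 -> 64 * 20 * (Theta * C) <= 1 ->
  (forall i j, (i <= k)%N ->
    cumul (hyp R (4 * k) (4 * m) (4 * N0)) j < cumul (hyp R k m N0) i.+1 ->
    cumul (hyp R k m N0) i < cumul (hyp R (4 * k) (4 * m) (4 * N0)) j.+1 ->
    `|2 * (i%:R - k%:R / 2) - (j%:R - 2 * k%:R)| <=
    C * (1 + (i%:R - k%:R / 2) ^+ 2 / (k + m)%:R)) ->
  (forall C' th, 0 <= th -> 0 <= C' -> 64 * (th * C') <= 1 ->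
    \sum_(i < k.+1) hyp R k m N0 i *
    expR (th * (C' * (1 + (i%:R - k%:R / 2) ^+ 2 / (k + m)%:R))) <= 1 + 64 * (th * C') * B) ->
  exists (Q : probability nat R) (U V : {RV Q >-> R}),
    is_coupling U V (bridge_law X k (k + m) 0) (bridge_law X (4 * k)%N (4 * (k + m))%N 0) /\
    forall theta : R, theta <= Theta ->
      ('E_Q[fun w => expR (theta * `|2 * U w - V w|)%R] <= (3 / 2)%:E)%E.
Proof.
move=> nN m0 C0 B0 TB TC disp mom.
have NN : (N0 <= k + m)%N by rewrite nN mul2n -addnn leq_addr.
have N4 : (4 * N0 <= 4 * k + 4 * m)%N by rewrite -mulnDr leq_mul.
have s1 : (0 : int)%:~R = 2 * N0%:R - (k + m)%:R :> R by rewrite nN natrM mulr0z; ring.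
have s4 : (0 : int)%:~R = 2 * (4 * N0)%:R - (4 * k + 4 * m)%:R :> R.
  by rewrite -mulnDr nN !natrM mulr0z; ring.
have [Q [U [V [hU hV hE _]]]] := monotone_coupling
  (fun i => 2 * i%:R - k%:R) (fun j => 2 * j%:R - (4 * k)%:R) (hyp_law R NN) (hyp_law R N4).
exists Q, U, V; split.
  move=> A mA; split; first by rewrite hU (bridge_lawE iid mA NN s1).
  by rewrite hV mulnDr (bridge_lawE iid mA N4 s4).
move=> th thT.
have psi0 (x y : R) : 0 <= expR (th * `|2 * x - y|) by exact: expR_ge0.
(* Negative theta is allowed too; the integrand is then at most 1. *)
have [th0|th0] := ltP th 0.
  apply: (le_trans (hE (fun x y => expR (th * `|2 * x - y|)) (fun=> 1) psi0 _)).
    by move=> i j _ _ _ _; rewrite expR_le1 mulr_le0_ge0 // ltW.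
  by rewrite lee_fin (law_sum_const _ (hyp_law R NN)); lra.
have thC : 0 <= th * C by rewrite mulr_ge0.
have thC2 : th * C <= Theta * C by rewrite ler_wpM2r.
have thB2 : th * (C * B) <= Theta * (C * B) by rewrite ler_wpM2r // mulr_ge0.
apply: (le_trans (hE (fun x y => expR (th * `|2 * x - y|))
  (fun i => expR (th * (2 * C * (1 + (i%:R - k%:R / 2) ^+ 2 / (k + m)%:R)))) psi0 _)).
  move=> i j ik _ h1 h2; rewrite ler_expR ler_wpM2l //.
  have := disp i j ik h1 h2.
  have -> : 2 * (2 * i%:R - k%:R) - (2 * j%:R - (4 * k)%:R) =
     2 * (2 * (i%:R - k%:R / 2) - (j%:R - 2 * k%:R)) :> R by rewrite natrM; field.
  by rewrite normrM (ger0_norm (x := 2)) // -mulrA; lra.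
rewrite lee_fin; apply: (le_trans (mom _ _ th0 _ _)); rewrite ?mulr_ge0 //; lra.
Qed.

Lemma bias_coupling (C B Theta M e1 : R) k m N N0 (s : int) :
  (k + m = 2 * N0)%N -> (0 < m)%N -> (N <= k + m)%N ->
  s%:~R = 2 * N%:R - (k + m)%:R :> R ->
  0 < C -> 1 <= B -> 0 < e1 ->
  64 * 20 * (Theta * (2 * C * B)) <= 1 -> 64 * 20 * (Theta * 1) <= 1 ->
  8 * (2 * C) ^+ 2 <= M -> 16 / e1 ^+ 2 <= M ->
  (forall sg : R, sg = `|2 * N%:R - (k + m)%:R| / (k + m)%:R -> sg <= e1 ->
    forall i j, (i <= k)%N ->
    cumul (hyp R k m N) j < cumul (hyp R k m N0) i.+1 ->
    cumul (hyp R k m N0) i < cumul (hyp R k m N) j.+1 ->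
    `|(i%:R - k%:R / 2) - (j%:R - hyp_mean R k m N)| <=
    C * (1 + sg * Num.sqrt (k + m)%:R + sg * `|i%:R - k%:R / 2| +
       (i%:R - k%:R / 2) ^+ 2 / (k + m)%:R)) ->
  (forall C' th, 0 <= th -> 0 <= C' -> 64 * (th * C') <= 1 ->
    \sum_(i < k.+1) hyp R k m N0 i *
    expR (th * (C' * (1 + (i%:R - k%:R / 2) ^+ 2 / (k + m)%:R))) <= 1 + 64 * (th * C') * B) ->
  exists (Q : probability nat R) (U V : {RV Q >-> R}),
    is_coupling U V (bridge_law X k (k + m) 0)
      (shifted_law (bridge_law X k (k + m) s) (s%:~R * k%:R / (k + m)%:R)) /\
    forall theta : R, theta <= Theta ->
      ('E_Q[fun w => expR (theta * `|U w - V w|)%R]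
        <= (expR (1 + M * theta ^+ 2 * (s%:~R ^+ 2 / (k + m)%:R)))%:E)%E.
Proof.
move=> nN m0 Nn sE C0 B1 e10 TB T8 M1 M2 disp mom.
have n0 : 0 < (k + m)%:R :> R by rewrite ltr0n addn_gt0 m0 orbT.
have NN : (N0 <= k + m)%N by rewrite nN mul2n -addnn leq_addr.
have s1 : (0 : int)%:~R = 2 * N0%:R - (k + m)%:R :> R by rewrite nN natrM mulr0z; ring.
have [sg sgE] : exists sg : R, sg = `|2 * N%:R - (k + m)%:R| / (k + m)%:R by eexists.
have sg0 : 0 <= sg by rewrite sgE divr_ge0 // ltW.
have sg1 : sg <= 1.
  rewrite sgE ler_pdivrMr // mul1r ler_norml.
  have : N%:R <= (k + m)%:R :> R by rewrite ler_nat.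
  by have := ler0n R N; move=> *; apply/andP; split; lra.
have sq : s%:~R ^+ 2 / (k + m)%:R = sg ^+ 2 * (k + m)%:R :> R.
  rewrite sE sgE exprMn real_normK ?num_real //.
  by move: ((k + m)%:R) (lt0r_neq0 n0) => n nz; field.
rewrite sq.
have cE : s%:~R * k%:R / (k + m)%:R = 2 * hyp_mean R k m N - k%:R.
  by rewrite sE /hyp_mean; move: ((k + m)%:R) (lt0r_neq0 n0) => n nz; field.
rewrite cE.
have [Q [U [V [hU hV hE hE2]]]] := monotone_coupling
  (fun i => 2 * i%:R - k%:R) (fun j => 2 * j%:R - k%:R - (2 * hyp_mean R k m N - k%:R))
  (hyp_law R NN) (hyp_law R Nn).
exists Q, U, V; split.
  move=> A mA; split; first by rewrite hU (bridge_lawE iid mA NN s1).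
  by rewrite hV (shifted_bridge_lawE _ mA Nn sE).
move=> th thT.
have M0 : 0 <= M by apply: le_trans M1; rewrite mulr_ge0 // sqr_ge0.
have ex0 : 0 <= M * th ^+ 2 * (sg ^+ 2 * (k + m)%:R).
  by apply: mulr_ge0; apply: mulr_ge0; rewrite ?sqr_ge0 // ltW.
have psi0 (x y : R) : 0 <= expR (th * `|x - y|) by exact: expR_ge0.
have [th0|th0] := ltP th 0.
  apply: (le_trans (hE (fun x y => expR (th * `|x - y|)) (fun=> 1) psi0 _)).
    by move=> i j _ _ _ _; rewrite expR_le1 mulr_le0_ge0 // ltW.
  by rewrite lee_fin (law_sum_const _ (hyp_law R NN)) -[leLHS]expR0 ler_expR addr_ge0.
have dE i j : (2 * i%:R - k%:R) - (2 * j%:R - k%:R - (2 * hyp_mean R k m N - k%:R)) =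
   2 * ((i%:R - k%:R / 2) - (j%:R - hyp_mean R k m N)) :> R by field.
have [sge|sge] := leP sg e1.
  apply: (le_trans (hE (fun x y => expR (th * `|x - y|))
    (fun i => expR (th * (2 * C * (1 + sg * Num.sqrt (k + m)%:R + sg * `|i%:R - k%:R / 2| +
       (i%:R - k%:R / 2) ^+ 2 / (k + m)%:R)))) psi0 _)).
    move=> i j ik _ h1 h2; rewrite ler_expR ler_wpM2l //.
    have := disp sg sgE sge i j ik h1 h2.
    by rewrite dE normrM (ger0_norm (x := 2)) // -mulrA => h; rewrite ler_wpM2l.
  have thB : 64 * 20 * (th * (2 * C * B)) <= 1.
    have CB0 : 0 <= 2 * C * B by rewrite mulr_ge0 //; lra.
    by have := ler_wpM2r CB0 thT; lra.
  have C2 : 0 < 2 * C by rewrite mulr_gt0.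
  have sgr : 0 <= sg <= 1 by rewrite sg0.
  rewrite lee_fin; apply: (le_trans (hyp_bias_moment C2 B1 mom nN m0 sgr th0 thB)).
  rewrite ler_expR lerD2l ler_wpM2r //; first by rewrite mulr_ge0 ?sqr_ge0 // ltW.
  by rewrite ler_wpM2r ?sqr_ge0.
(* Beyond e1 the triangle inequality and [expR_mean] leave two centred absolute moments at rate 4
   theta. *)
apply: (le_trans (hE2 (fun x y => expR (th * `|x - y|))
  (fun i => expR (4 * th * `|i%:R - k%:R / 2|) / 2)
  (fun j => expR (4 * th * `|j%:R - hyp_mean R k m N|) / 2) psi0 _)).
  move=> i j; rewrite dE normrM (ger0_norm (x := 2)) //.
  set x := i%:R - _; set y := j%:R - _.
  have -> : 4 * th * `|x| = 2 * (2 * th * `|x|) by ring.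
  have -> : 4 * th * `|y| = 2 * (2 * th * `|y|) by ring.
  apply: le_trans (expR_mean _ _); rewrite ler_expR.
  have := ler_wpM2l th0 (ler_normB x y); lra.
have t0 : 0 <= 4 * th by rewrite mulr_ge0.
have t1 : 4 * th <= 1 / 2 by lra.
have h1 := hyp_absmgf m0 NN t0 t1; have h2 := hyp_absmgf m0 Nn t0 t1.
rewrite hyp_mean_half ?addn_gt0 ?m0 ?orbT // in h1.
rewrite lee_fin.
have e1' := expR_ge1Dx (1 : R).
(* Since s^2/n = sg^2 n > e1^2 n, the choice M >= 16/e1^2 pays for n(4 theta)^2. *)
have big : expR ((k + m)%:R * (4 * th) ^+ 2) <= expR (M * th ^+ 2 * (sg ^+ 2 * (k + m)%:R)).
  rewrite ler_expR.
  have -> : (k + m)%:R * (4 * th) ^+ 2 = 16 * (th ^+ 2 * (k + m)%:R) by ring.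
  have -> : M * th ^+ 2 * (sg ^+ 2 * (k + m)%:R) = M * sg ^+ 2 * (th ^+ 2 * (k + m)%:R) by ring.
  rewrite ler_wpM2r ?mulr_ge0 ?sqr_ge0 ?(ltW n0) //.
  have e2 : 0 < e1 ^+ 2 by rewrite exprn_gt0.
  move: M2; rewrite ler_pdivrMr // => /le_trans; apply; rewrite ler_wpM2l //.
  by rewrite lerXn2r ?nnegrE ?(ltW e10) ?(ltW sge).
under eq_bigr do rewrite mulrA; under [X in _ + X]eq_bigr do rewrite mulrA.
rewrite -!mulr_suml expRD.
have g0 := expR_ge0 (M * th ^+ 2 * (sg ^+ 2 * (k + m)%:R)).
have : 2 * expR (M * th ^+ 2 * (sg ^+ 2 * (k + m)%:R)) <=
  expR 1 * expR (M * th ^+ 2 * (sg ^+ 2 * (k + m)%:R)) by rewrite ler_wpM2r //; lra.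
lra.
Qed.

End Couplings.

Lemma small_scale (R : realType) (K A : R) : 0 < K -> 0 < A ->
  exists2 th : R, 0 < th & forall c, 0 <= c -> c <= A -> K * (th * c) <= 1.
Proof.
move=> K0 A0; exists (K * A)^-1; first by rewrite invr_gt0 mulr_gt0.
move=> c c0 cA; have -> : K * ((K * A)^-1 * c) = c / A.
  by field; rewrite !gt_eqF.
by rewrite ler_pdivrMr // mul1r.
Qed.

Theorem theorem6 (R : realType) :
  exists Theta M : R, 0 < Theta /\
    forall (d : measure_display) (T : measurableType d)
      (P : probability T R) (X : nat -> {RV P >-> R}),
    iid_fair_signs X ->
    forall (n k : nat) (s : int),
    (0 < n)%N -> ~~ odd n ->
    1 / 3 * n%:R <= k%:R :> R -> k%:R <= 2 / 3 * n%:R :> R ->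
    probable X n s ->
    let W1 := bridge_law X k n 0 in
    let W2 := bridge_law X (4 * k)%N (4 * n)%N 0 in
    let W := shifted_law (bridge_law X k n s) (s%:~R * k%:R / n%:R) in
    (exists (d1 : measure_display) (T1 : measurableType d1)
       (Q : probability T1 R) (U V : {RV Q >-> R}),
       is_coupling U V W1 W2 /\
       forall theta : R, theta <= Theta ->
         ('E_Q[fun w => expR (theta * `|2 * U w - V w|)%R] <= (3 / 2)%:E)%E) /\
    (exists (d2 : measure_display) (T2 : measurableType d2)
       (Q : probability T2 R) (U V : {RV Q >-> R}),
       is_coupling U V W1 W /\
       forall theta : R, theta <= Theta ->
         ('E_Q[fun w => expR (theta * `|U w - V w|)%R]
            <= (expR (1 + M * theta ^+ 2 * (s%:~R ^+ 2 / n%:R)))%:E)%E).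
Proof.
have [e1 [Cb [e10 Cb0 Hb]]] := bias_displacement R.
have [Cs [Cs0 Hs]] := scale_displacement R.
have [B [B1 HB]] := hyp_quadratic_moment R.
(* L B dominates Cs B, Cs, 2 Cb B and 1, so a single Theta meets all four smallness conditions. *)
have [L LE] : exists L : R, L = Cs + 2 * Cb + 1 by eexists.
have L1 : 1 <= L by lra.
have LB1 : 1 <= L * B by rewrite mulr_ege1.
have K0 : 0 < 64 * 20 :> R by rewrite mulr_gt0 // ltr0n.
have [Th Th0 mono] := small_scale K0 (lt_le_trans ltr01 LB1).
(* The two summands of M serve small bias and bias of order n respectively. *)
exists Th, (8 * (2 * Cb) ^+ 2 + 16 / e1 ^+ 2); split => //.
move=> d T P X iid n k s n0 en hk1 hk2 prob W1 W2 W.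
have n0R : 0 < n%:R :> R by rewrite ltr0n.
have kn : (k <= n)%N by rewrite -(ler_nat R); lra.
have [m nE] : exists m, (n = k + m)%N by exists (n - k)%N; rewrite subnKC.
have nN : (k + m = 2 * n./2)%N by rewrite -nE -[LHS]odd_double_half (negbTE en) add0n mul2n.
rewrite {}/W {}/W2 {}/W1 nE in hk1 hk2 prob n0R *.
have kmE : (k + m)%:R = k%:R + m%:R :> R by rewrite natrD.
have hk : (k + m)%:R <= 3 * k%:R :> R by lra.
have hm : (k + m)%:R <= 3 * m%:R :> R by lra.
have k0 : (0 < k)%N by rewrite -(ltr0n R); lra.
have m0 : (0 < m)%N by rewrite -(ltr0n R); lra.
have LL : L <= L * B by rewrite ler_peMr //; lra.
have CsB : Cs * B <= L * B by rewrite ler_wpM2r //; lra.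
have CbB : 2 * Cb * B <= L * B by rewrite ler_wpM2r //; lra.
have T1 : 64 * 20 * (Th * (Cs * B)) <= 1 by apply: mono => //; rewrite mulr_ge0 //; lra.
have T2 : 64 * 20 * (Th * Cs) <= 1 by apply: mono; lra.
have T3 : 64 * 20 * (Th * (2 * Cb * B)) <= 1 by apply: mono => //; rewrite mulr_ge0 //; lra.
have T4 : 64 * 20 * (Th * 1) <= 1 by apply: mono => //; lra.
have B0 : 0 <= B by lra.
split.
  eexists; eexists; apply: (scale_coupling iid (C := Cs) (B := B) nN m0 (ltW Cs0) B0 T1 T2).
    exact: Hs.
  exact: HB.
have [N Nn sE] := probable_parity iid prob.
eexists; eexists; apply: (bias_coupling iid (C := Cb) (B := B) (e1 := e1) nN m0 Nn sE Cb0 B1 e10 T3 T4).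
- by rewrite lerDl divr_ge0 ?sqr_ge0.
- by rewrite lerDr mulr_ge0 ?sqr_ge0.
- exact: Hb.
- exact: HB.
Qed.
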